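(* Let $\mathcal U,\mathcal Y$ be separable Hilbert spaces. Suppose that $A\in\mathcal L(\mathcal X)$ is the main operator of a passive system $\Sigma=(T_\Sigma;\mathcal X,\mathcal U,\mathcal Y;\kappa)$ such that the index of the transfer function of $\Sigma$ is $\kappa$ (i.e. $\theta_\Sigma\in\mathbf S_\kappa(\mathcal U,\mathcal Y)$). Then there exist unique fundamental decompositions $\mathcal X=\mathcal X_1^+\oplus\mathcal X_1^-=\mathcal X_2^+\oplus\mathcal X_2^-$ such that $A\mathcal X_1^+\subset\mathcal X_1^+$ and $A\mathcal X_2^-\subset\mathcal X_2^-$, respectively.
   Context: All spaces are complex and separable. A Pontryagin space $\mathcal X$ is a vector space with a Hermitian indefinite inner product admitting a fundamental decomposition, i.e. an orthogonal decomposition $\mathcal X=\mathcal X^+\oplus\mathcal X^-$ where $(\mathcal X^{\pm},\pm\langle\cdot,\cdot\rangle)$ are Hilbert spaces, with $\dim\mathcal X^-<\infty$; its negative index is $\dim \mathcal X^-$. Fundamental decompositions are in general not unique. $\mathcal L(\cdot,\cdot)$ denotes linear operators continuous in the Hilbert space topology of $\mathcal X^+\oplus(-\mathcal X^-)$. $T$ is a contraction if $\langle Tx,Tx\rangle\le\langle x,x\rangle$ for all $x$. Generalized Schur class: $\mathbf S_\kappa(\mathcal U,\mathcal Y)$ (functions of index $\kappa$) is the set of $\mathcal L(\mathcal U,\mathcal Y)$-valued functions $S$ meromorphic in the unit disc $\mathbb D$ and holomorphic near $0$ such that the kernel $K_S(w,z)=\frac{1-S(z)S(w)^*}{1-z\bar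 w}$ has $\kappa$ negative squares, i.e. every Hermitian matrix $(\langle K_S(w_j,w_i)f_j,f_i\rangle)_{i,j=1}^n$ with $w_i$ in the domain of holomorphy of $S$ and $f_i\in\mathcal Y$ has at most $\kappa$ negative eigenvalues, and some such matrix has exactly $\kappa$. System: $\Sigma=(T_\Sigma;\mathcal X,\mathcal U,\mathcal Y;\kappa)$ consists of a Pontryagin space $\mathcal X$ of negative index $\kappa$, Hilbert spaces $\mathcal U,\mathcal Y$, and $T_\Sigma=\begin{pmatrix}A&B\\C&D\end{pmatrix}\in\mathcal L(\mathcal X\oplus\mathcal U,\mathcal X\oplus\mathcal Y)$; $A$ is the main operator. It is passive if $T_\Sigma$ is a contraction. Its transfer function is $\theta_\Sigma(z)=D+zC(I-zA)^{-1}B$, defined near $0$ and identified with its meromorphic extension. *)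

(* Defs.v *)
From HB Require Import structures.
From mathcomp Require Import all_boot all_order all_algebra.
From mathcomp Require Import complex.
From mathcomp Require Import all_classical all_reals all_analysis.

Set Implicit Arguments.
Unset Strict Implicit.
Unset Printing Implicit Defensive.

Import Order.TTheory GRing.Theory Num.Theory.
Import numFieldNormedType.Exports.

Local Open Scope classical_set_scope.
Local Open Scope ring_scope.

Definition separable (T : topologicalType) : Prop :=
  exists2 D : set T, countable D & dense D.

(* Forms are linear in the first variable and conjugate-linear in the second.
   They are passed as plain functions here because fundamental_decomposition
   below uses both f and its opposite. *)
Section Forms.
Variables (R : realType) (V : lmodType R[i]).
Implicit Types (f : V -> V -> R[i]) (H P N : set V).

Definition form_norm f (x : V) : R[i] := sqrtC (f x x).

Definition hilbert_subspace f H : Prop :=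
  [/\ submod_closed (mem H),
      forall x, H x -> x != 0 -> 0 < f x x
    & forall u : nat -> V, (forall n, H (u n)) ->
        (forall e : R[i], 0 < e ->
           \forall m & n \near \oo, form_norm f (u m - u n) < e) ->
        exists2 l, H l &
          forall e : R[i], 0 < e ->
            \forall n \near \oo, form_norm f (u n - l) < e].

Definition has_dim N (k : nat) : Prop :=
  exists b : 'I_k -> V,
    N = [set x | exists c : 'I_k -> R[i], x = \sum_i c i *: b i] /\
    forall c : 'I_k -> R[i], \sum_i c i *: b i = 0 -> forall i, c i = 0.

(* The sum is automatically direct: a nonzero common vector x would satisfy
   both 0 < f x x and 0 < - f x x. *)
Definition fundamental_decomposition f P N : Prop :=
  [/\ forall x, exists p n, [/\ P p, N n & x = p + n],
      forall p n, P p -> N n -> f p n = 0,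
      hilbert_subspace f P,
      hilbert_subspace (fun x y => - f x y) N
    & exists k, has_dim N k].

End Forms.

Record hilbertSpace (R : realType) := HilbertSpace {
  hs_sort :> completeNormedModType R[i];
  hs_dot : {dot hs_sort for Num.conj};
  hs_normE : forall u : hs_sort, `|u| ^+ 2 = hs_dot u u;
  hs_separable : separable hs_sort }.

(* The norm of the carrier is the Hilbert space norm of P (+) (-N) for some
   fundamental decomposition (P, N).  All such norms are equivalent, so only
   the topology they induce is intrinsic, and this norm is used below only
   through continuity and density. *)
Record pontryaginSpace (R : realType) (kappa : nat) := PontryaginSpace {
  ps_sort :> completeNormedModType R[i];
  ps_form : {hermitian ps_sort for false & Num.conj};
  ps_decomposition : exists P N : set ps_sort,
    [/\ fundamental_decomposition ps_form P N,
        has_dim N kappa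
      & forall p n, P p -> N n ->
          `|p + n| ^+ 2 = ps_form p p - ps_form n n];
  ps_separable : separable ps_sort }.

Definition continuous_linear (R : realType) (V W : normedModType R[i])
  (T : V -> W) : Prop := linear T /\ continuous T.

(* Inverse in L(V) (junk value 0 when T is not invertible in L(V)). *)
Definition operator_inverse (R : realType) (V : normedModType R[i])
    (T : V -> V) : V -> V :=
  xget (fun=> 0) [set S | [/\ continuous_linear S, cancel T S & cancel S T]].

Section OperatorFunctions.
Variables (R : realType) (U Y : hilbertSpace R).
Implicit Types (T : U -> Y) (S : R[i] -> U -> Y).

(* The adjoint of T in L(U, Y) exists and is unique by the Riesz
   representation theorem. *)
Definition adjoint T : Y -> U :=
  xget (fun=> 0) [set T' | continuous_linear T' /\
    forall u y, hs_dot Y (T u) y = hs_dot U u (T' y)].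

(* Complex differentiability at z for the operator norm.  Neighborhoods are
   taken in R[i]^o, the alias of R[i] that carries the topology of the complex
   modulus. *)
Definition operator_derivable S (z : R[i]) : Prop :=
  exists2 S' : U -> Y, continuous_linear S' &
    forall e : R[i], 0 < e -> \forall h \near (0 : R[i]^o), forall u,
      `|S (z + h) u - S z u - h *: S' u| <= e * `|h| * `|u|.

Definition holomorphic_at S (a : R[i]) : Prop :=
  \forall z \near (a : R[i]^o),
    continuous_linear (S z) /\ operator_derivable S z.

Definition meromorphic_at S (a : R[i]) : Prop :=
  exists (n : nat) (G : R[i] -> U -> Y), holomorphic_at G a /\
    \forall z \near (a : R[i]^o)^', forall u, (z - a) ^+ n *: S z u = G z u.

Definition schur_kernel S (w z : R[i]) (y : Y) : Y :=
  (1 - z * w^*)^-1 *: (y - S z (adjoint (S w) y)).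

Definition kernel_matrix S n (w : 'I_n -> R[i]) (f : 'I_n -> Y) : 'M[R[i]]_n :=
  \matrix_(i, j) hs_dot Y (schur_kernel S (w j) (w i) (f j)) (f i).

(* Eigenvalues are counted with multiplicity.  In the order of R[i], a < 0
   means that a is real and negative. *)
Definition nb_negative_eigenvalues n (M : 'M[R[i]]_n) : nat :=
  count (fun a => a < 0) (sval (closed_field_poly_normal (char_poly M))).

(* S is a total function whose values at its poles are irrelevant; the points
   of the disc where S is holomorphic form its domain of holomorphy. *)
Definition holomorphy_domain S : set R[i] :=
  [set z | `|z| < 1 /\ holomorphic_at S z].

Definition has_negative_squares S (kappa : nat) : Prop :=
  (forall n (w : 'I_n -> R[i]) (f : 'I_n -> Y),
     (forall i, holomorphy_domain S (w i)) ->
     (nb_negative_eigenvalues (kernel_matrix S w f) <= kappa)%N) /\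
  (exists n (w : 'I_n -> R[i]) (f : 'I_n -> Y),
     (forall i, holomorphy_domain S (w i)) /\
     nb_negative_eigenvalues (kernel_matrix S w f) = kappa).

Definition generalized_schur (kappa : nat) S : Prop :=
  [/\ forall a : R[i], `|a| < 1 -> meromorphic_at S a,
      holomorphic_at S 0
    & has_negative_squares S kappa].

(* theta, given near 0, is identified with its meromorphic extension S. *)
Definition germ_in_generalized_schur (kappa : nat) (theta : R[i] -> U -> Y) :
    Prop :=
  exists2 S, generalized_schur kappa S &
    \forall z \near (0 : R[i]^o), forall u, S z u = theta z u.

End OperatorFunctions.

Section Systems.
Variables (R : realType) (kappa : nat).
Variables (X : pontryaginSpace R kappa) (U Y : hilbertSpace R).

Record system := System {
  sys_op :> {linear (X * U)%type -> (X * Y)%type};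
  sys_continuous : continuous sys_op }.

Variable Sigma : system.

Definition main_operator (x : X) : X := (Sigma (x, 0)).1.
Definition input_operator (u : U) : X := (Sigma (0, u)).1.
Definition output_operator (x : X) : Y := (Sigma (x, 0)).2.
Definition feedthrough_operator (u : U) : Y := (Sigma (0, u)).2.

Definition passive : Prop := forall (x : X) (u : U),
  ps_form X (Sigma (x, u)).1 (Sigma (x, u)).1
    + hs_dot Y (Sigma (x, u)).2 (Sigma (x, u)).2
  <= ps_form X x x + hs_dot U u u.

Definition transfer_function (z : R[i]) (u : U) : Y :=
  feedthrough_operator u + z *: output_operator
    (operator_inverse (fun x => x - z *: main_operator x) (input_operator u)).

End Systems.

(* Main.v *)
Require Import Defs.
From HB Require Import structures.
From mathcomp Require Import all_boot all_order all_algebra.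
From mathcomp Require Import complex finmap.
From mathcomp Require Import all_classical all_reals all_analysis.
From mathcomp Require Import ring lra.

(** Let [f] be the form of the state space [X], of negative index [kappa], and
    [A], [C] the main and output operators. Passivity gives
    [f (A x) (A x) + |C x|^2 <= f x x]: squares decrease along orbits, and where
    they stagnate the output vanishes. Everything rests on observability
    ([passive_unobservable]): if [C A^j x = 0] for all [j] and [f x x <= 0],
    then [x = 0].

    Observability. On the free space on pairs [(w, y)], let [h] be the form with
    Gram matrices [<K_S(w, z) y, y'>]. Diagonalizing these matrices shows that [h]
    has a maximal negative definite family of [kappa] vectors ([schur_frame]).
    Such a family exists even among the points near [0] ([localize]): the disc
    automorphisms act on the kernel as contractions that are bounded for the norm
    of a frame, and kernel functions are eigenvectors of these actions up to
    kernel functions near [0]. Iterating them shows that [kappa + 1] kernel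
    functions are linearly dependent modulo the closure of those near [0], a
    single automorphism separates the points of such a dependence, and by
    continuity a point outside the closure would not be isolated. For [w] near
    [0], let [g (w, y)] represent the functional [x |-> <C (1 - w A)^-1 x, y>] on
    [X]. Since the adjoint of the system operator is a contraction as well
    ([adjoint_contraction]), the defect [h a a - f (g a) (g a)] decreases along
    the adjoint of the multiplication by [z], whose powers tend to zero near [0];
    so the defect is nonnegative ([defect_ge0]). Hence [g] maps the negative
    family near [0] to one of [kappa] vectors of [X]. These are orthogonal to all
    unobservable vectors, which therefore have positive squares unless they
    vanish.

    The positive subspace. Observability is uniform ([almost_unobservable], by
    weak compactness). Hence on the set [posinv] of vectors whose orbits stay in
    the nonnegative cone the norm is equivalent to the square ([posinv_hilbert]),
    and [posinv] is a Hilbert space. Every vector enters [posinv] after a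
    correction from the span of a frame ([posinv_cover]), by compactness of the
    set of corrections that work for finitely many steps. So [posinv] is the
    positive part of a fundamental decomposition, and it contains every invariant
    positive subspace.

    The negative subspace. The set [neginv] of vectors with a backward orbit
    tending to zero contains every invariant negative subspace. Its dimension is
    [kappa]: backward orbits with prescribed coordinates with respect to a frame
    are weak limits of finite orbits that start in the span of the frame, and
    these are uniformly bounded by observability ([backward_bound]). *)

Set Implicit Arguments.
Unset Strict Implicit.
Unset Printing Implicit Defensive.

Import Order.TTheory GRing.Theory Num.Theory.
Import numFieldNormedType.Exports.

Local Open Scope classical_set_scope.
Local Open Scope ring_scope.

(** * Real parts and moduli *)

Notation re := (@complex.Re _).

Definition sqn {R : realType} (z : R[i]) : R := re z ^+ 2 + complex.Im z ^+ 2.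

Section Complex.
Variable R : realType.
Implicit Types (z w : R[i]) (r : R).

Lemma reD z w : re (z + w) = re z + re w. Proof. by case: z w => [? ?] []. Qed.
Lemma reN z : re (- z) = - re z. Proof. by case: z. Qed.
Lemma reB z w : re (z - w) = re z - re w. Proof. by rewrite reD reN. Qed.
Lemma re0 : re (0 : R[i]) = 0. Proof. by []. Qed.
Lemma re_sum (I : Type) (s : seq I) (P : pred I) (F : I -> R[i]) :
  re (\sum_(i <- s | P i) F i) = \sum_(i <- s | P i) re (F i).
Proof. exact: (big_morph _ reD re0). Qed.
Lemma re_conj z : re z^* = re z. Proof. by case: z. Qed.
Lemma reMr r z : re (r%:C%C * z) = r * re z.
Proof. by case: z => a b /=; rewrite mul0r subr0. Qed.

Lemma conj_real r : (r%:C%C)^* = r%:C%C.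
Proof. by apply/eqP; rewrite eq_complex /= oppr0 !eqxx. Qed.

Lemma mulcJ z : z * z^* = (sqn z)%:C%C.
Proof.
case: z => a b; apply/eqP; rewrite eq_complex /sqn /=.
by apply/andP; split; apply/eqP; ring.
Qed.

Lemma mulJc z : z^* * z = (sqn z)%:C%C. Proof. by rewrite mulrC mulcJ. Qed.

Lemma sqn_ge0 z : 0 <= sqn z. Proof. by rewrite /sqn addr_ge0 ?sqr_ge0. Qed.
Lemma sqn0 : sqn (0 : R[i]) = 0. Proof. by rewrite /sqn /= expr0n /= addr0. Qed.
Lemma sqn_eq0 z : (sqn z == 0) = (z == 0).
Proof.
rewrite /sqn paddr_eq0 ?sqr_ge0// !sqrf_eq0.
by case: z => a b; rewrite eq_complex.
Qed.
Lemma sqn_gt0 z : (0 < sqn z) = (z != 0).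
Proof. by rewrite lt_def sqn_ge0 andbT sqn_eq0. Qed.
Lemma sqnM z w : sqn (z * w) = sqn z * sqn w.
Proof. by case: z w => [a b] [c d]; rewrite /sqn /=; ring. Qed.
Lemma sqn_conj z : sqn z^* = sqn z.
Proof. by case: z => a b; rewrite /sqn /=; ring. Qed.
Lemma sqnN z : sqn (- z) = sqn z.
Proof. by case: z => a b; rewrite /sqn /=; ring. Qed.
Lemma sqn_real r : sqn r%:C%C = r ^+ 2.
Proof. by rewrite /sqn /=; ring. Qed.
Lemma sqnD_le z w : sqn (z + w) <= 2 * sqn z + 2 * sqn w.
Proof.
rewrite -subr_ge0; have -> : 2 * sqn z + 2 * sqn w - sqn (z + w) = sqn (z - w).
  by case: z w => [a b] [c d]; rewrite /sqn /=; ring.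
exact: sqn_ge0.
Qed.
Lemma re_sqr_le z : re z ^+ 2 <= sqn z.
Proof. by rewrite /sqn lerDl sqr_ge0. Qed.
Lemma normc_sqn z : `|z| ^+ 2 = (sqn z)%:C%C.
Proof. by rewrite -add_Re2_Im2. Qed.
Lemma sqnV z : sqn z^-1 = (sqn z)^-1.
Proof.
have [->|z0] := eqVneq z 0; first by rewrite invr0 sqn0 invr0.
apply: (mulfI (x := sqn z)); first by rewrite sqn_eq0.
by rewrite -sqnM !mulfV ?sqn_eq0// /sqn /= expr1n expr0n /= addr0.
Qed.

Lemma complex_eq_re z w : (forall a : R[i], re (a * z) = re (a * w)) -> z = w.
Proof.
case: z w => [a b] [c d] H; apply/eqP; rewrite eq_complex /=.
have := H 1; have := H 'i%C; rewrite /= !mul0r !mul1r !sub0r !subr0.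
by move=> /oppr_inj -> ->; rewrite !eqxx.
Qed.

Lemma real_gt0P z : 0 < z -> exists2 r : R, 0 < r & z = r%:C%C.
Proof.
case: z => a b; rewrite ltcE /= => /andP[/eqP -> a0]; by exists a.
Qed.

End Complex.

Lemma sqnX (R : realType) (z : R[i]) k : sqn (z ^+ k) = sqn z ^+ k.
Proof.
elim: k => [|k IH]; last by rewrite !exprS sqnM IH.
by rewrite !expr0 /sqn /= expr1n expr0n addr0.
Qed.

(** * Hermitian forms and their negative orthonormal families *)

Definition hermitian_form (R : realType) (E : lmodType R[i])
    (h : E -> E -> R[i]) : Prop :=
  (forall a x y z, h (a *: x + y) z = a * h x z + h y z) /\
  (forall x y, h y x = (h x y)^*).

Definition quad (R : realType) (E : lmodType R[i]) (h : E -> E -> R[i])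
  (x : E) : R := re (h x x).

Definition lincomb (R : realType) (E : lmodType R[i]) k (v : 'I_k -> E)
  (c : 'I_k -> R[i]) : E := \sum_i c i *: v i.

Definition lspan (R : realType) (E : lmodType R[i]) k (v : 'I_k -> E) : set E :=
  [set x | exists c : 'I_k -> R[i], x = lincomb v c].

Lemma linear_0 (R : realType) (E F : lmodType R[i]) (T : E -> F) :
  linear T -> T 0 = 0.
Proof. by move=> TL; have := TL (-1) 0 0; rewrite scaler0 addr0 scaleN1r addNr. Qed.

Lemma linear_D (R : realType) (E F : lmodType R[i]) (T : E -> F) x y :
  linear T -> T (x + y) = T x + T y.
Proof. by move=> TL; have := TL 1 x y; rewrite !scale1r. Qed.

Lemma linear_Z (R : realType) (E F : lmodType R[i]) (T : E -> F) a x :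
  linear T -> T (a *: x) = a *: T x.
Proof. by move=> TL; have := TL a x 0; rewrite (linear_0 TL) !addr0. Qed.

Section LinComb.
Variables (R : realType) (E : lmodType R[i]).

Lemma lincombD k (v : 'I_k -> E) c d :
  lincomb v c + lincomb v d = lincomb v (fun i => c i + d i).
Proof. by rewrite -big_split; apply: eq_bigr => i _; rewrite scalerDl. Qed.

Lemma lincombZ k (v : 'I_k -> E) a c :
  a *: lincomb v c = lincomb v (fun i => a * c i).
Proof. by rewrite scaler_sumr; apply: eq_bigr => i _; rewrite scalerA. Qed.

Lemma lincomb0 k (v : 'I_k -> E) : lincomb v (fun=> 0) = 0.
Proof. by rewrite /lincomb big1// => i _; rewrite scale0r. Qed.

Lemma lincomb_delta k (v : 'I_k -> E) j : lincomb v (fun i => (i == j)%:R) = v j.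
Proof.
rewrite /lincomb (bigD1 j)//= eqxx scale1r big1 ?addr0// => i /negPf ->.
by rewrite scale0r.
Qed.

Lemma lincomb_lin k (v : 'I_k -> E) (F : lmodType R[i]) (T : E -> F) c :
  linear T -> T (lincomb v c) = lincomb (fun i => T (v i)) c.
Proof.
move=> linT; have T0 := linear_0 linT.
have TD x y : T (x + y) = T x + T y by have := linT 1 x y; rewrite !scale1r.
have TZ a x : T (a *: x) = a *: T x by have := linT a x 0; rewrite T0 !addr0.
by rewrite /lincomb (big_morph _ TD T0); apply: eq_bigr.
Qed.

Lemma lspan_lincomb k l (v : 'I_k -> E) (w : 'I_l -> E) c :
  (forall i, lspan w (v i)) -> lspan w (lincomb v c).
Proof.
move=> /choice[d vE]; exists (fun j => \sum_i c i * d i j).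
rewrite /lincomb; under eq_bigr => i _ do rewrite vE /lincomb scaler_sumr.
rewrite exchange_big /=. apply: eq_bigr => j _.
by rewrite scaler_suml; apply: eq_bigr => i _; rewrite scalerA.
Qed.

Lemma submod_lspan k (v : 'I_k -> E) : submod_closed (mem (lspan v)).
Proof.
split; first by rewrite inE; exists (fun=> 0); rewrite lincomb0.
move=> a x y; rewrite !inE => -[c ->] [d ->].
by exists (fun i => a * c i + d i); rewrite lincombZ lincombD.
Qed.

End LinComb.

Lemma exists_kernel_comb (R : realType) m k (a : 'I_m -> 'I_k -> R[i]) :
  (k < m)%N -> exists c : 'I_m -> R[i],
    (exists i, c i != 0) /\ forall j, \sum_i c i * a i j = 0.
Proof.
move=> km; pose A := \matrix_(i, j) a i j.
have : kermx A != 0.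
  rewrite -mxrank_eq0 mxrank_ker -lt0n subn_gt0.
  exact: leq_ltn_trans (rank_leq_col _) km.
case/rowV0Pn => c /sub_kermxP cA c0; exists (fun i => c 0 i); split.
  apply/existsP; apply: contraR c0; rewrite negb_exists => /forallP c0.
  by apply/eqP/rowP => i; move: (c0 i); rewrite negbK mxE => /eqP.
move=> j; have /rowP/(_ j) := cA; rewrite mxE [RHS]mxE => cAj.
by rewrite -[RHS]cAj; apply: eq_bigr => i _; rewrite mxE.
Qed.

Section HermitianForms.
Variables (R : realType) (E : lmodType R[i]) (h : E -> E -> R[i]).
Hypothesis hH : hermitian_form h.

Lemma herm_sym x y : h y x = (h x y)^*. Proof. exact: hH.2. Qed.
Lemma hermPl a x y z : h (a *: x + y) z = a * h x z + h y z.
Proof. exact: hH.1. Qed.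
Lemma herm0l z : h 0 z = 0.
Proof. by have := hermPl (-1) 0 0 z; rewrite scaler0 addr0 mulN1r addNr. Qed.
Lemma hermDl x y z : h (x + y) z = h x z + h y z.
Proof. by have := hermPl 1 x y z; rewrite scale1r mul1r. Qed.
Lemma hermZl a x z : h (a *: x) z = a * h x z.
Proof. by have := hermPl a x 0 z; rewrite herm0l !addr0. Qed.
Lemma hermNl x z : h (- x) z = - h x z.
Proof. by rewrite -scaleN1r hermZl mulN1r. Qed.
Lemma hermBl x y z : h (x - y) z = h x z - h y z.
Proof. by rewrite hermDl hermNl. Qed.
Lemma herm0r z : h z 0 = 0. Proof. by rewrite herm_sym herm0l rmorph0. Qed.
Lemma hermDr x y z : h z (x + y) = h z x + h z y.
Proof. by rewrite herm_sym hermDl rmorphD/= -!herm_sym. Qed.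
Lemma hermZr a x z : h z (a *: x) = a^* * h z x.
Proof. by rewrite herm_sym hermZl rmorphM/= -herm_sym. Qed.
Lemma hermNr x z : h z (- x) = - h z x.
Proof. by rewrite herm_sym hermNl rmorphN/= -herm_sym. Qed.
Lemma hermBr x y z : h z (x - y) = h z x - h z y.
Proof. by rewrite hermDr hermNr. Qed.
Lemma herm_suml (I : Type) (s : seq I) (P : pred I) (F : I -> E) z :
  h (\sum_(i <- s | P i) F i) z = \sum_(i <- s | P i) h (F i) z.
Proof. by apply: (big_morph (h^~ z)) => [x y|]; rewrite ?hermDl ?herm0l. Qed.
Lemma herm_sumr (I : Type) (s : seq I) (P : pred I) (F : I -> E) z :
  h z (\sum_(i <- s | P i) F i) = \sum_(i <- s | P i) h z (F i).
Proof. by apply: (big_morph (h z)) => [x y|]; rewrite ?hermDr ?herm0r. Qed.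

Lemma herm_quad x : h x x = (quad h x)%:C%C.
Proof.
have := herm_sym x x; rewrite /quad; case: (h x x) => a b [] /eqP.
rewrite -addr_eq0 -mulr2n mulrn_eq0 /= => /eqP ->; exact: complexr0.
Qed.

Lemma re_herm_sym x y : re (h x y) = re (h y x).
Proof. by rewrite (herm_sym y x) re_conj. Qed.

Lemma quad0 : quad h 0 = 0. Proof. by rewrite /quad herm0l. Qed.
Lemma quadD x y : quad h (x + y) = quad h x + quad h y + 2 * re (h x y).
Proof.
by rewrite /quad hermDl !hermDr !reD (re_herm_sym y x); ring.
Qed.
Lemma quadZ a x : quad h (a *: x) = sqn a * quad h x.
Proof. by rewrite /quad hermZl hermZr mulrA mulcJ reMr. Qed.
Lemma quadN x : quad h (- x) = quad h x.
Proof. by rewrite /quad hermNl hermNr opprK. Qed.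
Lemma quadB x y : quad h (x - y) = quad h x + quad h y - 2 * re (h x y).
Proof. by rewrite quadD quadN hermNr reN mulrN. Qed.
Lemma quad_parallelogram x y :
  quad h (x + y) + quad h (x - y) = 2 * quad h x + 2 * quad h y.
Proof. by rewrite quadB quadD; ring. Qed.

Lemma quadDr (r : R) x y :
  quad h (x + r%:C%C *: y) = quad h x + 2 * r * re (h x y) + r ^+ 2 * quad h y.
Proof.
by rewrite quadD quadZ sqn_real hermZr conj_real reMr; ring.
Qed.

Lemma cauchy_schwarz_in x y : 0 <= quad h y ->
  (forall a, 0 <= quad h (x - a *: y)) -> sqn (h x y) <= quad h x * quad h y.
Proof.
move=> y_ge0 h_ge0.
have key (t : R) : 0 <= quad h x - 2 * t * sqn (h x y)
    + t ^+ 2 * sqn (h x y) * quad h y.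
  have := h_ge0 (t%:C%C * h x y).
  rewrite quadB quadZ sqnM sqn_real hermZr rmorphM/= conj_real.
  by rewrite -(mulrA t%:C%C) mulJc reMr /= => /le_trans; apply; lra.
have [y0|y0] := eqVneq (quad h y) 0.
  rewrite y0 mulr0; have := key ((quad h x + 1) / (2 * sqn (h x y))).
  rewrite y0 mulr0 addr0; have [->//|n0] := eqVneq (sqn (h x y)) 0.
  suff -> : 2 * ((quad h x + 1) / (2 * sqn (h x y))) * sqn (h x y)
          = quad h x + 1 by lra.
  by field.
have y_gt0 : 0 < quad h y by rewrite lt_def y0.
have := key (quad h y)^-1.
have -> : (quad h y)^-1 ^+ 2 * sqn (h x y) * quad h y = sqn (h x y) / quad h y.
  by field.
rewrite -mulrA [_^-1 * _]mulrC => H.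
by rewrite -ler_pdivrMr//; lra.
Qed.

Lemma cauchy_schwarz x y : (forall z, 0 <= quad h z) ->
  sqn (h x y) <= quad h x * quad h y.
Proof. by move=> h_ge0; apply: cauchy_schwarz_in. Qed.

Lemma quadD_le x y : (forall z, 0 <= quad h z) ->
  quad h (x + y) <= 2 * quad h x + 2 * quad h y.
Proof. by move=> h_ge0; rewrite -quad_parallelogram lerDl. Qed.

(** The signs of the coefficients are those of an orthonormal basis of a
    negative definite subspace. *)
Definition negon k (n : 'I_k -> E) : Prop :=
  forall i j, h (n i) (n j) = - (i == j)%:R.

(** Negative definiteness on the span together with linear independence. *)
Definition negdef k (v : 'I_k -> E) : Prop :=
  forall c, (exists i, c i != 0) -> quad h (lincomb v c) < 0.

(** A frame describes a fundamental decomposition: its span is the negative part,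
    its orthogonal complement the positive part. *)
Definition frame k (n : 'I_k -> E) : Prop :=
  negon n /\ forall x, (forall i, h x (n i) = 0) -> 0 <= quad h x.

Lemma negon_coord k (n : 'I_k -> E) c j : negon n ->
  h (lincomb n c) (n j) = - c j.
Proof.
move=> nn; rewrite /lincomb herm_suml (bigD1 j)//= hermZl nn eqxx mulrN1.
by rewrite big1 ?addr0// => i /negPf ij; rewrite hermZl nn ij oppr0 mulr0.
Qed.

Lemma negon_quad k (n : 'I_k -> E) c : negon n ->
  quad h (lincomb n c) = - \sum_i sqn (c i).
Proof.
move=> nn; rewrite /quad {2}/lincomb herm_sumr re_sum -sumrN.
apply: eq_bigr => i _; rewrite hermZr negon_coord// mulrN mulrC mulcJ.
by rewrite reN.
Qed.

Lemma sum_sqn_gt0 k (c : 'I_k -> R[i]) : (exists i, c i != 0) ->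
  0 < \sum_i sqn (c i).
Proof.
case=> i ci; rewrite (bigD1 i)//= ltr_wpDr ?sqn_gt0//.
by apply: sumr_ge0 => j _; exact: sqn_ge0.
Qed.

Lemma negon_negdef k (n : 'I_k -> E) : negon n -> negdef n.
Proof. by move=> nn c c0; rewrite negon_quad// oppr_lt0 sum_sqn_gt0. Qed.

Lemma negdef_le_frame k m (n : 'I_k -> E) (v : 'I_m -> E) :
  frame n -> negdef v -> (m <= k)%N.
Proof.
move=> [_ np] vn; rewrite leqNgt; apply/negP => km.
have [c [c0 ck]] := exists_kernel_comb (fun i j => h (v i) (n j)) km.
have := vn c c0; rewrite ltNge => /negP; apply; apply: np => j.
by rewrite /lincomb herm_suml -[RHS](ck j); apply: eq_bigr => i _; rewrite hermZl.
Qed.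

Lemma quad_orthD x y : h x y = 0 -> quad h (x + y) = quad h x + quad h y.
Proof. by move=> xy; rewrite quadD xy re0 mulr0 addr0. Qed.

Definition fcons k (x : E) (v : 'I_k -> E) (i : 'I_k.+1) : E :=
  if unlift ord0 i is Some j then v j else x.

Lemma lincomb_fcons k x (v : 'I_k -> E) c :
  lincomb (fcons x v) c = c ord0 *: x + lincomb v (fun i => c (lift ord0 i)).
Proof.
rewrite /lincomb big_ord_recl /fcons unlift_none; congr (_ + _).
by apply: eq_bigr => i _; rewrite liftK.
Qed.

Lemma fcons_eta k (v : 'I_k.+1 -> E) :
  v = fcons (v ord0) (fun i => v (lift ord0 i)).
Proof. by apply/funext => i; rewrite /fcons; case: unliftP => [j|] ->. Qed.

Lemma negon_fcons_negdef k x (n : 'I_k -> E) : negon n ->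
  (forall i, h x (n i) = 0) -> quad h x < 0 -> negdef (fcons x n).
Proof.
move=> nn xn xlt c [i ci]; rewrite lincomb_fcons quad_orthD; last first.
  rewrite /lincomb herm_sumr big1// => j _.
  by rewrite hermZl hermZr xn !mulr0.
rewrite quadZ negon_quad//.
have s0 : 0 <= \sum_i sqn (c (lift ord0 i)) by apply: sumr_ge0 => *; exact: sqn_ge0.
have [c0|c0] := eqVneq (c ord0) 0.
  rewrite c0 sqn0 mul0r add0r oppr_lt0 sum_sqn_gt0//.
  by move: ci; case: (unliftP ord0 i) => [j|] -> => [cj|/eqP//]; exists j.
rewrite -subr_gt0 sub0r opprD opprK ltr_wpDr// -mulrN mulr_gt0 ?sqn_gt0//.
by rewrite oppr_gt0.
Qed.

Lemma frame_max k (n m : 'I_k -> E) : frame n -> negon m -> frame m.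
Proof.
move=> nf mn; split=> // x xm; rewrite leNgt; apply/negP => xlt.
have := negdef_le_frame nf (negon_fcons_negdef mn xm xlt).
by rewrite ltnn.
Qed.

(** The component of [x] orthogonal to the negative family [n]. *)
Definition ncomp k (n : 'I_k -> E) (x : E) : E := x + lincomb n (fun i => h x (n i)).

Lemma ncomp_orth k (n : 'I_k -> E) x j : negon n -> h (ncomp n x) (n j) = 0.
Proof. by move=> nn; rewrite hermDl negon_coord// subrr. Qed.

Lemma gram_schmidt k (v : 'I_k -> E) : negdef v ->
  exists n : 'I_k -> E, negon n /\ lspan n = lspan v.
Proof.
elim: k v => [|k IH] v vn.
  by exists v; split=> // -[].
pose v' i := v (lift ord0 i).
have v'n : negdef v'.
  move=> c [i ci].
  pose c' j := if unlift ord0 j is Some l then c l else 0.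
  have c'E : (fun j => c' (lift ord0 j)) = c.
    by apply/funext => j; rewrite /c' liftK.
  have := vn c'; rewrite [v in lincomb v]fcons_eta lincomb_fcons c'E.
  rewrite {2}/c' unlift_none scale0r add0r; apply.
  by exists (lift ord0 i); rewrite /c' liftK.
have [n' [nn' sn']] := IH v' v'n.
pose u := ncomp n' (v ord0).
have [d dE] : lspan v' (lincomb n' (fun i => h (v ord0) (n' i))).
  by rewrite -sn'; eexists.
have uE : u = lincomb (fcons (v ord0) v')
   (fun j => if unlift ord0 j is Some l then d l else 1).
  rewrite lincomb_fcons unlift_none scale1r /u /ncomp dE; congr (_ + lincomb _ _).
  by apply/funext => i; rewrite liftK.
have u_lt0 : quad h u < 0.
  by rewrite uE -fcons_eta; apply: vn; exists ord0; rewrite unlift_none oner_eq0.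
pose s := (Num.sqrt (- quad h u)).
have s0 : s != 0 by rewrite sqrtr_eq0 -ltNge oppr_gt0.
have s2 : s ^+ 2 = - quad h u by rewrite sqr_sqrtr// oppr_ge0 ltW.
pose n0 := (s^-1)%:C%C *: u.
have n0n' i : h n0 (n' i) = 0 by rewrite hermZl ncomp_orth// mulr0.
exists (fcons n0 n'); split.
  move=> i j; rewrite /fcons.
  case: (unliftP ord0 i) => [i'|] ->; case: (unliftP ord0 j) => [j'|] ->.
  - by rewrite nn' (inj_eq lift_inj).
  - by rewrite herm_sym n0n' rmorph0 eq_sym (negPf (neq_lift _ _)) oppr0.
  - by rewrite n0n' (negPf (neq_lift _ _)) oppr0.
  - rewrite eqxx herm_quad quadZ sqn_real exprVn s2.
    rewrite invrN mulNr mulVf ?ltr0_neq0//.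
    by apply/eqP; rewrite eq_complex /= oppr0 !eqxx.
have sv : forall i, lspan (fcons n0 n') (v' i).
  move=> i; have [c cE] : lspan n' (v' i).
    by rewrite sn'; exists (fun j => (j == i)%:R); rewrite lincomb_delta.
  exists (fun j => if unlift ord0 j is Some l then c l else 0).
  rewrite lincomb_fcons unlift_none scale0r add0r cE; congr lincomb.
  by apply/funext => j; rewrite liftK.
have sub a b : a \in mem (lspan (fcons n0 n')) -> b \in mem (lspan (fcons n0 n')) ->
   a + b \in mem (lspan (fcons n0 n')).
  by move=> ha hb; have := (submod_lspan (fcons n0 n')).2 1 a b ha hb; rewrite scale1r.
have sub' a b : lspan v a -> lspan v b -> lspan v (a + b).
  move=> ha hb; have := (submod_lspan v).2 1 a b; rewrite scale1r !inE; exact.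
have subZ z a : lspan v a -> lspan v (z *: a).
  by move=> -[c ->]; rewrite lincombZ; eexists.
have svv i : lspan v (v i) by exists (fun j => (j == i)%:R); rewrite lincomb_delta.
have sn'v c : lspan v (lincomb n' c).
  have [e ->] : lspan v' (lincomb n' c) by rewrite -sn'; eexists.
  by apply: lspan_lincomb => i; exact: svv.
apply/seteqP; split=> x [c ->]; apply: lspan_lincomb => i.
  rewrite /fcons; case: unliftP => [j|] _.
    by have := sn'v (fun i => (i == j)%:R); rewrite lincomb_delta.
  by apply: subZ; apply: sub'.
case: (unliftP ord0 i) => [j|] ->; first exact: sv.
have -> : v ord0 = s%:C%C *: n0 + - lincomb n' (fun i => h (v ord0) (n' i)).
  rewrite /n0 scalerA; have -> : s%:C%C * (s^-1)%:C%C = 1 :> R[i].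
    by apply/eqP; rewrite eq_complex /= !mul0r mulr0 subr0 mulfV// addr0 !eqxx.
  by rewrite scale1r /u /ncomp addrK.
exists (fun j => if unlift ord0 j is Some l then - h (v ord0) (n' l) else s%:C%C).
rewrite lincomb_fcons unlift_none; congr (_ + _).
rewrite -scaleN1r lincombZ; congr lincomb; apply/funext => j.
by rewrite liftK mulN1r.
Qed.

(** The positive form obtained by reversing the sign of [h] on the span of a
    frame; its square root is the Hilbert space norm of that frame. *)
Definition maj k (n : 'I_k -> E) (x y : E) : R[i] :=
  h x y + 2 * \sum_i h x (n i) * h (n i) y.

Lemma maj_herm k (n : 'I_k -> E) : hermitian_form (maj n).
Proof.
split=> [a x y z|x y]; rewrite /maj.
  have -> : \sum_i h (a *: x + y) (n i) * h (n i) z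
     = a * (\sum_i h x (n i) * h (n i) z) + \sum_i h y (n i) * h (n i) z.
    rewrite mulr_sumr -big_split; apply: eq_bigr => i _.
    by rewrite hermPl mulrDl mulrA.
  by rewrite hermPl; ring.
rewrite rmorphD rmorphM/= rmorph_nat -herm_sym rmorph_sum/=.
congr (_ + _ * _); apply: eq_bigr => i _.
by rewrite rmorphM/= -!herm_sym mulrC.
Qed.

Lemma quad_maj k (n : 'I_k -> E) x :
  quad (maj n) x = quad h x + 2 * \sum_i sqn (h x (n i)).
Proof.
rewrite /quad /maj reD; congr (_ + _).
have -> : \sum_i h x (n i) * h (n i) x = (\sum_i sqn (h x (n i)))%:C%C.
  rewrite rmorph_sum/=; apply: eq_bigr => i _.
  by rewrite (herm_sym x) mulcJ.
by rewrite -[2]/(1 + 1) mulrDl mul1r reD /=; ring.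
Qed.

Lemma quad_ncomp k (n : 'I_k -> E) x : negon n ->
  quad h (ncomp n x) = quad h x + \sum_i sqn (h x (n i)).
Proof.
move=> nn; rewrite /quad {2}/ncomp hermDr /lincomb herm_sumr.
rewrite [X in _ + X]big1 ?addr0; last first.
  by move=> i _; rewrite hermZr ncomp_orth// mulr0.
rewrite hermDl reD; congr (_ + _).
rewrite herm_suml re_sum; apply: eq_bigr => i _.
by rewrite hermZl (herm_sym x) mulcJ.
Qed.

Lemma maj_ge_coord k (n : 'I_k -> E) x : frame n ->
  \sum_i sqn (h x (n i)) <= quad (maj n) x.
Proof.
move=> [nn np]; have : 0 <= quad h (ncomp n x).
  by apply: np => i; exact: ncomp_orth.
by rewrite quad_ncomp// quad_maj; lra.
Qed.

Lemma maj_ge0 k (n : 'I_k -> E) x : frame n -> 0 <= quad (maj n) x.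
Proof.
move=> nf; apply: le_trans (maj_ge_coord x nf).
by apply: sumr_ge0 => *; exact: sqn_ge0.
Qed.

(** The fundamental symmetry of a frame. *)
Definition fundsym k (n : 'I_k -> E) (x : E) : E :=
  x + lincomb n (fun i => 2 * h x (n i)).

Lemma fundsym_coord k (n : 'I_k -> E) x j : negon n ->
  h (fundsym n x) (n j) = - h x (n j).
Proof. by move=> nn; rewrite hermDl negon_coord//; ring. Qed.

Lemma fundsymK k (n : 'I_k -> E) : negon n -> involutive (fundsym n).
Proof.
move=> nn x; rewrite {1}/fundsym.
have -> : (fun i => 2 * h (fundsym n x) (n i)) = (fun i => 2 * - h x (n i)).
  by apply/funext => i; rewrite fundsym_coord.
rewrite /fundsym -addrA lincombD -[RHS]addr0; congr (_ + _).
rewrite -(lincomb0 n); congr lincomb; apply/funext => i; ring.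
Qed.

Lemma majE k (n : 'I_k -> E) x y : maj n x y = h x (fundsym n y).
Proof.
rewrite /maj /fundsym hermDr; congr (_ + _).
rewrite /lincomb herm_sumr mulr_sumr; apply: eq_bigr => i _.
by rewrite hermZr rmorphM/= rmorph_nat (herm_sym y) mulrAC mulrA.
Qed.

Lemma herm_majE k (n : 'I_k -> E) x y : negon n -> h x y = maj n x (fundsym n y).
Proof. by move=> nn; rewrite majE fundsymK. Qed.

Lemma quad_maj_fundsym k (n : 'I_k -> E) x : negon n ->
  quad (maj n) (fundsym n x) = quad (maj n) x.
Proof.
by move=> nn; rewrite /quad majE fundsymK// majE re_herm_sym.
Qed.

End HermitianForms.

Section Majorant.
Variables (R : realType) (E : lmodType R[i]) (h : E -> E -> R[i]).
Hypothesis hH : hermitian_form h.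

Lemma herm_le_maj k (n : 'I_k -> E) x y : frame h n ->
  sqn (h x y) <= quad (maj h n) x * quad (maj h n) y.
Proof.
move=> nf; rewrite (herm_majE hH x y nf.1) -(quad_maj_fundsym hH y nf.1).
by apply: (cauchy_schwarz (maj_herm hH n)) => z; exact: maj_ge0.
Qed.

(** All frames have equivalent norms; the constant only involves the norms of
    the vectors of [m] with respect to [n]. *)
Lemma maj_le_maj k l (n : 'I_k -> E) (m : 'I_l -> E) : frame h n ->
  exists2 c : R, 0 < c & forall x, quad (maj h m) x <= c * quad (maj h n) x.
Proof.
move=> nf; exists (1 + 2 * \sum_i quad (maj h n) (m i)).
  by rewrite ltr_pwDl// mulr_ge0// sumr_ge0// => i _; exact: maj_ge0.
move=> x; rewrite [leLHS](quad_maj hH) [leRHS]mulrDl mul1r; apply: lerD.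
  by rewrite (quad_maj hH) lerDl mulr_ge0// sumr_ge0// => i _; exact: sqn_ge0.
rewrite -mulrA ler_wpM2l// mulr_suml ler_sum// => i _.
by rewrite mulrC herm_le_maj.
Qed.

Lemma frame_quad_gt0 k (n m : 'I_k -> E) x : frame h n -> frame h m ->
  quad (maj h n) x != 0 -> (forall i, h x (m i) = 0) -> 0 < quad h x.
Proof.
move=> nf mf x0 xm; have [c c0 cP] := maj_le_maj n mf.
have := cP x; rewrite (quad_maj hH m).
under eq_bigr => i _ do rewrite xm sqn0.
rewrite big1// mulr0 addr0 => H.
rewrite -(pmulr_rgt0 _ c0); apply: lt_le_trans H.
by rewrite lt_def x0 maj_ge0.
Qed.

End Majorant.

(** * Hilbert spaces and the representation of functionals *)

Lemma near2P (P : nat -> nat -> Prop) :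
  (\forall m & n \near \oo, P m n) <->
  exists N, forall m n, (N <= m)%N -> (N <= n)%N -> P m n.
Proof.
split=> [[[A B]] /= [[N1 _ A1] [N2 _ B2]] AB|[N NP]].
  exists (maxn N1 N2) => m n; rewrite !geq_max => /andP[m1 _] /andP[_ n2].
  exact: (AB (m, n) (conj (A1 _ m1) (B2 _ n2))).
exists ([set m | (N <= m)%N], [set m | (N <= m)%N]).
  by split; exists N.
by move=> [m n] /= [? ?]; exact: NP.
Qed.

Lemma nearoP (P : nat -> Prop) :
  (\forall n \near \oo, P n) <-> exists N, forall n, (N <= n)%N -> P n.
Proof. by split=> [[N _ NP]|[N NP]]; exists N. Qed.

Lemma inv_small (R : realType) (e : R) : 0 < e ->
  exists N, forall n, (N <= n)%N -> n.+1%:R^-1 < e.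
Proof.
by move=> e0; have [N _ NP] := near_infty_natSinv_lt (PosNum e0); exists N.
Qed.

Section Sequences.
Variables (R : realType) (E : lmodType R[i]).
Implicit Types (Q : E -> R) (u : nat -> E).

Definition qcauchy Q u : Prop := forall e : R, 0 < e ->
  exists N, forall m n, (N <= m)%N -> (N <= n)%N -> Q (u m - u n) < e.

Definition qcvg Q u l : Prop := forall e : R, 0 < e ->
  exists N, forall n, (N <= n)%N -> Q (u n - l) < e.

End Sequences.

Section FormNorm.
Variables (R : realType) (E : lmodType R[i]) (h : E -> E -> R[i]).
Hypothesis hH : hermitian_form h.

Lemma form_norm_lt x (r : R) : 0 < r -> 0 <= quad h x ->
  (form_norm h x < r%:C%C) = (quad h x < r ^+ 2).
Proof.
move=> r0 x0; rewrite /form_norm (herm_quad hH).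
have s0 : 0 <= sqrtC (quad h x)%:C%C by rewrite sqrtC_ge0 ler0c.
rewrite -(ltr_pXn2r (n := 2))// ?nnegrE ?ler0c ?(ltW r0)//.
by rewrite sqrtCK -rmorphXn/= ltcR.
Qed.

Lemma hilbert_subspaceP (H : set E) : hilbert_subspace h H <->
  [/\ submod_closed (mem H), forall x, H x -> x != 0 -> 0 < quad h x
    & forall u, (forall n, H (u n)) -> qcauchy (quad h) u ->
      exists2 l, H l & qcvg (quad h) u l].
Proof.
have posE x : (0 < h x x) = (0 < quad h x) by rewrite (herm_quad hH) ltcR.
split=> -[sH pH cH].
  have pH' x : H x -> 0 <= quad h x.
    move=> Hx; have [->|x0] := eqVneq x 0; first by rewrite (quad0 hH).
    by rewrite ltW// -posE pH.
  have sB x y : H x -> H y -> H (x - y).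
    move=> Hx Hy; have := sH.2 (-1) y x; rewrite !inE scaleN1r addrC.
    exact.
  split=> // [x Hx x0|u Hu cu]; first by rewrite -posE pH.
  have [|l Hl ul] := cH u Hu.
    move=> e /real_gt0P[r r0 ->]; apply/near2P.
    have [N NP] := cu (r ^+ 2) (exprn_gt0 2 r0).
    exists N => m n Nm Nn; rewrite form_norm_lt//; first exact: NP.
    exact/pH'/sB.
  exists l => // e e0.
  have [|N NP] := (nearoP _).1 (ul (Num.sqrt e)%:C%C _).
    by rewrite ltcR sqrtr_gt0.
  exists N => n /NP; rewrite form_norm_lt ?sqrtr_gt0 ?sqr_sqrtr ?(ltW e0)//.
  exact/pH'/sB.
have pH' x : H x -> 0 <= quad h x.
  move=> Hx; have [->|x0] := eqVneq x 0; first by rewrite (quad0 hH).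
  by rewrite ltW// pH.
have sB x y : H x -> H y -> H (x - y).
  move=> Hx Hy; have := sH.2 (-1) y x; rewrite !inE scaleN1r addrC.
  exact.
split=> // [x Hx x0|u Hu cu]; first by rewrite posE pH.
have [|l Hl ul] := cH u Hu.
  move=> e e0; have [|N NP] := (near2P _).1 (cu (Num.sqrt e)%:C%C _).
    by rewrite ltcR sqrtr_gt0.
  exists N => m n Nm /(NP _ _ Nm).
  rewrite form_norm_lt ?sqrtr_gt0 ?sqr_sqrtr ?(ltW e0)//.
  exact/pH'/sB.
exists l => // e /real_gt0P[r r0 ->]; apply/nearoP.
have [N NP] := ul (r ^+ 2) (exprn_gt0 2 r0).
exists N => n Nn; rewrite form_norm_lt//; first exact: NP.
exact/pH'/sB.
Qed.

(** The representing vector minimizes [quad h x - 2 * re (phi x)]; by the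
    parallelogram identity every minimizing sequence is Cauchy. *)
Lemma riesz (H : set E) (phi : E -> R[i]) (B : R) : hilbert_subspace h H ->
  (forall a x y, H x -> H y -> phi (a *: x + y) = a * phi x + phi y) ->
  (forall x, H x -> sqn (phi x) <= B * quad h x) ->
  exists2 y, H y & forall x, H x -> phi x = h x y.
Proof.
move=> /hilbert_subspaceP[sH pH cH] phiL phiB.
have H0 : H 0 by have := sH.1; rewrite inE.
have HP a x y : H x -> H y -> H (a *: x + y).
  by move=> Hx Hy; have := sH.2 a x y; rewrite !inE; apply.
have HZ a x : H x -> H (a *: x) by move=> Hx; rewrite -[_ *: _]addr0; exact: HP.
have HD x y : H x -> H y -> H (x + y).
  by move=> Hx Hy; rewrite -[x]scale1r; exact: HP.
have HB x y : H x -> H y -> H (x - y).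
  by move=> Hx Hy; apply: HD => //; rewrite -scaleN1r; exact: HZ.
have pH' x : H x -> 0 <= quad h x.
  move=> Hx; have [->|x0] := eqVneq x 0; first by rewrite (quad0 hH).
  by rewrite ltW// pH.
have phi0 : phi 0 = 0.
  by have := phiL (-1) 0 0 H0 H0; rewrite scaler0 addr0 mulN1r addNr.
have phiD x y : H x -> H y -> phi (x + y) = phi x + phi y.
  by move=> Hx Hy; have := phiL 1 x y Hx Hy; rewrite scale1r mul1r.
have phiZ a x : H x -> phi (a *: x) = a * phi x.
  by move=> Hx; have := phiL a x 0 Hx H0; rewrite phi0 !addr0.
wlog B0 : B phiB / 0 <= B.
  move=> /(_ (Num.max B 0)); apply; last by rewrite le_max lexx orbT.
  move=> x Hx; apply: le_trans (phiB x Hx) _.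
  by rewrite ler_wpM2r ?pH'// le_max lexx.
pose J x := quad h x - 2 * re (phi x).
have JB x : H x -> - B <= J x.
  move=> Hx; have := phiB x Hx; have := re_sqr_le (phi x).
  have := pH' x Hx; rewrite /J; set q := quad h x; set t := re _ => q0 t1 t2.
  suff : 2 * t <= q + B by lra.
  rewrite leNgt; apply/negP => lt1.
  have : (q + B) ^+ 2 < (2 * t) ^+ 2 by rewrite ltrXn2r// ?nnegrE; lra.
  by have := sqr_ge0 (q - B); nra.
pose SJ := J @` H.
have SJi : has_inf SJ.
  split; first by exists (J 0); exists 0.
  by exists (- B) => _ [x Hx <-]; exact: JB.
pose I := inf SJ.
have JI x : H x -> I <= J x by move=> Hx; apply: ge_inf; [exact: SJi.2|exists x].
have /choice[u uP] (n : nat) : exists x, H x /\ J x < I + n.+1%:R^-1.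
  have n0 : (0 : R) < n.+1%:R^-1 by rewrite invr_gt0.
  by have [_ [x Hx <-] ?] := inf_adherent n0 SJi; exists x.
have Jpar x y : H x -> H y ->
    quad h (x - y) <= 2 * (J x - I) + 2 * (J y - I).
  move=> Hx Hy.
  have Hm : H ((2^-1 : R)%:C%C *: (x + y)) by apply/HZ/HD.
  have := JI _ Hm; have := quad_parallelogram hH x y.
  rewrite /J (quadZ hH) sqn_real phiZ ?phiD//; last exact: HD.
  by rewrite reMr reD (_ : 2^-1 ^+ 2 = 4^-1 :> R); [lra|field].
have [|y Hy uy] := cH u (fun n => (uP n).1).
  move=> e e0.
  have e40 : 0 < e / 4 by rewrite divr_gt0.
  have [N NP] := inv_small e40.
  exists N => m n /NP mN /NP nN.
  apply: le_lt_trans (Jpar _ _ (uP m).1 (uP n).1) _.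
  have := (uP m).2; have := (uP n).2; move: mN nN.
  by move: m.+1%:R^-1 n.+1%:R^-1 => a b; lra.
have hyp x e : H x -> 0 < e ->
    exists n, J (u n) < I + e /\ re (h (u n) x - h y x) ^+ 2 < e.
  move=> Hx e0.
  have e10 : 0 < e / (quad h x + 1) by rewrite divr_gt0// ltr_wpDl// pH'.
  have [N1 N1P] := uy _ e10.
  have [N2 N2P] := inv_small e0.
  exists (maxn N1 N2); have := N1P _ (leq_maxl N1 N2).
  have := N2P _ (leq_maxr N1 N2); set n := maxn _ _ => n2 n1; split.
    by have := (uP n).2; move: n2; move: n.+1%:R^-1 => a; lra.
  rewrite -(hermBl hH); apply: le_lt_trans (re_sqr_le _) _.
  apply: le_lt_trans (cauchy_schwarz_in hH (pH' _ Hx) _) _.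
    by move=> a; apply/pH'/HB; [apply: HB => //; exact: (uP n).1|exact: HZ].
  have x1 : 0 < quad h x + 1 by rewrite ltr_wpDl// pH'.
  apply: le_lt_trans (_ : quad h (u n - y) * (quad h x + 1) < _).
    by rewrite ler_wpM2l ?lerDl// pH'//; apply: HB => //; exact: (uP n).1.
  by rewrite -ltr_pdivlMr.
have orth x : H x -> re (h y x) = re (phi x).
  move=> Hx; apply/eqP; rewrite -subr_eq0; apply/negPn/negP => d0.
  set d := _ - _ in d0.
  have qx : 0 <= quad h x by exact: pH'.
  have key (t : R) : 0 <= t ^+ 2 * quad h x + 2 * t * d.
    rewrite leNgt; apply/negP => klt.
    pose D := - (t ^+ 2 * quad h x + 2 * t * d).
    have D0 : 0 < D by rewrite /D oppr_gt0.
    have t0 : 0 < 16 * t ^+ 2 + 1 by rewrite ltr_wpDl// mulr_ge0// sqr_ge0.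
    have e0 : 0 < Num.min (D / 2) (D ^+ 2 / (16 * t ^+ 2 + 1)).
      by rewrite lt_min !divr_gt0// exprn_gt0.
    have [n [n1 n2]] := hyp x _ Hx e0.
    move: n1 n2; set e := Num.min _ _ => n1 n2.
    have eD : e <= D / 2 by rewrite /e ge_min lexx.
    have eD2 : e * (16 * t ^+ 2 + 1) <= D ^+ 2.
      by rewrite -ler_pdivlMr// /e ge_min lexx orbT.
    have := JI _ (HD _ _ (uP n).1 (HZ t%:C%C _ Hx)).
    rewrite /J (quadDr hH) phiD ?phiZ//; [|exact: (uP n).1|exact: HZ].
    rewrite reD reMr.
    move: n1 n2; rewrite /J reB.
    set a := re (h (u n) x); set b := re (h y x).
    move=> n1 n2 n3.
    have n4 : 0 <= e + t ^+ 2 * quad h x + 2 * t * (a - re (phi x)) by lra.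
    have n5 : D / 2 <= 2 * t * (a - b) by move: n4 eD; rewrite /D /d -/b; lra.
    have n6 : (D / 2) ^+ 2 <= (2 * t * (a - b)) ^+ 2.
      by rewrite ler_sqr// nnegrE; lra.
    have n7 : (a - b) ^+ 2 * (16 * t ^+ 2) <= e * (16 * t ^+ 2).
      by apply: ler_wpM2r; [rewrite mulr_ge0// sqr_ge0|exact: ltW].
    move: n6; rewrite (_ : (D / 2) ^+ 2 = D ^+ 2 / 4); last by field.
    rewrite (_ : (2 * t * (a - b)) ^+ 2 = (a - b) ^+ 2 * (16 * t ^+ 2) / 4).
      by move: eD2 n7 (e0 : 0 < e); rewrite mulrDr mulr1; lra.
    by field.
  have := key (- d / (quad h x + 1)).
  have x1 : 0 < quad h x + 1 by rewrite ltr_wpDl.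
  have -> : (- d / (quad h x + 1)) ^+ 2 * quad h x + 2 * (- d / (quad h x + 1)) * d
     = - (d ^+ 2 * (quad h x + 2) / (quad h x + 1) ^+ 2).
    by field; rewrite gt_eqF.
  rewrite oppr_ge0 leNgt => /negP; apply.
  rewrite divr_gt0 ?exprn_gt0// mulr_gt0//; last by lra.
  by rewrite exprn_even_gt0.
exists y => // x Hx; apply: complex_eq_re => a.
have Hax : H (a *: x) by exact: HZ.
by rewrite -(phiZ a x Hx) -(orth _ Hax) (re_herm_sym hH) (hermZl hH).
Qed.
End FormNorm.

(** * Norms, continuity and completeness through real squares *)

(** Order relations between squared norms are settled in [R] rather than in the
    partially ordered field [R[i]]. *)
Definition nq (R : realType) (V : normedModType R[i]) (x : V) : R :=
  re `|x| ^+ 2.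

Section NormSquare.
Variables (R : realType).
Implicit Types (V W : normedModType R[i]).

Lemma norm_re V (x : V) : `|x| = (re `|x|)%:C%C.
Proof.
have := normr_ge0 x; case: `|x| => a b; rewrite lecE /= => /andP[/eqP -> _].
by [].
Qed.

Lemma re_norm_ge0 V (x : V) : 0 <= re `|x|.
Proof. by have := normr_ge0 x; rewrite lecE => /andP[]. Qed.

Lemma nq_norm V (x : V) : (nq x)%:C%C = `|x| ^+ 2.
Proof. by rewrite /nq rmorphXn /= -norm_re. Qed.

Lemma nq_ge0 V (x : V) : 0 <= nq x. Proof. exact: sqr_ge0. Qed.

Lemma nq0 V : nq (0 : V) = 0. Proof. by rewrite /nq normr0 /= expr0n. Qed.

Lemma nq_eq0 V (x : V) : (nq x == 0) = (x == 0).
Proof.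
by rewrite /nq sqrf_eq0 -[RHS]normr_eq0 norm_re eq_complex /= eqxx andbT.
Qed.

Lemma nqZ V (a : R[i]) (x : V) : nq (a *: x) = sqn a * nq x.
Proof.
by apply: complexI; rewrite nq_norm normrZ exprMn normc_sqn -nq_norm -rmorphM.
Qed.

Lemma nqN V (x : V) : nq (- x) = nq x. Proof. by rewrite /nq normrN. Qed.

Lemma norm_lt V (x : V) (r : R) : 0 < r -> (`|x| < r%:C%C) = (nq x < r ^+ 2).
Proof.
by move=> r0; rewrite norm_re ltcR /nq ltr_pXn2r// nnegrE ?re_norm_ge0 ?ltW.
Qed.

Lemma nqD_le V (x y : V) : nq (x + y) <= 2 * nq x + 2 * nq y.
Proof.
have := ler_normD x y; rewrite (norm_re x) (norm_re y) (norm_re (x + y)).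
rewrite -rmorphD/= lecR /nq.
move: (re_norm_ge0 x) (re_norm_ge0 y) (re_norm_ge0 (x + y)).
set a := re `|x|; set b := re `|y|; set c := re `|x + y| => a0 b0 c0 ab.
have : c ^+ 2 <= (a + b) ^+ 2 by rewrite ler_pXn2r// nnegrE addr_ge0.
have := sqr_ge0 (a - b); nra.
Qed.

Lemma bounded_of_continuous V W (T : V -> W) : continuous_linear T ->
  exists2 c : R, 0 < c & forall x, nq (T x) <= c * nq x.
Proof.
move=> [linT contT].
pose Tl : {linear V -> W} := HB.pack T (GRing.isLinear.Build _ _ _ _ _ linT).
have /linear_bounded_continuous/linear_boundedP[M [Mr MP]] :
  continuous Tl by [].
have [r r0 rM] : exists2 r : R, 0 < r & M < r%:C%C.
  exists (1 + `|re M|); first by rewrite ltr_pwDl.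
  by rewrite -(RRe_real Mr) ltcR ltr_pwDl// ler_norm.
exists (r ^+ 2) => [|x]; first exact: exprn_gt0.
have := MP _ rM x; rewrite /= (norm_re x) (norm_re (T x)) -rmorphM lecR.
by move=> H; rewrite /nq -exprMn ler_pXn2r// ?nnegrE ?mulr_ge0 ?re_norm_ge0// ltW.
Qed.

Lemma complete_qcvg (V : completeNormedModType R[i]) (u : nat -> V) :
  qcauchy (@nq R V) u -> exists l, qcvg (@nq R V) u l.
Proof.
move=> cu; have : cauchy (u @ \oo).
  apply/cauchy_ballP => e /real_gt0P[r r0 ->].
  have [N NP] := cu _ (exprn_gt0 2 r0).
  exists (u @` [set n | (N <= n)%N], u @` [set n | (N <= n)%N]) => /=.
    by split; exists N => // n Nn; exists n.
  move=> [_ _] /= [[m Nm <-] [n Nn <-]].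
  by rewrite -ball_normE /ball_ /= norm_lt//; exact: NP.
move=> /cauchy_cvgP/cvg_ex[l ul]; exists l => e e0.
have s0 : 0 < (Num.sqrt e)%:C%C :> R[i] by rewrite ltcR sqrtr_gt0.
have [N NP] := (nearoP _).1 ((cvgrPdist_lt _ _).1 ul _ s0).
exists N => n /NP; rewrite norm_lt ?sqrtr_gt0// sqr_sqrtr ?(ltW e0)//.
by rewrite -nqN opprB.
Qed.

Lemma qcvg_lin V W (T : V -> W) u l : continuous_linear T ->
  qcvg (@nq R V) u l -> qcvg (@nq R W) (T \o u) (T l).
Proof.
move=> cT ul e e0; have [c c0 cP] := bounded_of_continuous cT.
have [N NP] := ul (e / c) (divr_gt0 e0 c0).
exists N => n Nn; have -> : T (u n) - T l = T (u n - l).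
  have := cT.1 (-1) l (u n).
  by rewrite !scaleN1r [RHS]addrC => <-; rewrite [u n - l]addrC.
by apply: le_lt_trans (cP _) _; rewrite -ltr_pdivlMl// mulrC; exact: NP.
Qed.

Lemma qcvg_unique V u (l m : V) :
  qcvg (@nq R V) u l -> qcvg (@nq R V) u m -> l = m.
Proof.
move=> ul um; apply/eqP; rewrite -subr_eq0 -nq_eq0; apply/eqP.
apply/le_anti; rewrite nq_ge0 andbT leNgt; apply/negP => d0.
have d40 : 0 < nq (l - m) / 4 by rewrite divr_gt0.
have [N1 P1] := ul _ d40; have [N2 P2] := um _ d40.
have := P1 _ (leq_maxl N1 N2); have := P2 _ (leq_maxr N1 N2).
set x := u _; have := nqD_le (l - x) (x - m).
by rewrite addrA subrK -(nqN (l - x)) opprB; lra.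
Qed.

Lemma hilbert_closed (V : completeNormedModType R[i]) (h : V -> V -> R[i])
    (H : set V) (c d : R) :
  hermitian_form h -> submod_closed (mem H) -> 0 < c -> 0 < d ->
  (forall x, H x -> nq x <= c * quad h x) ->
  (forall x, H x -> quad h x <= d * nq x) ->
  (forall u l, (forall n, H (u n)) -> qcvg (@nq R V) u l -> H l) ->
  hilbert_subspace h H.
Proof.
move=> hH sH c0 d0 Hc Hd cl; apply/(hilbert_subspaceP hH).
have sB x y : H x -> H y -> H (x - y).
  move=> Hx Hy; have := sH.2 (-1) y x; rewrite !inE scaleN1r addrC.
  exact.
split=> // [x Hx x0|u Hu cu].
  rewrite -(pmulr_rgt0 _ c0); apply: lt_le_trans (Hc _ Hx).
  by rewrite lt_def nq_ge0 nq_eq0 x0.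
have [|l ul] := @complete_qcvg V u.
  move=> e e0; have [N NP] := cu (e / c) (divr_gt0 e0 c0).
  exists N => m n Nm Nn; apply: le_lt_trans (Hc _ _) _; first exact: sB.
  by rewrite -ltr_pdivlMl// mulrC; exact: NP.
exists l; first exact: cl ul.
move=> e e0; have [N NP] := ul (e / d) (divr_gt0 e0 d0).
exists N => n Nn; apply: le_lt_trans (Hd _ _) _; first by apply: sB=> //; exact: cl ul.
by rewrite -ltr_pdivlMl// mulrC; exact: NP.
Qed.

Lemma near_complexP (a : R[i]) (P : R[i] -> Prop) :
  (\forall z \near (a : R[i]^o), P z) <->
  exists2 r : R, 0 < r & forall z, sqn (z - a) < r ^+ 2 -> P z.
Proof.
have sE (z : R[i]) (r : R) : 0 < r ->
    (`|a - z| < r%:C%C) = (sqn (z - a) < r ^+ 2).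
  move=> r0; rewrite -(ltr_pXn2r (n := 2))// ?nnegrE ?ler0c ?(ltW r0)//.
  by rewrite normc_sqn -rmorphXn/= ltcR -sqnN opprB.
split.
  move=> /nbhs_ballP[e /= /real_gt0P[r r0 ->] eP]; exists r => // z zr.
  by apply: eP; rewrite /ball /= sE.
move=> [r r0 rP]; apply/nbhs_ballP; exists r%:C%C => /=; first by rewrite ltcR.
by move=> z; rewrite /ball /= sE// => /rP.
Qed.

End NormSquare.

(** * Frames and fundamental decompositions of a Pontryagin space *)

Lemma hermitian_dot (R : realType) (V : lmodType R[i])
    (f : {hermitian V for false & Num.conj}) : hermitian_form f.
Proof.
split=> [a x y z|x y]; first by rewrite linearPl.
by rewrite hermC expr0 mul1r.
Qed.

Lemma hermitian_opp (R : realType) (V : lmodType R[i]) (f : V -> V -> R[i]) :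
  hermitian_form f -> hermitian_form (fun x y => - f x y).
Proof.
move=> fH; split=> [a x y z|x y]; first by rewrite (hermPl fH); ring.
by rewrite rmorphN /= -(herm_sym fH).
Qed.

Lemma quad_opp (R : realType) (V : lmodType R[i]) (f : V -> V -> R[i]) x :
  quad (fun x y => - f x y) x = - quad f x.
Proof. by rewrite /quad reN. Qed.

Lemma hs_hermitian (R : realType) (Y : hilbertSpace R) : hermitian_form (hs_dot Y).
Proof. exact: hermitian_dot. Qed.

Lemma hs_quad (R : realType) (Y : hilbertSpace R) (y : Y) : quad (hs_dot Y) y = nq y.
Proof. by apply: complexI; rewrite nq_norm hs_normE (herm_quad (hs_hermitian Y)). Qed.

Lemma hs_hilbert (R : realType) (Y : hilbertSpace R) :
  hilbert_subspace (hs_dot Y) setT.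
Proof.
apply: (@hilbert_closed R _ _ _ 1 1) => //; first exact: hs_hermitian.
  by split=> [|a x y _ _]; rewrite inE.
  by move=> x _; rewrite hs_quad mul1r.
by move=> x _; rewrite hs_quad mul1r.
Qed.

Lemma hs_riesz (R : realType) (Y : hilbertSpace R) (phi : Y -> R[i]) (B : R) :
  (forall a x y, phi (a *: x + y) = a * phi x + phi y) ->
  (forall x, sqn (phi x) <= B * nq x) ->
  exists y, forall x, phi x = hs_dot Y x y.
Proof.
move=> phiL phiB.
have [||y _ yP] := riesz (hs_hermitian Y) (phi := phi) (B := B) (hs_hilbert Y).
- by move=> a x y _ _.
- by move=> x _; rewrite hs_quad.
by exists y => x; exact: yP.
Qed.

Lemma hs_cauchy_schwarz (R : realType) (Y : hilbertSpace R) (x y : Y) :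
  sqn (hs_dot Y x y) <= nq x * nq y.
Proof.
rewrite -!hs_quad; apply: (cauchy_schwarz (hs_hermitian Y)) => z.
by rewrite hs_quad nq_ge0.
Qed.

Lemma has_dim_negdef (R : realType) (V : lmodType R[i]) (f : V -> V -> R[i])
    (N : set V) k : hermitian_form f ->
  hilbert_subspace (fun x y => - f x y) N -> has_dim N k ->
  exists m : 'I_k -> V, negon f m /\ N = lspan m.
Proof.
move=> fH /(hilbert_subspaceP (hermitian_opp fH))[_ pN _] [b [NE bi]].
have bn : negdef f b.
  move=> c [i ci]; have : 0 < quad (fun x y => - f x y) (lincomb b c).
    apply: pN; first by rewrite NE; exists c.
    by apply/eqP => c0; move: ci; rewrite (bi c c0) eqxx.
  by rewrite quad_opp oppr_gt0.
have [m [mn mE]] := gram_schmidt fH bn.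
by exists m; rewrite mE NE.
Qed.

Lemma frame_of_decomposition (R : realType) (V : lmodType R[i])
    (f : V -> V -> R[i]) (P N : set V) k (m : 'I_k -> V) : hermitian_form f ->
  fundamental_decomposition f P N -> negon f m -> N = lspan m -> frame f m.
Proof.
move=> fH [dec orth hP hN _] mn NE; split=> // x xm.
have [p [v [Pp Nv xE]]] := dec x.
have := Nv; rewrite NE => -[c vE].
have : f x v = 0.
  by rewrite vE /lincomb (herm_sumr fH) big1// => i _; rewrite (hermZr fH) xm mulr0.
rewrite xE (hermDl fH) orth// add0r => v0.
have -> : v = 0.
  apply/eqP/negPn/negP => vn; have [_ /(_ v Nv vn)] := hN.
  by rewrite v0 oppr0 ltxx.
rewrite addr0; have [->|pn] := eqVneq p 0; first by rewrite (quad0 fH).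
have /(hilbert_subspaceP fH)[_ /(_ p Pp pn) ? _] := hP.
exact: ltW.
Qed.

Lemma pontryagin_frame (R : realType) k (X : pontryaginSpace R k) :
  exists n : 'I_k -> X, frame (ps_form X) n /\
    forall x, nq x = quad (maj (ps_form X) n) x.
Proof.
have fH := hermitian_dot (ps_form X).
have [P [N [FD dimN nE]]] := ps_decomposition X.
have [dec orth hP hN _] := FD.
have [m [mn mE]] := has_dim_negdef fH hN dimN.
exists m; split; first exact: frame_of_decomposition FD mn mE.
move=> x; have [p [v [Pp Nv ->]]] := dec x.
apply: complexI; rewrite nq_norm nE// (quad_maj fH).
have pm i : ps_form X p (m i) = 0.
  by apply: orth => //; rewrite mE; exists (fun j => (j == i)%:R); rewrite lincomb_delta.
have [c vE] : lspan m v by rewrite -mE.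
have -> : \sum_i sqn (ps_form X (p + v) (m i)) = \sum_i sqn (c i).
  apply: eq_bigr => i _.
  by rewrite (hermDl fH) pm add0r vE (negon_coord fH)// sqnN.
rewrite (quad_orthD fH (orth _ _ Pp Nv)) (herm_quad fH p) (herm_quad fH v).
rewrite vE (negon_quad fH)// -rmorphB/=; congr (_%:C%C); ring.
Qed.

Section Pontryagin.
Variables (R : realType) (X : completeNormedModType R[i]) (f : X -> X -> R[i]).
Variables (kappa : nat) (n : 'I_kappa -> X).
Hypothesis fH : hermitian_form f.
Hypothesis nf : frame f n.
Hypothesis nqE : forall x : X, nq x = quad (maj f n) x.

Lemma nq_quad x : nq x = quad f x + 2 * \sum_i sqn (f x (n i)).
Proof. by rewrite nqE (quad_maj fH). Qed.

Lemma form_le x y : sqn (f x y) <= nq x * nq y.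
Proof. by rewrite !nqE; exact: herm_le_maj. Qed.

Lemma quad_le_nq x : quad f x <= nq x.
Proof. by rewrite nq_quad lerDl mulr_ge0// sumr_ge0// => i _; exact: sqn_ge0. Qed.

Lemma coord_le_nq x : \sum_i sqn (f x (n i)) <= nq x.
Proof. by rewrite nqE; exact: maj_ge_coord. Qed.

Lemma Nquad_le_nq x : - quad f x <= nq x.
Proof. by have := coord_le_nq x; have := nq_quad x; lra. Qed.

Lemma qcvg_form u l y (a : R[i]) : qcvg (@nq R X) u l ->
  (forall k, f (u k) y = a) -> f l y = a.
Proof.
move=> ul uy; apply/eqP; rewrite -subr_eq0 -sqn_eq0; apply/eqP.
apply/le_anti; rewrite sqn_ge0 andbT leNgt; apply/negP => d0.
have y0 : 0 < nq y + 1 by rewrite ltr_wpDl// nq_ge0.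
have [k kP] := ul _ (divr_gt0 d0 y0).
have := kP k (leqnn k); rewrite ltr_pdivlMr// ltNge => /negP; apply.
rewrite -(uy k) -(hermBl fH) -sqnN -(hermNl fH) opprB.
by apply: le_trans (form_le _ _) _; rewrite ler_wpM2l ?nq_ge0// lerDl.
Qed.

Lemma negon_nq_le (m : 'I_kappa -> X) : negon f m ->
  exists2 c : R, 0 < c & forall x, nq x <= c * quad (maj f m) x.
Proof.
move=> mn; have mf := frame_max fH nf mn.
have [c c0 cP] := maj_le_maj fH n mf.
by exists c => // x; rewrite nqE.
Qed.

Lemma pos_of_orth (m : 'I_kappa -> X) x : negon f m ->
  (forall i, f x (m i) = 0) -> x != 0 -> 0 < quad f x.
Proof.
move=> mn xm x0; apply: (frame_quad_gt0 fH nf (frame_max fH nf mn)) => //.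
by rewrite -nqE nq_eq0.
Qed.

Lemma submod_orth k (m : 'I_k -> X) : submod_closed (mem [set x | forall i, f x (m i) = 0]).
Proof.
split=> [|a x y]; rewrite !inE /=; first by move=> i; rewrite (herm0l fH).
by move=> xm ym i; rewrite (hermPl fH) xm ym mulr0 addr0.
Qed.

Lemma orth_lspan k (m : 'I_k -> X) p v :
  (forall i, f p (m i) = 0) -> lspan m v -> f p v = 0.
Proof.
move=> pm [c ->]; rewrite /lincomb (herm_sumr fH) big1// => i _.
by rewrite (hermZr fH) pm mulr0.
Qed.

Lemma lspan_bipolar (m : 'I_kappa -> X) x : negon f m ->
  lspan m x <-> forall y, (forall i, f y (m i) = 0) -> f x y = 0.
Proof.
move=> mn.
split=> [lx y ym|xo]; first by rewrite (herm_sym fH) (orth_lspan ym lx) rmorph0.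
have := xo (ncomp f m x) (fun i => ncomp_orth fH x i mn).
have -> : f x (ncomp f m x) = f (ncomp f m x) (ncomp f m x).
  rewrite [in RHS]/ncomp (hermDl fH) (herm_sym fH (ncomp f m x) (lincomb _ _)).
  rewrite (orth_lspan (fun i => ncomp_orth fH x i mn)) ?rmorph0 ?addr0//.
  by eexists.
move=> q0; have : ncomp f m x = 0.
  apply/eqP/negPn/negP => xn.
  have := pos_of_orth mn (fun i => ncomp_orth fH x i mn) xn.
  by rewrite /quad q0 ltxx.
move=> /eqP; rewrite addr_eq0 => /eqP ->.
exists (fun i => -1 * f x (m i)); by rewrite -lincombZ scaleN1r.
Qed.

(** Any maximal orthonormal negative family splits the space; completeness of
    the positive part comes from the equivalence of all frame norms. *)
Lemma decomposition_of_negon (m : 'I_kappa -> X) : negon f m ->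
  fundamental_decomposition f [set x | forall i, f x (m i) = 0] (lspan m).
Proof.
move=> mn; have [c c0 cP] := negon_nq_le mn.
have lsE x := lspan_bipolar x mn.
split.
- move=> x; exists (ncomp f m x), (- lincomb m (fun i => f x (m i))).
  split; [by move=> i; exact: ncomp_orth| |by rewrite addrK].
  by exists (fun i => -1 * f x (m i)); rewrite -lincombZ scaleN1r.
- by move=> p v /= pm; exact: orth_lspan.
- apply: (hilbert_closed fH (c := c) (d := 1)) => //.
  + exact: submod_orth.
  + move=> x /= xm; apply: le_trans (cP x) _.
    rewrite (quad_maj fH) big1 ?mulr0 ?addr0// => i _; by rewrite xm sqn0.
  + by move=> x _; rewrite mul1r quad_le_nq.
  + by move=> u l um ul i /=; apply: qcvg_form ul _ => k; exact: um.
- apply: (hilbert_closed (hermitian_opp fH) (c := c) (d := 1)) => //.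
  + exact: submod_lspan.
  + move=> x [d xE]; apply: le_trans (cP x) _; rewrite quad_opp.
    rewrite ler_pM2l// (quad_maj fH) xE (negon_quad fH)//.
    under [X in _ + 2 * X]eq_bigr => i _ do rewrite (negon_coord fH)// sqnN.
    by rewrite opprK; lra.
  + by move=> x _; rewrite mul1r quad_opp Nquad_le_nq.
  + move=> u l um ul; apply/lsE => y ym.
    by apply: qcvg_form ul _ => k; have /lsE := um k; apply.
- exists kappa, m; split => // d d0 i.
  by have := negon_coord fH d i mn; rewrite {1}/lincomb d0 (herm0l fH) => /eqP;
     rewrite eq_sym oppr_eq0 => /eqP.
Qed.

Lemma negon_of_decomposition P N : fundamental_decomposition f P N ->
  exists m : 'I_kappa -> X,
    [/\ negon f m, N = lspan m & P = [set x | forall i, f x (m i) = 0]].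
Proof.
move=> FD; have [dec orth hP hN [k dimN]] := FD.
have [m [mn mE]] := has_dim_negdef fH hN dimN.
have mf := frame_of_decomposition fH FD mn mE.
have kk : k = kappa.
  apply/eqP; rewrite eqn_leq (negdef_le_frame fH nf (negon_negdef fH mn)) /=.
  exact: (negdef_le_frame fH mf (negon_negdef fH nf.1)).
subst k; exists m; split=> //; apply/seteqP; split=> [p Pp i /=|x /= xm].
  apply: orth => //; rewrite mE.
  by exists (fun j => (j == i)%:R); rewrite lincomb_delta.
have [p [v [Pp Nv xE]]] := dec x.
suff v0 : v = 0 by rewrite xE v0 addr0.
have : f x v = 0 by apply: orth_lspan xm _; rewrite -mE.
rewrite xE (hermDl fH) orth// add0r => v0.
apply/eqP/negPn/negP => vn; have [_ /(_ v Nv vn)] := hN.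
by rewrite v0 oppr0 ltxx.
Qed.

End Pontryagin.

(** * Weak limits along ultrafilters *)

Lemma ultra_bounded_cvg (R : realType) (U : set_system nat) (a : nat -> R) (M : R) :
  UltraFilter U -> (forall k, `|a k| <= M) -> exists l : R, a k @[k --> U] --> l.
Proof.
move=> UU aM; have UP : ProperFilter U by exact: ultra_proper.
have aU : (a @ U) [set` `[- M, M]].
  apply: (@filterS _ U _ setT _ _ filterT) => k _ /=.
  by rewrite in_itv /= -ler_norml.
have [l [_ al]] := segment_compact (fmap_proper_filter a UP) aU.
exists l; apply/cvgrPdist_lt => e e0.
have [//|Uc] := in_ultra_setVsetC [set k | `|l - a k| < e] UU.
have [||y [/= ny ye]] := al (~` ball l e) (ball l e).
- by apply: (@filterS _ U _ _ _ _ Uc) => k /=; rewrite -ball_normE.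
- exact: nbhsx_ballx.
by [].
Qed.

Section WeakLimits.
Variables (R : realType) (X : completeNormedModType R[i]) (f : X -> X -> R[i]).
Variables (kappa : nat) (n : 'I_kappa -> X).
Hypothesis fH : hermitian_form f.
Hypothesis nf : frame f n.
Hypothesis nqE : forall x : X, nq x = quad (maj f n) x.

Lemma pontryagin_riesz (phi : X -> R[i]) (B : R) :
  (forall a x y, phi (a *: x + y) = a * phi x + phi y) ->
  (forall x, sqn (phi x) <= B * nq x) ->
  exists r, forall x, phi x = f x r.
Proof.
move=> phiL phiB; have mH := maj_herm fH n.
have hX : hilbert_subspace (maj f n) setT.
  apply: (hilbert_closed mH (c := 1) (d := 1)) => //.
  - by split=> [|a x y _ _]; rewrite inE.
  - by move=> x _; rewrite mul1r nqE.
  - by move=> x _; rewrite mul1r nqE.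
have [||y _ yP] := riesz mH (phi := phi) (B := B) hX.
- by move=> a x y _ _.
- by move=> x _; rewrite -nqE.
by exists (fundsym f n y) => x; rewrite yP// (majE fH).
Qed.

Lemma form_nondeg x y : (forall z, re (f z x) = re (f z y)) -> x = y.
Proof.
move=> xy; apply/eqP; rewrite -subr_eq0 -nq_eq0 nqE /quad (majE fH) (re_herm_sym fH).
by rewrite (hermBr fH) reB xy subrr.
Qed.

Section Ultra.
Variable (U : set_system nat).
Context {UU : UltraFilter U}.
Implicit Types (z : nat -> X) (y : X).

Definition wcvg z y := forall x, re (f x (z k)) @[k --> U] --> re (f x y).

Lemma wcvg_exists z (B : R) : (forall k, nq (z k) <= B) -> exists y, wcvg z y.
Proof.
move=> zB; have zb x k : sqn (f x (z k)) <= nq x * B.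
  apply: le_trans (form_le fH nf nqE _ _) _.
  by rewrite ler_wpM2l// nq_ge0.
have B0 : 0 <= B by apply: le_trans (zB 0%N); exact: nq_ge0.
have bd x (g : R[i] -> R) : (forall w, g w ^+ 2 <= sqn w) ->
    exists l : R, g (f x (z k)) @[k --> U] --> l.
  move=> gs; apply: (@ultra_bounded_cvg _ _ _ (Num.sqrt (nq x * B))) => k.
  rewrite -sqrtr_sqr ler_wsqrtr//; exact: le_trans (gs _) (zb x k).
have /choice[p pP] := fun x => bd x (@complex.Re R) (fun w => re_sqr_le w).
have ims (w : R[i]) : complex.Im w ^+ 2 <= sqn w by rewrite /sqn lerDr sqr_ge0.
have /choice[q qP] := fun x => bd x (@complex.Im R) ims.
pose phi x := Complex (p x) (q x).
have limU (g : nat -> R) (a b : R) :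
    g k @[k --> U] --> a -> g k @[k --> U] --> b -> a = b.
  by move=> ga gb; apply: cvg_unique ga gb; exact: norm_hausdorff.
have phiL a x y : phi (a *: x + y) = a * phi x + phi y.
  apply/eqP; rewrite eq_complex; case: a => a b /=; apply/andP; split; apply/eqP.
    apply: limU (pP _) _.
    have -> : (fun k => re (f (Complex a b *: x + y) (z k))) =
       (fun k => (a * re (f x (z k)) - b * complex.Im (f x (z k))) + re (f y (z k))).
      apply/funext => k; rewrite (hermPl fH).
      by case: (f x _) (f y _) => [? ?] [].
    by apply: cvgD (pP y); apply: cvgB; apply: cvgMr.
  apply: limU (qP _) _.
  have -> : (fun k => complex.Im (f (Complex a b *: x + y) (z k))) =
     (fun k => (a * complex.Im (f x (z k)) + b * re (f x (z k)))
               + complex.Im (f y (z k))).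
    apply/funext => k; rewrite (hermPl fH).
    by case: (f x _) (f y _) => [? ?] [].
  by apply: cvgD (qP y); apply: cvgD; apply: cvgMr.
have phiB x : sqn (phi x) <= B * nq x.
  have cl := @closed_le R (B * nq x).
  apply: (@closed_cvg _ _ U _ (fun k => sqn (f x (z k))) _ cl).
    by apply: nearW => k /=; rewrite mulrC.
  by rewrite /sqn /= !expr2; apply: cvgD; apply: cvgM.
have [r rP] := pontryagin_riesz phiL phiB.
by exists r => x; rewrite -rP; exact: pP.
Qed.

Lemma wcvg_im z y x : wcvg z y ->
  complex.Im (f x (z k)) @[k --> U] --> complex.Im (f x y).
Proof.
move=> zy; have E w : complex.Im (f x w) = re (f (- 'i%C *: x) w).
  by rewrite (hermZl fH); case: (f x w) => a b /=; ring.
by under eq_fun do rewrite E; rewrite E; exact: zy.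
Qed.

Lemma wcvg_sqn z y x : wcvg z y ->
  sqn (f x (z k)) @[k --> U] --> sqn (f x y).
Proof.
move=> zy; rewrite /sqn /= !expr2; under eq_fun do rewrite !expr2.
by apply: cvgD; apply: cvgM; rewrite ?zy//; exact: wcvg_im.
Qed.

Lemma cvg_sumU k (F : 'I_k -> nat -> R) (a : 'I_k -> R) :
  (forall i, F i j @[j --> U] --> a i) ->
  \sum_i F i j @[j --> U] --> \sum_i a i.
Proof.
elim: k F a => [|k IH] F a Fa.
  by rewrite big_ord0; under eq_fun do rewrite big_ord0; exact: cvg_cst.
rewrite big_ord_recl; under eq_fun do rewrite big_ord_recl.
by apply: cvgD => //; exact: IH.
Qed.

Lemma wcvg_coord z y : wcvg z y ->
  \sum_i sqn (f (z k) (n i)) @[k --> U] --> \sum_i sqn (f y (n i)).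
Proof.
move=> zy.
have E w : \sum_i sqn (f w (n i)) = \sum_i sqn (f (n i) w).
  by apply: eq_bigr => i _; rewrite (herm_sym fH) sqn_conj.
under eq_fun do rewrite E.
by rewrite E; apply: cvg_sumU => i; exact: wcvg_sqn.
Qed.

Lemma cvgU_le (a b : nat -> R) (l m : R) : (forall k, a k <= b k) ->
  a k @[k --> U] --> l -> b k @[k --> U] --> m -> l <= m.
Proof.
move=> ab al bm; rewrite -subr_ge0.
apply: (@closed_cvg _ _ U _ (fun k => b k - a k) _ (@closed_ge R 0)).
  by apply: nearW => k /=; rewrite subr_ge0.
exact: cvgB.
Qed.

(** The form is weakly lower semicontinuous: it is the square of the norm minus
    a function of finitely many coordinates. *)
Lemma wcvg_quad_le z y (a : nat -> R) (l : R) : wcvg z y ->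
  (forall k, quad f (z k) <= a k) -> a k @[k --> U] --> l -> quad f y <= l.
Proof.
move=> zy za al.
have ineq k : 2 * re (f (fundsym f n y) (z k)) - nq y - 2 * \sum_i sqn (f (z k) (n i))
    <= a k.
  apply: le_trans (za k).
  have : 0 <= nq (z k - y) by exact: nq_ge0.
  rewrite nqE (quadB (maj_herm fH n)) -!nqE (majE fH) (re_herm_sym fH).
  by rewrite (nq_quad fH nqE (z k)); lra.
have E : 2 * re (f (fundsym f n y) y) - nq y - 2 * \sum_i sqn (f y (n i)) = quad f y.
  rewrite (re_herm_sym fH) -(majE fH) -/(quad (maj f n) y) -nqE.
  by rewrite (nq_quad fH nqE y); ring.
rewrite -E; apply: cvgU_le ineq _ al.
apply: cvgB; last by apply: cvgMr; exact: wcvg_coord.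
by apply: cvgB; [apply: cvgMr; exact: zy|exact: cvg_cst].
Qed.

Lemma wcvg_functional z y (phi : X -> R[i]) (B : R) :
  (forall a x y, phi (a *: x + y) = a * phi x + phi y) ->
  (forall x, sqn (phi x) <= B * nq x) ->
  wcvg z y -> re (phi (z k)) @[k --> U] --> re (phi y).
Proof.
move=> phiL phiB zy; have [r rP] := pontryagin_riesz phiL phiB.
have E w : re (phi w) = re (f r w) by rewrite rP (re_herm_sym fH).
by under eq_fun do rewrite E; rewrite E; exact: zy.
Qed.

Lemma wcvg_lin z y (T : X -> X) : continuous_linear T ->
  wcvg z y -> wcvg (T \o z) (T y).
Proof.
move=> cT zy x; have [c c0 cP] := bounded_of_continuous cT.
have E w : re (f x (T w)) = re (f (T w) x) by rewrite (re_herm_sym fH).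
under eq_fun do rewrite E; rewrite E.
apply: (@wcvg_functional _ _ (fun w => f (T w) x) (c * nq x)) => //.
  by move=> a u v; rewrite cT.1 (hermPl fH).
move=> u; apply: le_trans (form_le fH nf nqE _ _) _.
by rewrite [leRHS]mulrAC; apply: ler_wpM2r; [exact: nq_ge0|exact: cP].
Qed.

Lemma wcvg_unique z y y' : wcvg z y -> wcvg z y' -> y = y'.
Proof.
move=> zy zy'; apply: form_nondeg => x.
by apply: cvg_unique (zy x) (zy' x); exact: norm_hausdorff.
Qed.

Lemma wcvg_out z y (Y : hilbertSpace R) (T : X -> Y) (a : nat -> R) :
  continuous_linear T -> wcvg z y -> (forall k, nq (T (z k)) <= a k) ->
  a k @[k --> U] --> (0 : R) -> T y = 0.
Proof.
move=> cT zy Ta a0; have [c c0 cP] := bounded_of_continuous cT.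
pose phi w := hs_dot Y (T w) (T y).
have phiL b u v : phi (b *: u + v) = b * phi u + phi v.
  by rewrite /phi cT.1 (hermPl (hs_hermitian Y)).
have phiB u : sqn (phi u) <= c * nq (T y) * nq u.
  apply: le_trans (hs_cauchy_schwarz _ _) _.
  by rewrite [leRHS]mulrAC; apply: ler_wpM2r; [exact: nq_ge0|exact: cP].
have lim := wcvg_functional phiL phiB zy.
have : re (phi y) ^+ 2 <= 0 * nq (T y).
  apply: (@cvgU_le (fun k => re (phi (z k)) ^+ 2) (fun k => a k * nq (T y))).
  - move=> k; apply: le_trans (re_sqr_le _) _.
    apply: le_trans (hs_cauchy_schwarz _ _) _.
    by rewrite ler_wpM2r ?nq_ge0.
  - by rewrite expr2; under eq_fun do rewrite expr2; exact: cvgM.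
  - by apply: cvgM => //; exact: cvg_cst.
rewrite mul0r => H; apply/eqP; rewrite -nq_eq0 -hs_quad -sqrf_eq0.
by apply/eqP/le_anti; rewrite H sqr_ge0.
Qed.

End Ultra.

End WeakLimits.

(** * Orbits of an observable contraction *)

Lemma decrease_small (R : realType) (s : nat -> R) (b e : R) : 0 < e ->
  (forall k, b <= s k) -> (forall k, s k.+1 <= s k) ->
  exists N, forall k, (N <= k)%N -> s k - s k.+1 < e.
Proof.
move=> e0 bs ds.
have mono k j : s (k + j)%N <= s k.
  elim: j => [|j IH]; first by rewrite addn0.
  by rewrite addnS; exact: le_trans (ds _) IH.
have hi : has_inf (range s).
  by split; [exists (s 0%N); exists 0%N|exists b => _ [k _ <-]].
have [_ [N _ <-] Ni] := inf_adherent e0 hi.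
exists N => k Nk; have := mono N (k - N)%N; rewrite subnKC// => kN.
have : inf (range s) <= s k.+1 by apply: ge_inf; [exact: hi.2|exists k.+1].
lra.
Qed.

Lemma small_perturbation (R : realType) (a b r q D : R) :
  b < D / 4 -> b * (16 * (a + 1)) < D ^+ 2 -> 0 < D ->
  0 <= a -> 0 <= b -> r ^+ 2 <= a * b -> q <= b -> 0 <= - D + q + 2 * r -> False.
Proof.
move=> b1 b2 D0 a0 b0 rab qb H; have r1 : D / 4 < r by lra.
have : (D / 4) ^+ 2 < r ^+ 2 by rewrite ltr_pXn2r// nnegrE; lra.
rewrite (_ : (D / 4) ^+ 2 = D ^+ 2 / 16); last by field.
nra.
Qed.

Section Orbits.
Variables (R : realType) (X : completeNormedModType R[i]) (f : X -> X -> R[i]).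
Variables (kappa : nat) (n : 'I_kappa -> X).
Hypothesis fH : hermitian_form f.
Hypothesis nf : frame f n.
Hypothesis nqE : forall x : X, nq x = quad (maj f n) x.
Variables (Y : hilbertSpace R) (A : X -> X) (C : X -> Y).
Hypothesis cA : continuous_linear A.
Hypothesis cC : continuous_linear C.
Hypothesis dissip : forall x, quad f (A x) + nq (C x) <= quad f x.
Hypothesis observable : forall x,
  (forall j, C (iter j A x) = 0) -> quad f x <= 0 -> x = 0.

Let A0 : A 0 = 0.
Proof. exact: (linear_0 cA.1). Qed.
Let C0 : C 0 = 0.
Proof. exact: (linear_0 cC.1). Qed.

Lemma continuous_iter j : continuous_linear (iter j A).
Proof.
split=> [a x y|]; first by elim: j => [//|j IH]; rewrite !iterS IH cA.1.
elim: j => [|j IH] x //; exact: (continuous_comp (IH x) (cA.2 _)).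
Qed.

Lemma continuous_out j : continuous_linear (C \o iter j A).
Proof.
split=> [a x y /=|x]; first by rewrite (continuous_iter j).1 cC.1.
exact: (continuous_comp ((continuous_iter j).2 x) (cC.2 _)).
Qed.

Let it0 j : iter j A 0 = 0. Proof. by elim: j => [//|j IH]; rewrite iterS IH. Qed.
Let itZ j a x : iter j A (a *: x) = a *: iter j A x.
Proof. by have := (continuous_iter j).1 a x 0; rewrite it0 !addr0. Qed.
Let itD j x y : iter j A (x + y) = iter j A x + iter j A y.
Proof. by have := (continuous_iter j).1 1 x y; rewrite !scale1r. Qed.
Let itB j x y : iter j A (x - y) = iter j A x - iter j A y.
Proof. by rewrite -scaleN1r itD itZ scaleN1r. Qed.
Let CZ a x : C (a *: x) = a *: C x.
Proof. by have := cC.1 a x 0; rewrite C0 !addr0. Qed.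

Lemma quadA_le x : quad f (A x) <= quad f x.
Proof. by apply: le_trans (dissip x); rewrite lerDl nq_ge0. Qed.

Lemma quad_iter_le j x : quad f (iter j A x) <= quad f x.
Proof. by elim: j => [//|j IH]; rewrite iterS; exact: le_trans (quadA_le _) IH. Qed.

Lemma nq_out_le x : nq (C x) <= quad f x - quad f (A x).
Proof. by have := dissip x; lra. Qed.

(** Observability is uniform: otherwise a weak limit of a bad sequence would be
    a nonzero unobservable vector that is not positive. *)
Lemma almost_unobservable (e : R) : 0 < e ->
  exists2 d : R, 0 < d & exists m : nat, forall z (B : R), 0 < B -> nq z <= B ->
    (forall j, (j < m)%N -> nq (C (iter j A z)) <= d * B) -> quad f z <= d * B ->
    \sum_i sqn (f z (n i)) < e * B.
Proof.
move=> e0; apply: contrapT => no.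
have bad (k : nat) : exists z, [/\ nq z <= 1,
    forall j, (j < k)%N -> nq (C (iter j A z)) <= k.+1%:R^-1,
    quad f z <= k.+1%:R^-1 & e <= \sum_i sqn (f z (n i))].
  apply: contrapT => nz; apply: no; exists k.+1%:R^-1; first by rewrite invr_gt0.
  exists k => z B B0 zB zC zq; rewrite ltNge; apply/negP => ze; apply: nz.
  pose s := (Num.sqrt B)^-1.
  have s2 : s ^+ 2 = B^-1 by rewrite exprVn sqr_sqrtr// ltW.
  have sc : sqn (s%:C%C : R[i]) = B^-1 by rewrite sqn_real.
  exists (s%:C%C *: z); split.
  - by rewrite nqZ sc mulrC ler_pdivrMr// mul1r.
  - move=> j jk; rewrite itZ CZ nqZ sc mulrC ler_pdivrMr//; exact: zC.
  - by rewrite (quadZ fH) sc mulrC ler_pdivrMr.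
  - under eq_bigr => i _ do rewrite (hermZl fH) sqnM sc.
    by rewrite -mulr_sumr mulrC ler_pdivlMr.
have /choice[z zP] := bad.
have [U [UU oU]] := ultraFilterLemma (F := \oo) _.
have [y zy] : exists y, wcvg f U z y.
  by apply: (wcvg_exists fH nf nqE (B := 1)) => k; case: (zP k).
have lim0 : (k.+1%:R^-1 : R) @[k --> U] --> (0 : R).
  apply/cvgrPdist_lt => d d0; apply: oU.
  have [N NP] := inv_small d0; apply/nearoP; exists N => k /NP.
  by rewrite sub0r normrN ger0_norm// invr_ge0.
have y0 : y = 0.
  apply: observable => [j|]; last first.
    by apply: (wcvg_quad_le fH nqE zy _ lim0) => k; case: (zP k).
  pose z' k := if (k <= j)%N then 0 else z k.
  have z'y : wcvg f U z' y.
    move=> x; apply: cvg_trans (zy x); apply: near_eq_cvg; apply: oU.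
    by apply/nearoP; exists j.+1 => k jk; rewrite /z' leqNgt jk.
  rewrite -[C _]/((C \o iter j A) y).
  apply: (wcvg_out fH nqE (continuous_out j) z'y _ lim0) => k /=.
  rewrite /z'; case: leqP => kj; first by rewrite it0 C0 nq0 invr_ge0.
  by have [_ ->] := zP k.
have : e <= \sum_i sqn (f y (n i)).
  apply: (cvgU_le (a := fun=> e) (b := fun k => \sum_i sqn (f (z k) (n i)))
    _ (cvg_cst _) (wcvg_coord (n := n) fH zy)) => k.
  by case: (zP k).
rewrite y0 big1 ?leNgt ?e0// => i _.
by rewrite (herm0l fH) sqn0.
Qed.

Definition orbit (x : nat -> X) := forall k, A (x k.+1) = x k.

Lemma iter_orbit x j k : orbit x -> iter j A (x (k + j)%N) = x k.
Proof.
by move=> ox; elim: j k => [|j IH] k; rewrite ?addn0// iterSr addnS ox IH.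
Qed.

Lemma iter_orbit_lt x j k : orbit x -> (j <= k)%N -> iter j A (x k) = x (k - j)%N.
Proof. by move=> ox jk; rewrite -{1}(subnK jk) iter_orbit. Qed.

Lemma orbit_cvg0 x : orbit x -> (forall k, quad f (x k) <= 0) -> qcvg (@nq R X) x 0.
Proof.
move=> ox xq eta eta0.
have [|d d0 [m dm]] := @almost_unobservable 4^-1; first by rewrite invr_gt0.
have [||N NP] := @decrease_small _ (fun k => - quad f (x k)) 0 _ (mulr_gt0 d0 eta0).
- by move=> k; rewrite oppr_ge0.
- by move=> k; rewrite lerN2 -(ox k) quadA_le.
exists (N + m).+1 => k Nk; rewrite subr0 ltNge; apply/negP => kbig.
have k0 : 0 < nq (x k) by exact: lt_le_trans kbig.
have : \sum_i sqn (f (x k) (n i)) < 4^-1 * nq (x k).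
  apply: dm => // [j jm|]; last by apply: le_trans (xq k) _; rewrite mulr_ge0// ltW.
  have jk : (j < k)%N by rewrite (leq_trans jm)// (leq_trans _ Nk)// leqW// leq_addl.
  rewrite iter_orbit_lt// 1?ltnW//.
  have [l lE] : exists l, (k - j)%N = l.+1 by exists (k - j).-1; rewrite prednK// subn_gt0.
  apply: le_trans (nq_out_le _) _; rewrite lE ox.
  have Nl : (N <= l)%N.
    rewrite -ltnS -lE ltn_subRL; apply: leq_trans Nk; rewrite ltnS addnC.
    by rewrite leq_add2l ltnW.
  have := NP l Nl; rewrite opprK addrC => /ltW /le_trans; apply.
  by rewrite ler_wpM2l// ltW.
have := xq k; have := nq_quad fH nqE (x k); lra.
Qed.

Lemma quad_iter_nonincr k j x : quad f (iter (j + k) A x) <= quad f (iter k A x).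
Proof. by rewrite iterD; exact: quad_iter_le. Qed.

(** A vector whose orbit never leaves the nonnegative cone is small as soon as
    its square is: otherwise it would be almost unobservable. *)
Lemma nonneg_orbit_bound : exists2 M : R, 0 < M &
  forall x, (forall k, 0 <= quad f (iter k A x)) -> nq x <= M * quad f x.
Proof.
have [|d d0 [m dm]] := @almost_unobservable 4^-1; first by rewrite invr_gt0.
have di : 0 < d^-1 by rewrite invr_gt0.
exists (2 + d^-1) => [|x xq]; first by rewrite addr_gt0.
rewrite leNgt; apply/negP => xbig.
have q0 : 0 <= quad f x := xq 0%N.
have B0 : 0 < nq x by apply: le_lt_trans xbig; rewrite mulr_ge0// ltW// addr_gt0.
have qd : quad f x <= d * nq x.
  rewrite -ler_pdivrMl//; apply: ltW; apply: le_lt_trans xbig.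
  by rewrite ler_wpM2r// lerDr.
have := dm x (nq x) B0 (lexx _) _ qd.
have -> : (forall j, (j < m)%N -> nq (C (iter j A x)) <= d * nq x) = True.
  apply/propext; split=> // _ j _; apply: le_trans qd.
  apply: le_trans (nq_out_le _) _; have := xq j.+1; rewrite iterS => xj.
  by apply: le_trans (quad_iter_le j x); rewrite gerBl.
move=> /(_ I); have := nq_quad fH nqE x; nra.
Qed.

Definition bounded_orbit x := exists B : R, forall k, nq (iter k A x) <= B.

Lemma bounded_orbit_quad x : bounded_orbit x -> x != 0 -> 0 < quad f x.
Proof.
move=> [B xB] x0; rewrite ltNge; apply/negP => xq.
pose s k := quad f (iter k A x).
have ds k : s k.+1 <= s k by exact: quadA_le.
have sb k : - B <= s k.
  by have := Nquad_le_nq fH nf nqE (iter k A x); have := xB k; rewrite /s; lra.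
have B0 : 0 < B + 1.
  by apply: lt_le_trans ltr01 _; rewrite lerDr; apply: le_trans (xB 0%N); exact: nq_ge0.
have s0 k : 0 <= s k.
  rewrite leNgt; apply/negP => sk.
  have e0 : 0 < - s k / (4 * (B + 1)) by rewrite divr_gt0 ?mulr_gt0// oppr_gt0.
  have [d d0 [m dm]] := almost_unobservable e0.
  have [N NP] := decrease_small (mulr_gt0 d0 B0) sb ds.
  pose z := iter (maxn N k) A x.
  have zk : quad f z <= s k.
    by rewrite /z -(subnK (leq_maxr N k)); exact: quad_iter_nonincr.
  have zB : nq z <= B + 1 by apply: le_trans (xB _) _; rewrite lerDl.
  have : \sum_i sqn (f z (n i)) < - s k / (4 * (B + 1)) * (B + 1).
    apply: dm => // [j _|]; last first.
      apply: le_trans zk _; apply: le_trans (ltW sk) _.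
      by rewrite mulr_ge0// ltW.
    rewrite /z -iterD; set l := (j + _)%N.
    apply: le_trans (nq_out_le _) _; apply/ltW/NP.
    by rewrite /l (leq_trans (leq_maxl N k))// leq_addl.
  have -> : - s k / (4 * (B + 1)) * (B + 1) = - s k / 4.
    by field; rewrite gt_eqF.
  have := nq_quad fH nqE z; have := nq_ge0 z; lra.
have s00 k : s k = 0.
  by apply/le_anti; rewrite s0 andbT; apply: le_trans (quad_iter_le k x) xq.
case/eqP: x0; apply: observable => // j.
apply/eqP; rewrite -nq_eq0; apply/eqP/le_anti; rewrite nq_ge0 andbT.
apply: le_trans (nq_out_le _) _.
by rewrite -iterS -/(s j) -/(s j.+1) !s00 subrr.
Qed.

(** ** The invariant positive subspace *)

(** The orbits of an invariant positive subspace stay in the nonnegative cone. *)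
Definition posinv : set X := [set x | forall k, 0 <= quad f (iter k A x)].

Lemma posinvP x : posinv x <-> bounded_orbit x.
Proof.
split=> [xW|[B xB] k].
  have [M M0 MP] := nonneg_orbit_bound.
  exists (M * quad f x) => k.
  apply: le_trans (MP _ _) _; last by apply: ler_wpM2l; [exact: ltW|exact: quad_iter_le].
  by move=> j; rewrite -iterD; exact: xW.
have [->|xk] := eqVneq (iter k A x) 0; first by rewrite (quad0 fH).
apply/ltW/bounded_orbit_quad => //; exists B => j; by rewrite -iterD.
Qed.

Lemma posinv_gt0 x : posinv x -> x != 0 -> 0 < quad f x.
Proof. by move=> /posinvP; exact: bounded_orbit_quad. Qed.

Lemma posinv_submod : submod_closed (mem posinv).
Proof.
split=> [|a x y]; rewrite !inE; first by move=> k; rewrite it0 (quad0 fH).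
move=> /posinvP[B xB] /posinvP[D yD]; apply/posinvP.
exists (2 * (sqn a * B) + 2 * D) => k; rewrite itD itZ.
apply: le_trans (nqD_le _ _) _; rewrite nqZ lerD// ler_wpM2l//.
by rewrite ler_wpM2l ?sqn_ge0.
Qed.

Lemma posinvA x : posinv x -> posinv (A x).
Proof. by move=> xW k; rewrite -iterSr; exact: xW. Qed.

Lemma quad_ge0_closed x : (forall e : R, 0 < e ->
    exists2 y, nq (y - x) < e & 0 <= quad f y) -> 0 <= quad f x.
Proof.
move=> xc; rewrite leNgt; apply/negP => xq.
pose D := - quad f x; have D0 : 0 < D by rewrite oppr_gt0.
have x1 : 0 < nq x + 1 by rewrite ltr_wpDl// nq_ge0.
have e0 : 0 < Num.min (D / 4) (D ^+ 2 / (16 * (nq x + 1))).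
  by rewrite lt_min !divr_gt0 ?mulr_gt0// exprn_gt0.
have [y yx yq] := xc _ e0.
have y1 : nq (y - x) < D / 4 by apply: lt_le_trans yx _; rewrite ge_min lexx.
have y2 : nq (y - x) * (16 * (nq x + 1)) < D ^+ 2.
  by rewrite -ltr_pdivlMr ?mulr_gt0//; apply: lt_le_trans yx _; rewrite ge_min lexx orbT.
have := yq; rewrite -(subrK x y) addrC (quadD fH).
have := quad_le_nq fH nqE (y - x).
have : re (f x (y - x)) ^+ 2 <= nq x * nq (y - x).
  exact: le_trans (re_sqr_le _) (form_le fH nf nqE _ _).
have := nq_ge0 (y - x); have := nq_ge0 x.
have qD : quad f x = - D by rewrite opprK.
move: y1 y2 D0; rewrite qD; exact: small_perturbation.
Qed.

Lemma posinv_closed u l : (forall k, posinv (u k)) -> qcvg (@nq R X) u l -> posinv l.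
Proof.
move=> uW ul k; apply: quad_ge0_closed => e e0.
have [N NP] := qcvg_lin (continuous_iter k) ul e0.
by exists (iter k A (u N)); [exact: (NP N)|exact: uW].
Qed.

Lemma posinv_hilbert : hilbert_subspace f posinv.
Proof.
have [M M0 MP] := nonneg_orbit_bound.
apply: (hilbert_closed fH (c := M) (d := 1)) => //.
- exact: posinv_submod.
- by move=> x _; rewrite mul1r (quad_le_nq fH nqE).
- exact: posinv_closed.
Qed.

(** A power of a contraction maps a maximal negative subspace onto a subspace
    that is still in bijection with it by orthogonal projection, because the
    image is negative definite of the same dimension. *)
Lemma iter_coord_solve (m : 'I_kappa -> X) k (t : 'I_kappa -> R[i]) : negon f m ->
  exists c, forall j, f (iter k A (lincomb m c)) (m j) = t j.
Proof.
move=> mn; have mf := frame_max fH nf mn.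
pose a i j := f (iter k A (m i)) (m j).
have aE c j : f (iter k A (lincomb m c)) (m j) = \sum_i c i * a i j.
  rewrite (lincomb_lin _ _ (continuous_iter k).1) /lincomb (herm_suml fH).
  by apply: eq_bigr => i _; rewrite (hermZl fH).
pose b (i : 'I_kappa.+1) := if unlift ord0 i is Some i' then a i' else t.
have [c [[i ci] cb]] := exists_kernel_comb b (ltnSn kappa).
pose d i' := c (lift ord0 i').
have cb' j : c ord0 * t j + \sum_i d i * a i j = 0.
  rewrite -[RHS](cb j) big_ord_recl /b unlift_none; congr (_ + _).
  by apply: eq_bigr => i' _; rewrite liftK.
have c0 : c ord0 != 0.
  apply/eqP => c0.
  have dn : exists i, d i != 0.
    move: ci; case: (unliftP ord0 i) => [i'|] ->; first by exists i'.
    by rewrite c0 eqxx.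
  have := negon_negdef fH mn dn; rewrite ltNge => /negP; apply.
  apply: le_trans (quad_iter_le k _); apply: mf.2 => j.
  by rewrite aE; have := cb' j; rewrite c0 mul0r add0r.
exists (fun i => - (c ord0)^-1 * d i) => j; rewrite aE.
under eq_bigr => i' _ do rewrite -mulrA.
rewrite -mulr_sumr; have /eqP := cb' j; rewrite addrC addr_eq0 => /eqP ->.
by rewrite mulrNN mulrA mulVf ?mul1r.
Qed.

Lemma nq_lincomb (c : 'I_kappa -> R[i]) : nq (lincomb n c) = \sum_i sqn (c i).
Proof.
rewrite (nq_quad fH nqE) (negon_quad fH c nf.1).
under [X in _ + 2 * X]eq_bigr => i _ do rewrite (negon_coord fH c i nf.1) sqnN.
ring.
Qed.

(** Every vector is brought into [posinv] by a correction from the span of the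
    frame; the corrections that work for the first [k] steps have a limit. *)
Lemma posinv_cover x : exists c, posinv (x + lincomb n c).
Proof.
have /choice[c cP] (k : nat) : exists c,
    forall j, f (iter k A (x + lincomb n c)) (n j) = 0.
  have [c cE] := iter_coord_solve k (fun j => - f (iter k A x) (n j)) nf.1.
  by exists c => j; rewrite itD (hermDl fH) cE subrr.
pose v k := lincomb n (c k).
have uq k j : (j <= k)%N -> 0 <= quad f (iter j A (x + v k)).
  move=> jk; apply: le_trans (nf.2 _ (cP k)) _.
  by rewrite -(subnK jk); exact: quad_iter_nonincr.
have vB k : nq (v k) <= 4 * nq (ncomp f n x) + 2 * nq x.
  have : nq (x + v k) <= 2 * nq (ncomp f n x).
    have E : ncomp f n (x + v k) = ncomp f n x.
      rewrite /ncomp -addrA; congr (_ + _); rewrite /v lincombD; congr lincomb.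
      apply/funext => i; rewrite (hermDl fH) (negon_coord fH _ _ nf.1); ring.
    have := quad_ncomp fH (x + v k) nf.1; rewrite E => q1.
    have := quad_le_nq fH nqE (ncomp f n x); have := uq k 0%N (leq0n _).
    have := nq_quad fH nqE (x + v k); rewrite /=; lra.
  have := nqD_le (x + v k) (- x); rewrite addrAC subrr add0r nqN; lra.
have [U [UU oU]] := ultraFilterLemma (F := \oo) _.
have [y vy] := wcvg_exists fH nf nqE vB (U := U).
pose c' i := - f y (n i).
exists c' => k; apply: quad_ge0_closed => e e0.
have [a a0 aP] := bounded_of_continuous (continuous_iter k).
have limv : \sum_i sqn (f (v j - y) (n i)) @[j --> U] --> (0 : R).
  have zy : wcvg f U (fun j => v j - y) 0.
    move=> z; rewrite -(subrr y) (hermBr fH) reB.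
    under eq_fun do rewrite (hermBr fH) reB.
    by apply: cvgB; [exact: vy|exact: cvg_cst].
  have E : \sum_i sqn (f 0 (n i)) = 0.
    by rewrite big1// => i _; rewrite (herm0l fH) sqn0.
  by have := wcvg_coord (n := n) fH zy; rewrite E => /(_ UU).
have Us : U [set j | (k <= j)%N] by apply: oU; exists k.
have Ue : U [set j | \sum_i sqn (f (v j - y) (n i)) < e / a].
  apply: (@filterS _ U _ _ _ _ ((cvgrPdist_lt _ _).1 limv _ (divr_gt0 e0 a0))).
  move=> j /=; rewrite sub0r normrN ger0_norm//.
  by rewrite sumr_ge0// => i _; exact: sqn_ge0.
have [j [/= kj je]] := filter_ex (filterI Us Ue).
exists (iter k A (x + v j)); last exact: uq.
rewrite -itB opprD addrACA subrr add0r.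
apply: le_lt_trans (aP _) _; rewrite -ltr_pdivlMl// mulrC.
have -> : v j - lincomb n c' = lincomb n (fun i => c j i - c' i).
  rewrite /v -scaleN1r lincombZ lincombD; congr lincomb.
  by apply/funext => i; rewrite mulN1r.
rewrite nq_lincomb; apply: le_lt_trans je; rewrite le_eqVlt; apply/orP; left.
apply/eqP/eq_bigr => i _; rewrite (hermBl fH) (negon_coord fH _ _ nf.1).
by rewrite -sqnN /c' opprB addrC.
Qed.

(** The vectors [n j - w j], where [w j] represents [f _ (n j)] on the Hilbert
    space [posinv], span a negative definite complement of [posinv]. Conversely
    an invariant positive subspace lies in [posinv], and it cannot be smaller:
    the negative component of a vector of [posinv] would lie in [posinv], where
    nonzero vectors have positive squares. *)
Theorem posinv_decomposition : exists! D : set X * set X,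
  fundamental_decomposition f D.1 D.2 /\ A @` D.1 `<=` D.1.
Proof.
have [M M0 MP] := nonneg_orbit_bound.
have Wadd x y : posinv x -> posinv y -> posinv (x + y).
  by move=> Wx Wy; have := posinv_submod.2 1 x y; rewrite !inE scale1r; exact.
have WZ a x : posinv x -> posinv (a *: x).
  move=> Wx; have := posinv_submod.2 a x 0; rewrite !inE addr0; apply => //.
  by have := posinv_submod.1; rewrite inE.
have /choice[w wP] (j : 'I_kappa) : exists w, posinv w /\
    forall x, posinv x -> f x (n j) = f x w.
  have [||w Ww wE] := riesz fH (phi := fun x => f x (n j)) (B := M * nq (n j))
      posinv_hilbert.
  - by move=> a x y _ _; rewrite (hermPl fH).
  - move=> x Wx; apply: le_trans (form_le fH nf nqE _ _) _.
    by rewrite [leRHS]mulrAC; apply: ler_wpM2r; [exact: nq_ge0|exact: MP].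
  by exists w.
have Wlin c : posinv (lincomb w c).
  apply: big_ind => //; first by have := posinv_submod.1; rewrite inE.
  by move=> i _; apply: WZ; case: (wP i).
pose r j := n j - w j.
have rW c x : posinv x -> f x (lincomb r c) = 0.
  move=> Wx; rewrite /lincomb (herm_sumr fH) big1// => j _.
  by rewrite (hermZr fH) (hermBr fH) (wP j).2// subrr mulr0.
have rE c : lincomb r c = lincomb n c - lincomb w c.
  rewrite /lincomb -sumrB; apply: eq_bigr => j _; exact: scalerBr.
have rn : negdef f r.
  move=> c c0; have := negon_negdef fH nf.1 c0.
  rewrite -[lincomb n c](subrK (lincomb w c)) -rE addrC (quad_orthD fH) ?rW//.
  by have := Wlin c 0%N; rewrite /=; lra.
have [m [mn mE]] := gram_schmidt fH rn.
have orthE : [set x | forall i, f x (m i) = 0] = posinv.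
  apply/seteqP; split=> [x /= xm|x Wx i /=]; last first.
    have [c ->] : lspan r (m i).
      by rewrite -mE; exists (fun j => (j == i)%:R); rewrite lincomb_delta.
    exact: rW.
  have [c Wc] := posinv_cover x.
  have W' : posinv (x + lincomb r c).
    rewrite rE addrA; apply: Wadd => //.
    by rewrite -scaleN1r; exact: WZ.
  have [[i ci]|c0] := pselect (exists i, c i != 0).
    have s0 : f x (lincomb r c) = 0.
      by apply: (orth_lspan fH xm); rewrite mE; exists c.
    have := rW c _ W'; rewrite (hermDl fH) s0 add0r => q0.
    have : quad f (lincomb r c) < 0 by apply: rn; exists i.
    by rewrite /quad q0 ltxx.
  suff r0 : lincomb r c = 0 by move: W'; rewrite r0 addr0.
  rewrite -(lincomb0 r); congr lincomb; apply/funext => i.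
  by apply/eqP/negPn/negP => ci; apply: c0; exists i.
have FD := decomposition_of_negon fH nf nqE mn.
exists (posinv, lspan m); split.
  by rewrite /= -{1}orthE; split=> // _ [x Wx <-]; exact: posinvA.
move=> [P N] [/= FD' AP].
have [m' [mn' NE PE]] := negon_of_decomposition fH nf FD'.
have PW : P `<=` posinv.
  move=> x Px k; have : P (iter k A x).
    by elim: k => [//|k IH]; rewrite iterS; apply: AP; exists (iter k A x).
  rewrite PE /= => xm; by apply: (frame_max fH nf mn').2.
have posP : P = posinv.
  apply/seteqP; split=> // x Wx; have [dec orth _ hN _] := FD'.
  have [p [v [Pp Nv xE]]] := dec x.
  suff v0 : v = 0 by rewrite xE v0 addr0.
  apply/eqP/negPn/negP => v0.
  have Wv : posinv v.
    have -> : v = x + (-1) *: p by rewrite xE scaleN1r addrAC subrr add0r.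
    by apply: Wadd => //; apply: WZ; exact: PW.
  have q1 := posinv_gt0 Wv v0; have [_ /(_ v Nv v0)] := hN.
  by rewrite (herm_quad fH) -rmorphN ltcR oppr_gt0 ltNge (ltW q1).
rewrite posP; congr (_, _); rewrite NE; apply/seteqP.
have same y : (forall i, f y (m i) = 0) <-> (forall i, f y (m' i) = 0).
  have -> : (forall i, f y (m i) = 0) = posinv y by rewrite -orthE.
  by rewrite -posP PE.
split=> x hx.
  apply/(lspan_bipolar fH nf nqE x mn') => y /same ym.
  exact: ((lspan_bipolar fH nf nqE x mn).1 hx y ym).
apply/(lspan_bipolar fH nf nqE x mn) => y /same ym.
exact: ((lspan_bipolar fH nf nqE x mn').1 hx y ym).
Qed.

(** ** The invariant negative subspace *)

(** A negative subspace invariant under a contraction consists of vectors with a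
    past, and observability makes this past vanish at infinity. *)
Definition neginv : set X :=
  [set x | exists p, [/\ orbit p, p 0%N = x & qcvg (@nq R X) p 0]].

Lemma orbit_quad_le p : orbit p -> qcvg (@nq R X) p 0 -> forall k, quad f (p k) <= 0.
Proof.
move=> po p0 k; rewrite leNgt; apply/negP => ok.
have [N NP] := p0 _ ok.
have := NP (k + N)%N (leq_addl _ _); rewrite subr0 ltNge => /negP; apply.
rewrite -(iter_orbit N k po); apply: le_trans (quad_iter_le _ _) _.
exact: (quad_le_nq fH nqE).
Qed.

Lemma orbit_neginv p : orbit p -> (forall k, quad f (p k) <= 0) -> neginv (p 0%N).
Proof. by move=> po oq; exists p; split=> //; exact: orbit_cvg0. Qed.

Lemma neginv_quad_le x : neginv x -> quad f x <= 0.
Proof. by move=> [p [po <- p0]]; exact: orbit_quad_le. Qed.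

Lemma qcvg0_comb (u v : nat -> X) a : qcvg (@nq R X) u 0 -> qcvg (@nq R X) v 0 ->
  qcvg (@nq R X) (fun k => a *: u k + v k) 0.
Proof.
move=> u0 v0 e e0.
have e1 : 0 < e / (4 * (sqn a + 1)).
  by rewrite divr_gt0// mulr_gt0// ltr_wpDl// sqn_ge0.
have [N1 P1] := u0 _ e1; have [N2 P2] := v0 (e / 4) (divr_gt0 e0 (ltr0n _ 4)).
exists (maxn N1 N2) => k; rewrite geq_max => /andP[k1 k2]; rewrite subr0.
have := P1 _ k1; have := P2 _ k2; rewrite !subr0 => vk uk.
apply: le_lt_trans (nqD_le _ _) _; rewrite nqZ.
move: uk; rewrite ltr_pdivlMr; last by rewrite mulr_gt0// ltr_wpDl// sqn_ge0.
have := nq_ge0 (u k); have := sqn_ge0 a; nra.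
Qed.

Lemma neginv_submod : submod_closed (mem neginv).
Proof.
split=> [|a x y]; rewrite !inE.
  exists (fun=> 0); split=> // e e0; exists 0%N => k _; by rewrite subr0 nq0.
move=> [u [uo <- u0]] [v [vo <- v0]]; exists (fun k => a *: u k + v k).
by split=> //; [move=> k; rewrite cA.1 uo vo|exact: qcvg0_comb].
Qed.

Lemma neginv_lincomb k (v : 'I_k -> X) c :
  (forall i, neginv (v i)) -> neginv (lincomb v c).
Proof.
move=> vN; rewrite /lincomb; elim/big_ind: _ => [|x y Nx Ny|i _].
- by have := neginv_submod.1; rewrite inE.
- by have := neginv_submod.2 1 x y; rewrite !inE scale1r; exact.
- have := neginv_submod.2 (c i) (v i) 0; rewrite !inE addr0; apply => //.
  by have := neginv_submod.1; rewrite inE.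
Qed.

Lemma neginvB x y : neginv x -> neginv y -> neginv (x - y).
Proof.
by move=> Nx Ny; have := neginv_submod.2 (-1) y x; rewrite !inE scaleN1r addrC; exact.
Qed.

Lemma neginvA x : neginv x -> neginv (A x).
Proof.
move=> [p [po ox p0]]; exists (fun k => if k is k'.+1 then p k' else A x); split=> //.
  by case=> [|k] //=; rewrite ox.
by move=> e /p0[N NP]; exists N.+1; case=> // k /NP.
Qed.

Lemma neginv_coord_inj x : neginv x -> (forall i, f x (n i) = 0) -> x = 0.
Proof.
move=> /neginv_quad_le xq x0; apply/eqP; rewrite -nq_eq0; apply/eqP/le_anti.
rewrite nq_ge0 andbT (nq_quad fH nqE) big1 ?mulr0 ?addr0// => i _.
by rewrite x0 sqn0.
Qed.

(** A neutral vector of the invariant negative subspace has an orbit without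
    output.  By a linear dependence it is a combination of its own past, so its
    future has no output either. *)
Lemma neginv_lt0 x : neginv x -> x != 0 -> quad f x < 0.
Proof.
move=> Nx x0; rewrite lt_neqAle neginv_quad_le// andbT.
apply: contra x0 => /eqP xq.
have [p [po ox p0]] := Nx.
have oq k : quad f (p k) = 0.
  apply/le_anti; rewrite orbit_quad_le//= -xq -ox.
  have := iter_orbit k 0 po; rewrite add0n => <-; exact: quad_iter_le.
have Co k : C (p k.+1) = 0.
  apply/eqP; rewrite -nq_eq0; apply/eqP/le_anti; rewrite nq_ge0 andbT.
  by apply: le_trans (nq_out_le _) _; rewrite po !oq subrr.
have oN k : neginv (p k).
  have [q' [pu' _ p0']] : neginv x by [].
  have pb : orbit (fun j => p (k + j)%N) by move=> j; rewrite addnS po.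
  have := orbit_neginv pb; rewrite addn0; apply => j; exact: orbit_quad_le.
have [c [[i0 ci0] c0]] := exists_kernel_comb
   (fun (k : 'I_kappa.+1) j => f (p k) (n j)) (ltnSn kappa).
have dep : lincomb (fun k : 'I_kappa.+1 => p k) c = 0.
  apply: neginv_coord_inj; first by apply: neginv_lincomb => k; exact: oN.
  move=> j; rewrite /lincomb (herm_suml fH) -[RHS](c0 j).
  by apply: eq_bigr => k _; rewrite (hermZl fH).
have [i ci imin] := arg_minnP (P := fun k => c k != 0)
   (fun k : 'I_kappa.+1 => k : nat) ci0.
have out j : C (iter j A (p 0%N)) = 0.
  elim/ltn_ind: j => j IH.
  have E : (C \o iter (i + j) A) (lincomb (fun k : 'I_kappa.+1 => p k) c) = 0.
    by rewrite dep /= it0 C0.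
  rewrite (lincomb_lin _ _ (continuous_out (i + j)).1) /lincomb (bigD1 i)//= in E.
  rewrite [X in _ + X]big1 in E; last first.
    move=> k ki; have [->|ck] := eqVneq (c k) 0; first by rewrite scale0r.
    have ik : (i < k)%N by rewrite ltn_neqAle imin// andbT eq_sym.
    have [kij|kij] := leqP k (i + j).
      have -> : (i + j = (i + j - k) + k)%N by rewrite subnK.
      rewrite iterD -[p k]/(p (0 + k)%N) iter_orbit// IH ?scaler0//.
      by rewrite ltn_subLR// ltn_add2r.
    rewrite (iter_orbit_lt po (ltnW kij)).
    have -> : (k - (i + j) = (k - (i + j)).-1.+1)%N by rewrite prednK// subn_gt0.
    by rewrite Co scaler0.
  move: E; rewrite addr0 addnC iterD -[p i]/(p (0 + i)%N) iter_orbit//.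
  by move/eqP; rewrite scaler_eq0 (negPf ci) => /eqP.
by apply/eqP/observable; rewrite -?ox// oq.
Qed.

(** The orbits that start in the span of the frame and end, after [K] steps, at
    prescribed coordinates are bounded independently of [K]: a large vector in
    such an orbit would be almost unobservable. *)
Lemma backward_bound (t : 'I_kappa -> R[i]) : exists B : R,
  forall K x, (forall k, quad f (iter k A x) <= 0) ->
    (forall j, f (iter K A x) (n j) = t j) -> nq x <= B.
Proof.
have [|d d0 [m dm]] := @almost_unobservable 4^-1; first by rewrite invr_gt0.
have [a a0 aP] := bounded_of_continuous cA.
have [b b0 bP] := bounded_of_continuous cC.
pose tau := 2 * \sum_i sqn (t i).
have tau0 : 0 <= tau by rewrite mulr_ge0// sumr_ge0// => i _; exact: sqn_ge0.
pose g := 1 + b * (1 + a) ^+ m.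
have a1 : 1 <= 1 + a by rewrite lerDl ltW.
have g0 : 0 < g by rewrite ltr_pwDl// mulr_ge0 ?exprn_ge0// ?ltW// ltr_pwDl// ltW.
exists (g * tau / d + 1) => K x xq xt; rewrite leNgt; apply/negP => xB.
have B0 : 0 < nq x.
  apply: le_lt_trans xB; rewrite addr_ge0// divr_ge0// ?(ltW d0)//.
  by rewrite mulr_ge0// ltW.
have gB : g * tau <= d * nq x.
  by rewrite [leRHS]mulrC -ler_pdivrMr//; lra.
have endE : nq (iter K A x) <= tau.
  rewrite (nq_quad fH nqE); under eq_bigr => i _ do rewrite xt.
  by have := xq K; rewrite /tau; lra.
have iterB' j z : nq (iter j A z) <= (1 + a) ^+ j * nq z.
  elim: j => [|j IH]; first by rewrite expr0 mul1r.
  rewrite iterS exprS -mulrA; apply: le_trans (aP _) _.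
  apply: ler_pM; rewrite ?nq_ge0 ?(ltW a0)//; first by rewrite lerDr.
have : \sum_i sqn (f x (n i)) < 4^-1 * nq x.
  apply: dm => // [j jm|]; last first.
    by apply: le_trans (xq 0%N) _; rewrite mulr_ge0// ltW.
  apply: le_trans gB; have [jK|Kj] := ltnP j K.
    apply: le_trans (nq_out_le _) _; rewrite -iterS.
    have q1 := xq j.
    have q2 : quad f (iter K A x) <= quad f (iter j.+1 A x).
      by rewrite -(subnK jK); exact: quad_iter_nonincr.
    have q3 := Nquad_le_nq fH nf nqE (iter K A x).
    have q4 : tau <= g * tau.
      by rewrite ler_peMl// lerDl mulr_ge0 ?exprn_ge0 ?(ltW b0)// (le_trans _ a1).
    lra.
  rewrite -(subnK Kj) iterD; apply: le_trans (bP _) _.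
  apply: le_trans (_ : b * ((1 + a) ^+ m * tau) <= _).
    rewrite ler_pM2l//; apply: le_trans (iterB' _ _) _.
    apply: ler_pM; rewrite ?nq_ge0 ?exprn_ge0// ?(le_trans _ a1)//.
    by apply: ler_weXn2l => //; rewrite (leq_trans (leq_subr _ _))// ltnW.
  by rewrite mulrA ler_wpM2r// lerDr.
have := nq_quad fH nqE x; have := xq 0%N; rewrite /=; lra.
Qed.

Lemma neginv_coord_surj (t : 'I_kappa -> R[i]) :
  exists x, neginv x /\ forall j, f x (n j) = t j.
Proof.
have [B BP] := backward_bound t.
have /choice[c cP] (K : nat) : exists c,
    forall j, f (iter K A (lincomb n c)) (n j) = t j.
  exact: iter_coord_solve nf.1.
pose y (k K : nat) := iter (K - k) A (lincomb n (c K)).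
have yq k K : quad f (y k K) <= 0.
  apply: le_trans (quad_iter_le _ _) _; rewrite (negon_quad fH _ nf.1) oppr_le0.
  by rewrite sumr_ge0// => i _; exact: sqn_ge0.
have yB k K : nq (y k K) <= B.
  have [kK|Kk] := leqP k K.
    apply: (BP k) => [j|j]; first by apply: le_trans (quad_iter_le _ _) _; exact: yq.
    by rewrite /y -iterD subnKC//.
  apply: (BP K) => [j|j]; first by apply: le_trans (quad_iter_le _ _) _; exact: yq.
  by have /ltnW := Kk; rewrite /y -subn_eq0 => /eqP ->.
have [U [UU oU]] := ultraFilterLemma (F := \oo) _.
have /choice[p pP] (k : nat) : exists z, wcvg f U (y k) z.
  exact: (wcvg_exists fH nf nqE (yB k)).
have po : orbit p.
  move=> k; apply: (wcvg_unique fH nqE (wcvg_lin fH nf nqE cA (pP k.+1))) => x.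
  apply: cvg_trans (pP k x); apply: near_eq_cvg; apply: oU.
  by apply/nearoP; exists k.+1 => K kK /=; rewrite /y -iterS -subSn.
exists (p 0%N); split.
  apply: orbit_neginv => // k.
  exact: (wcvg_quad_le fH nqE (pP k) (yq k) (cvg_cst _)).
move=> j; apply: complex_eq_re => a.
have E w : re (a * f w (n j)) = re (f (a^* *: n j) w).
  by rewrite (hermZl fH) (herm_sym fH w) -rmorphM re_conj.
rewrite E; apply: (@cvg_unique R _ (re (f (a^* *: n j) (y 0%N K)) @[K --> U])).
- exact: norm_hausdorff.
- exact: pP.
have -> : (fun K => re (f (a^* *: n j) (y 0%N K))) = fun=> re (a * t j).
  by apply/funext => K; rewrite -E /y subn0 cP.
exact: cvg_cst.
Qed.

(** By [neginv_coord_surj] and [neginv_lt0], [neginv] is negative definite of the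
    dimension of the frame. Conversely a contraction is bijective on an invariant
    negative subspace, so that the vectors of such a subspace have backward
    orbits with nonpositive squares, and these tend to zero. *)
Theorem neginv_decomposition : exists! D : set X * set X,
  fundamental_decomposition f D.1 D.2 /\ A @` D.2 `<=` D.2.
Proof.
have /choice[v vP] (i : 'I_kappa) := neginv_coord_surj (fun j => (i == j)%:R).
have vN c : neginv (lincomb v c) by apply: neginv_lincomb => i; case: (vP i).
have vc c j : f (lincomb v c) (n j) = c j.
  rewrite /lincomb (herm_suml fH) (bigD1 j)//= (hermZl fH) (vP j).2 eqxx mulr1.
  by rewrite big1 ?addr0// => i /negPf ij; rewrite (hermZl fH) (vP i).2 ij mulr0.
have vn : negdef f v.
  move=> c [i ci]; apply: neginv_lt0 => //; apply: contra ci => /eqP v0.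
  by rewrite -(vc c i) v0 (herm0l fH).
have [m [mn mE]] := gram_schmidt fH vn.
have NE : lspan m = neginv.
  rewrite mE; apply/seteqP; split=> [_ [c ->] //|x Nx].
  exists (fun j => f x (n j)); apply/eqP; rewrite -subr_eq0; apply/eqP.
  apply: neginv_coord_inj; first exact: neginvB.
  by move=> i; rewrite (hermBl fH) vc subrr.
have FD := decomposition_of_negon fH nf nqE mn.
exists ([set x | forall i, f x (m i) = 0], lspan m); split.
  by rewrite /= NE in FD *; split=> // _ [x Nx <-]; exact: neginvA.
move=> [P N] [/= FD' AN].
have [m' [mn' NE' PE]] := negon_of_decomposition fH nf FD'.
have NV : N `<=` neginv.
  have back x : exists z, N x -> N z /\ A z = x.
    have [c cE] := iter_coord_solve 1 (fun j => f x (m' j)) mn'.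
    exists (lincomb m' c) => Nx.
    have Nc : N (lincomb m' c) by rewrite NE'; exists c.
    split=> //; have : N (A (lincomb m' c)) by apply: AN; exists (lincomb m' c).
    move: Nx cE; rewrite NE' /= => -[d ->] cE [e eE].
    rewrite eE in cE *; congr lincomb; apply/funext => i; have := cE i.
    by rewrite !(negon_coord fH)// => /oppr_inj.
  have /choice[b bP] := back.
  move=> x Nx; have bN k : N (iter k b x).
    by elim: k => [//|k IH]; rewrite iterS; case: (bP _ IH).
  rewrite -[x]/((fun k => iter k b x) 0%N); apply: orbit_neginv => k.
    by rewrite iterS (bP _ (bN k)).2.
  have := bN k; rewrite NE' => -[c ->]; rewrite (negon_quad fH)// oppr_le0.
  by rewrite sumr_ge0// => i _; exact: sqn_ge0.
have NVE : N = neginv.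
  apply/seteqP; split=> // x Nx; have [dec orth hP _ _] := FD'.
  have [p [w [Pp Nw xE]]] := dec x.
  suff p0 : p = 0 by rewrite xE p0 add0r.
  apply/eqP/negPn/negP => p0.
  have : quad f p <= 0.
    apply: neginv_quad_le; have -> : p = x - w by rewrite xE addrK.
    by apply: neginvB => //; exact: NV.
  have /(hilbert_subspaceP fH)[_ /(_ p Pp p0) + _] := hP.
  by rewrite ltNge => /negP.
rewrite NVE NE; congr (_, _); rewrite PE.
have same y : (forall i, f y (m i) = 0) <-> (forall z, neginv z -> f y z = 0).
  split=> [ym z|yN i]; first by rewrite -NE; exact: (orth_lspan fH ym).
  by apply: yN; rewrite -NE; exists (fun j => (j == i)%:R); rewrite lincomb_delta.
have same' y : (forall i, f y (m' i) = 0) <-> (forall z, neginv z -> f y z = 0).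
  rewrite -NVE NE'; split=> [ym z|yN i]; first exact: (orth_lspan fH ym).
  by apply: yN; exists (fun j => (j == i)%:R); rewrite lincomb_delta.
apply/seteqP; split=> y /= ym.
  by apply: (same' y).2; exact: ((same y).1 ym).
by apply: (same y).2; exact: ((same' y).1 ym).
Qed.

End Orbits.

(** * The free vector space on a set *)

Section FreeSpace.
Variables (R : realType) (I : choiceType).

Definition finsupport : {pred (I -> R[i])} :=
  [pred a | `[< finite_set [set i | a i != 0] >]].

Lemma finsupportP (a : I -> R[i]) :
  a \in finsupport <-> finite_set [set i | a i != 0].
Proof. by rewrite unfold_in /=; split=> /asboolP. Qed.

Lemma finsupport_submod : submod_closed finsupport.
Proof.
split=> [|a x y].
  by apply/finsupportP; apply: (@sub_finite_set _ _ set0) => // i /=; rewrite eqxx.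
move=> /finsupportP xf /finsupportP yf; apply/finsupportP.
apply: (@sub_finite_set _ _ ([set i | x i != 0] `|` [set i | y i != 0])).
  move=> i /=; have [xi|] := eqVneq (x i) 0; last by left.
  by rewrite !fctE xi scaler0 add0r; right.
by rewrite finite_setU.
Qed.

HB.instance Definition _ :=
  GRing.isSubmodClosed.Build R[i] (I -> R[i]) finsupport finsupport_submod.

Record fspace := FSpace { free_val :> I -> R[i]; _ : free_val \in finsupport }.

HB.instance Definition _ := [isSub for free_val].
HB.instance Definition _ := [Choice of fspace by <:].
HB.instance Definition _ := [SubChoice_isSubLmodule of fspace by <:].

Lemma free_eqP (a b : fspace) : (forall i, a i = b i) -> a = b.
Proof. by move=> ab; apply: val_inj; apply/funext. Qed.

Lemma free_supp (a : fspace) : exists A : {fset I}, forall i, i \notin A -> a i = 0.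
Proof.
have /finsupportP fa := valP a; exists (fset_set [set i | a i != 0]) => i.
by rewrite in_fset_set// notin_setE /= => /negP; rewrite negbK => /eqP.
Qed.

Lemma delta_finsupport i : (fun j => (j == i)%:R) \in finsupport.
Proof.
apply/finsupportP; apply: (@sub_finite_set _ _ [set i]) => // j /=.
by have [->//|_] := eqVneq j i; rewrite eqxx.
Qed.

Definition fpoint i : fspace := FSpace (delta_finsupport i).

Lemma fpointE i j : fpoint i j = (j == i)%:R. Proof. by []. Qed.

Definition lext (V : lmodType R[i]) (phi : I -> V) (a : fspace) : V :=
  \sum_(i \in [set: I]) a i *: phi i.

Lemma lextE (V : lmodType R[i]) (phi : I -> V) (a : fspace) (A : {fset I}) :
  (forall i, i \notin A -> a i = 0) -> lext phi a = \sum_(i <- A) a i *: phi i.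
Proof. by move=> aA; rewrite /lext (fsbigTE A)// => i /aA ->; rewrite scale0r. Qed.

Lemma lext_linear (V : lmodType R[i]) (phi : I -> V) : linear (lext phi).
Proof.
move=> c a b; have [A aA] := free_supp a; have [B bB] := free_supp b.
have sub i : (i \notin (A `|` B)%fset) -> a i = 0 /\ b i = 0.
  by rewrite in_fsetU negb_or => /andP[/aA -> /bB ->].
rewrite !(lextE phi (A := (A `|` B)%fset)); last 3 first.
- by move=> i /sub[].
- by move=> i /sub[].
- by move=> i /sub[ai bi]; rewrite /= !fctE ai bi scaler0 addr0.
rewrite scaler_sumr -big_split; apply: eq_bigr => i _ /=.
by rewrite !fctE scalerDl scalerA.
Qed.

Lemma lext_delta (V : lmodType R[i]) (phi : I -> V) i : lext phi (fpoint i) = phi i.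
Proof.
rewrite (lextE phi (A := [fset i]%fset)); last first.
  by move=> j; rewrite inE fpointE => /negPf ->.
by rewrite big_seq_fset1 fpointE eqxx scale1r.
Qed.

Lemma free_sum (a : fspace) (A : {fset I}) : (forall i, i \notin A -> a i = 0) ->
  a = \sum_(i <- A) a i *: fpoint i.
Proof.
move=> aA; apply: free_eqP => j.
have valS (s : seq I) : (\sum_(i <- s) a i *: fpoint i : fspace) j =
    \sum_(i <- s) a i * (j == i)%:R.
  elim: s => [|i s IH]; first by rewrite !big_nil.
  by rewrite !big_cons -IH.
rewrite valS; have [jA|/[dup] jA /aA ->] := boolP (j \in A).
  rewrite (big_fsetD1 j)//= eqxx mulr1 big1_fset ?addr0// => i.
  by rewrite !inE eq_sym => /andP[/negPf -> _] _; rewrite mulr0.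
rewrite big1_fset// => i iA _; have [ji|_] := eqVneq j i; last by rewrite mulr0.
by rewrite ji iA in jA.
Qed.

Lemma free_family m (v : 'I_m -> fspace) : exists k (x : 'I_k -> I)
  (a : 'I_m -> 'I_k -> R[i]), forall i, v i = lincomb (fun j => fpoint (x j)) (a i).
Proof.
have /choice[B BP] := fun i => free_supp (v i).
pose A := (\bigcup_(i <- enum 'I_m) B i)%fset.
have vA i : forall p, p \notin A -> v i p = 0.
  move=> p pA; apply: BP; apply: contra pA => pB.
  by apply/bigfcupP; exists i; rewrite // mem_enum.
exists (size A), (fun j => tnth (in_tuple A) j),
  (fun i j => v i (tnth (in_tuple A) j)) => i.
by rewrite {1}(free_sum (vA i)) big_tnth.
Qed.

(** The points [fpoint i] span: a property stable under linear combinations that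
    holds for those in the support holds for the vector. *)
Lemma free_ind (P : fspace -> Prop) (a : fspace) : P 0 ->
  (forall c x y, P x -> P y -> P (c *: x + y)) ->
  (forall i, a i != 0 -> P (fpoint i)) -> P a.
Proof.
move=> P0 PP Pd; have [A aA] := free_supp a.
rewrite (free_sum aA).
apply: big_ind => [//|x y Px Py|i _]; first by rewrite -[x]scale1r; exact: PP.
have [->|ai] := eqVneq (a i) 0; first by rewrite scale0r.
by rewrite -[_ *: _]addr0; apply: PP => //; exact: Pd.
Qed.

End FreeSpace.

Section KernelForm.
Variables (R : realType) (I : choiceType) (k : I -> I -> R[i]).
Hypothesis kH : forall i j, k j i = (k i j)^*.

Definition kform (a b : fspace R I) : R[i] :=
  lext (V := R[i]^o) (fun i => (lext (V := R[i]^o) (fun j => k j i) b)^* : R[i]^o) a.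

Lemma kform_delta i j : kform (fpoint R i) (fpoint R j) = k i j.
Proof. by rewrite /kform !lext_delta -kH. Qed.

Lemma kformPl c a b x : kform (c *: a + b) x = c * kform a x + kform b x.
Proof. by rewrite /kform lext_linear. Qed.

Lemma kformPr c a b x : kform x (c *: a + b) = c^* * kform x a + kform x b.
Proof.
apply: (free_ind (P := fun x =>
  kform x (c *: a + b) = c^* * kform x a + kform x b)) => [|d u v uE vE|i _].
- by rewrite /kform !(linear_0 (lext_linear _)) mulr0 addr0.
- by rewrite !kformPl uE vE; ring.
- by rewrite /kform !lext_delta lext_linear rmorphD rmorphM.
Qed.

Lemma kform_herm : hermitian_form kform.
Proof.
split; first exact: kformPl.
have z a : kform 0 a = 0 by have := kformPl (-1) 0 0 a; rewrite scaler0 addr0 mulN1r addNr.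
have z' a : kform a 0 = 0.
  by have := kformPr (-1) 0 0 a; rewrite scaler0 addr0 rmorphN1 mulN1r addNr.
move=> a b; apply: (free_ind (P := fun a => kform b a = (kform a b)^*)).
- by rewrite z z' rmorph0.
- by move=> c x y xE yE; rewrite kformPl kformPr xE yE rmorphD rmorphM.
move=> i _; apply: (free_ind (P := fun b => kform b (fpoint R i) = (kform (fpoint R i) b)^*)).
- by rewrite z z' rmorph0.
- by move=> c x y xE yE; rewrite kformPl kformPr xE yE rmorphD rmorphM /= conjCK.
- by move=> j _; rewrite !kform_delta kH.
Qed.

End KernelForm.

(** * Schur kernels and their invariance under disc automorphisms *)

Lemma disc_neq0 (R : realType) (z w : R[i]) : sqn z < 1 -> sqn w < 1 ->
  1 - z * w^* != 0.
Proof.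
move=> z1 w1; rewrite subr_eq0; apply/eqP => zw.
have : sqn (z * w^*) = 1 by rewrite -zw /sqn /= expr1n expr0n addr0.
rewrite sqnM sqn_conj; have := sqn_ge0 z; have := sqn_ge0 w; nra.
Qed.

Section SchurKernel.
Variables (R : realType) (Y U : hilbertSpace R) (I : choiceType).
Variables (pw : I -> R[i]) (py : I -> Y) (ps : I -> U).
Hypothesis pw1 : forall i, sqn (pw i) < 1.

(** The points are indexed by an abstract type: [ps i] stands for the value at
    [py i] of the adjoint of the Schur function at [pw i]. *)
Definition schurker (i j : I) : R[i] :=
  (hs_dot Y (py i) (py j) - hs_dot U (ps i) (ps j)) / (1 - pw j * (pw i)^*).

Lemma schurker_herm i j : schurker j i = (schurker i j)^*.
Proof.
rewrite /schurker fmorph_div !rmorphB rmorph1 rmorphM /= conjCK.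
by rewrite -!(herm_sym (hs_hermitian _)) [pw i * _]mulrC.
Qed.

Local Notation h := (kform schurker).
Local Notation E := (fspace R I).

Lemma schurform_herm : hermitian_form h. Proof. exact: (kform_herm schurker_herm). Qed.

Definition off (v : R[i]) (a : E) := forall i, a i != 0 -> pw i != v.

Section Mobius.
Variables (v : R[i]) (sg : I -> I).
Hypothesis v1 : sqn v < 1.
Hypothesis sgw : forall i, pw (sg i) = v.
Hypothesis sgy : forall i, py (sg i) = py i.

(** The operator [(A - v) (1 - v^* A)^-1], where [A] maps the kernel function
    [d_w] at [w] to [(d_w - d_0) / w^*]; it multiplies the kernel function
    at [w] by the inverse of a Blaschke factor, up to kernel functions at [v]. *)
Definition mobius : E -> E := lext (fun i =>
  ((1 - v * (pw i)^*) / ((pw i)^* - v^*)) *: fpoint R i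
  - ((1 - v * v^*) / ((pw i)^* - v^*)) *: fpoint R (sg i)).

Definition mobius_out : E -> U := lext (fun i =>
  ((pw i)^* - v^*)^-1 *: (ps i - ps (sg i))).

Lemma mobius_isom a b : off v a -> off v b ->
  h (mobius a) (mobius b)
  + (1 - v * v^*) * hs_dot U (mobius_out a) (mobius_out b) = h a b.
Proof.
have hH := schurform_herm; have uH := hs_hermitian U.
have mL : linear mobius := lext_linear _.
have oL : linear mobius_out := lext_linear _.
move=> va vb.
have vd i j : pw i != v -> pw j != v ->
  h (mobius (fpoint R i)) (mobius (fpoint R j))
  + (1 - v * v^*) * hs_dot U (mobius_out (fpoint R i)) (mobius_out (fpoint R j))
  = h (fpoint R i) (fpoint R j).
  move=> iv jv; rewrite /mobius /mobius_out !lext_delta.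
  rewrite !(hermBl hH, hermBr hH, hermZl hH, hermZr hH).
  rewrite !(hermZl uH, hermZr uH, hermBl uH, hermBr uH).
  rewrite !(kform_delta schurker_herm) /schurker !sgw !sgy.
  rewrite !(fmorph_div, fmorphV, rmorphB, rmorphM, rmorph1) /=.
  rewrite !conjCK.
  have n1 : 1 - pw j * (pw i)^* != 0 by exact: disc_neq0.
  have n2 : 1 - v * (pw i)^* != 0 by exact: disc_neq0.
  have n3 : 1 - pw j * v^* != 0 by exact: disc_neq0.
  have n4 : 1 - v * v^* != 0 by exact: disc_neq0.
  have n5 : (pw i)^* - v^* != 0.
    by rewrite -rmorphB fmorph_eq0 subr_eq0.
  have n6 : pw j - v != 0 by rewrite subr_eq0.
  move: (hs_dot Y _ _) (hs_dot U (ps i) (ps j)) (hs_dot U (ps i) (ps (sg j)))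
    (hs_dot U (ps (sg i)) (ps j)) (hs_dot U (ps (sg i)) (ps (sg j))) n1 n2 n3 n4 n5 n6.
  move: ((pw i)^*) (pw j) (v^*) => wc z vc P S1 S2 S3 S4 n1 n2 n3 n4 n5 n6.
  by field; rewrite n1 n2 n3 n4 n5 n6.
apply: (free_ind (P := fun a => h (mobius a) (mobius b)
  + (1 - v * v^*) * hs_dot U (mobius_out a) (mobius_out b) = h a b)).
- rewrite (linear_0 mL) (linear_0 oL) !(herm0l hH) (herm0l uH).
  by rewrite mulr0 addr0.
- move=> c x y xE yE; rewrite mL oL !(hermPl hH) (hermPl uH) -xE -yE; ring.
move=> i /va iv; apply: (free_ind (P := fun b => h (mobius (fpoint R i)) (mobius b)
  + (1 - v * v^*) * hs_dot U (mobius_out (fpoint R i)) (mobius_out b)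
  = h (fpoint R i) b)).
- rewrite (linear_0 mL) (linear_0 oL) !(herm0r hH) (herm0r uH).
  by rewrite mulr0 addr0.
- move=> c x y xE yE; rewrite mL oL !(hermDr hH, hermZr hH) !(hermDr uH, hermZr uH).
  rewrite -xE -yE; ring.
by move=> j /vb jv; exact: vd.
Qed.

Lemma one_sub_normsq (z : R[i]) : 1 - z * z^* = (1 - sqn z)%:C%C.
Proof. by rewrite mulcJ rmorphB rmorph1. Qed.

Lemma mobius_contr a : off v a -> quad h (mobius a) <= quad h a.
Proof.
move=> va; rewrite /quad -(mobius_isom va va) reD lerDl one_sub_normsq reMr.
by rewrite mulr_ge0 ?subr_ge0 ?(ltW v1)// -/(quad _ _) hs_quad nq_ge0.
Qed.

(** The isometry [(mobius, mobius_out)] maps a frame to a frame of the direct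
    sum, and the norms of two frames are equivalent. *)
Lemma mobius_bounded kappa (n : 'I_kappa -> E) : frame h n ->
  (forall j, off v (n j)) ->
  exists2 c : R, 0 < c & forall a, off v a ->
    quad (maj h n) (mobius a) <= c * quad (maj h n) a.
Proof.
move=> nf noff; have hH := schurform_herm; have uH := hs_hermitian U.
have D0 : 0 < 1 - sqn v by rewrite subr_gt0.
pose h2 (x y : (E * U)%type) :=
  h x.1 y.1 + (1 - v * v^*) * hs_dot U x.2 y.2.
have h2H : hermitian_form h2.
  split=> [c x y z|x y]; rewrite /h2 /=.
    by rewrite (hermPl hH) (hermPl uH); ring.
  rewrite rmorphD rmorphM /= -(herm_sym hH) -(herm_sym uH); congr (_ + _ * _).
  by rewrite one_sub_normsq conj_real.
pose V a : (E * U)%type := (mobius a, mobius_out a).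
pose n2 j : (E * U)%type := (n j, 0).
have h2n x j : h2 x (n2 j) = h x.1 (n j).
  by rewrite /h2 /= (herm0r uH) mulr0 addr0.
have q2 x : quad h2 x = quad h x.1 + (1 - sqn v) * nq x.2.
  by rewrite /quad /h2 reD one_sub_normsq reMr -[re (hs_dot _ _ _)]/(quad _ _) hs_quad.
have nf2 : frame h2 n2.
  split=> [i j|x xn]; first by rewrite h2n nf.1.
  rewrite q2; apply: addr_ge0; last exact: mulr_ge0 (ltW D0) (nq_ge0 _).
  by apply: nf.2 => i; rewrite -h2n.
have Vn : negon h2 (fun j => V (n j)).
  by move=> i j; rewrite /h2 /= mobius_isom// nf.1.
have [c c0 cP] := maj_le_maj h2H n2 (frame_max h2H nf2 Vn).
exists c => // a va; have := cP (V a).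
rewrite (quad_maj h2H) [X in _ <= _ * X](quad_maj h2H) (quad_maj hH) (quad_maj hH n a).
have -> : quad h2 (V a) = quad h a by rewrite /quad /h2 mobius_isom.
have -> : \sum_i sqn (h2 (V a) (V (n i))) = \sum_i sqn (h a (n i)).
  by apply: eq_bigr => i _; rewrite /h2 /= mobius_isom.
under eq_bigr => i _ do rewrite h2n.
by apply: le_trans; rewrite lerD2r mobius_contr.
Qed.
End Mobius.
End SchurKernel.

(** * Approximation by kernel functions at points near the origin *)

Lemma geometric_small (R : realType) (r e : R) : 0 <= r -> r < 1 -> 0 < e ->
  exists N, forall n, (N <= n)%N -> r ^+ n < e.
Proof.
move=> r0 r1 e0; have : (GRing.exp r : nat -> R) @ \oo --> (0 : R).
  by apply: cvg_expr; rewrite ger0_norm.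
move=> /cvgrPdist_lt/(_ _ e0)/nearoP[N NP]; exists N => n /NP.
by rewrite sub0r normrN ger0_norm// exprn_ge0.
Qed.

Lemma family_lt1 (R : realType) k (x : 'I_k -> R) : (forall i, x i < 1) ->
  exists r, [/\ 0 <= r, r < 1 & forall i, x i <= r].
Proof.
move=> x1; exists (\big[Num.max/0]_i x i); split.
- exact: bigmax_ge_id.
- by apply/bigmax_ltP; split.
- by move=> i; exact: le_bigmax.
Qed.

Lemma blaschke_identity (R : realType) (v w : R[i]) :
  sqn (1 - v * w^*) - sqn (w^* - v^*) = (1 - sqn v) * (1 - sqn w).
Proof. case: v w => [a b] [c d]; rewrite /sqn /=; ring. Qed.

Section Seminorm.
Variables (R : realType) (E : lmodType R[i]) (h : E -> E -> R[i]).
Variables (kappa : nat) (n : 'I_kappa -> E).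
Hypothesis hH : hermitian_form h.
Hypothesis nf : frame h n.

Local Notation N := (quad (maj h n)).

Lemma sn_ge0 a : 0 <= N a. Proof. exact: maj_ge0. Qed.

Lemma snD_le a b : N (a + b) <= 2 * N a + 2 * N b.
Proof. by apply: (quadD_le (maj_herm hH n)) => z; exact: maj_ge0. Qed.

Lemma snZ c a : N (c *: a) = sqn c * N a.
Proof. exact: (quadZ (maj_herm hH n)). Qed.

Lemma sn0 : N 0 = 0. Proof. exact: (quad0 (maj_herm hH n)). Qed.

Lemma snN a : N (- a) = N a. Proof. exact: (quadN (maj_herm hH n)). Qed.

Lemma sn_lincomb k (x : 'I_k -> E) c :
  N (lincomb x c) <= 2 ^+ k * \sum_i sqn (c i) * N (x i).
Proof.
elim: k x c => [|k IH] x c; first by rewrite /lincomb !big_ord0 sn0 mulr0.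
rewrite /lincomb big_ord_recl; apply: le_trans (snD_le _ _) _.
rewrite [in leRHS]big_ord_recl mulrDr lerD//.
  rewrite snZ ler_wpM2r ?mulr_ge0 ?sqn_ge0 ?sn_ge0//.
  by rewrite exprS ler_peMr// exprn_ege1// ler1n.
have := IH (fun i => x (lift ord0 i)) (fun i => c (lift ord0 i)).
by rewrite exprS -mulrA ler_pM2l.
Qed.

Lemma quad_le_sn a : quad h a <= N a.
Proof.
by rewrite (quad_maj hH) lerDl mulr_ge0// sumr_ge0// => i _; exact: sqn_ge0.
Qed.

End Seminorm.

Section Approximation.
Variables (R : realType) (Y U : hilbertSpace R) (I : choiceType).
Variables (pw : I -> R[i]) (py : I -> Y) (ps : I -> U).
Hypothesis pw1 : forall i, sqn (pw i) < 1.

Local Notation h := (kform (schurker pw py ps)).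
Local Notation E := (fspace R I).
Let hH : hermitian_form h := schurform_herm pw py ps.

Variables (kappa : nat) (n : 'I_kappa -> E).
Hypothesis nf : frame h n.

Local Notation N := (quad (maj h n)).

Definition supported (P : set I) (a : E) := forall i, a i != 0 -> P i.

Lemma supported0 P : supported P 0.
Proof. by move=> i; rewrite /= eqxx. Qed.

Lemma supported_comb P c a b : supported P a -> supported P b ->
  supported P (c *: a + b).
Proof.
move=> Pa Pb i; rewrite /= !fctE; have [ai|/Pa//] := eqVneq (a i) 0.
by rewrite ai scaler0 add0r => /Pb.
Qed.

Lemma supportedZ P c a : supported P a -> supported P (c *: a).
Proof.
by move=> Pa; rewrite -[_ *: _]addr0; apply: supported_comb => //; exact: supported0.
Qed.

Lemma supportedD P a b : supported P a -> supported P b -> supported P (a + b).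
Proof. by move=> Pa Pb; rewrite -[a]scale1r; exact: supported_comb. Qed.

Lemma supported_point (P : set I) i : P i -> supported P (fpoint R i).
Proof. by move=> Pi j; rewrite fpointE; have [->//|_] := eqVneq j i; rewrite eqxx. Qed.

Lemma supported_lincomb P k (x : 'I_k -> E) c :
  (forall i, supported P (x i)) -> supported P (lincomb x c).
Proof.
move=> Px; apply: big_ind => [|a b|i _]; first exact: supported0.
  exact: supportedD.
exact: supportedZ.
Qed.

Lemma supported_sub (P Q : set I) a : P `<=` Q -> supported P a -> supported Q a.
Proof. by move=> PQ Pa i /Pa /PQ. Qed.

Lemma supported_mobius (P Q : set I) v sg a :
  (forall i, P i -> Q i /\ Q (sg i)) ->
  supported P a -> supported Q (mobius pw v sg a).
Proof.
have mL : linear (mobius pw v sg) := lext_linear _.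
move=> PQ Pa; apply: (free_ind (P := fun a => supported Q (mobius pw v sg a))).
- by rewrite (linear_0 mL); exact: supported0.
- by move=> c x y Qx Qy; rewrite mL; exact: supported_comb.
move=> i /Pa /PQ[Qi Qsi]; rewrite /mobius lext_delta addrC -scaleNr.
by apply: supported_comb; [|apply: supportedZ]; exact: supported_point.
Qed.

Variable base : set I.

(** The closure of the span of the kernel functions at the points of [base]. *)
Definition spanlim (a : E) := forall e : R, 0 < e ->
  exists2 b, supported base b & N (a - b) < e.

Lemma spanlim_supported a : supported base a -> spanlim a.
Proof. by move=> ba e e0; exists a => //; rewrite subrr (sn0 n hH). Qed.

Lemma spanlim_comb c a b : spanlim a -> spanlim b -> spanlim (c *: a + b).
Proof.
move=> aa ab e e0.
have c1 : 0 < sqn c + 1 by rewrite ltr_wpDl// sqn_ge0.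
have [a' ba' na'] := aa (e / (4 * (sqn c + 1))) (divr_gt0 e0 (mulr_gt0 (ltr0n _ 4) c1)).
have [b' bb' nb'] := ab (e / 4) (divr_gt0 e0 (ltr0n _ 4)).
exists (c *: a' + b'); first exact: supported_comb.
have -> : c *: a + b - (c *: a' + b') = c *: (a - a') + (b - b').
  by rewrite scalerBr opprD addrACA.
apply: le_lt_trans (snD_le hH nf _ _) _; rewrite snZ//.
move: na'; rewrite ltr_pdivlMr ?mulr_gt0//.
have := sn_ge0 hH nf (a - a'); have := sqn_ge0 c; nra.
Qed.

Lemma spanlim0 : spanlim 0.
Proof. by apply: spanlim_supported; exact: supported0. Qed.

Lemma spanlimZ c a : spanlim a -> spanlim (c *: a).
Proof. by move=> aa; rewrite -[_ *: _]addr0; apply: spanlim_comb; [exact: aa|exact: spanlim0]. Qed.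

Lemma spanlimD a b : spanlim a -> spanlim b -> spanlim (a + b).
Proof. by move=> aa ab; rewrite -[a]scale1r; exact: spanlim_comb. Qed.

Lemma spanlim_lincomb k (x : 'I_k -> E) c :
  (forall i, spanlim (x i)) -> spanlim (lincomb x c).
Proof.
move=> Px; apply: big_ind => [|a b|i _]; first exact: spanlim0.
  exact: spanlimD.
exact: spanlimZ.
Qed.

Lemma spanlim_closed a :
  (forall e : R, 0 < e -> exists2 b, spanlim b & N (a - b) < e) -> spanlim a.
Proof.
move=> ac e e0; have e4 : 0 < e / 4 by rewrite divr_gt0.
have [b ab nb] := ac _ e4; have [b' bb' nb'] := ab _ e4.
exists b' => //; have -> : a - b' = (a - b) + (b - b') by rewrite addrA subrK.
by apply: le_lt_trans (snD_le hH nf _ _) _; lra.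
Qed.

Section Iterate.
Variables (v : nat -> R[i]) (sg : nat -> I -> I).
Hypothesis v4 : forall k, sqn (v k) <= 4^-1.
Hypothesis v_inj : injective v.
Hypothesis sgw : forall k i, pw (sg k i) = v k.
Hypothesis sgy : forall k i, py (sg k i) = py i.
Hypothesis sgb : forall k i, base (sg k i).

Let v1 k : sqn (v k) < 1.
Proof. by apply: le_lt_trans (v4 k) _; rewrite invf_lt1// ltr1n. Qed.

Fixpoint miter (m : nat) (a : E) : E :=
  if m is l.+1 then mobius pw (v l) (sg l) (miter l a) else a.

Definition blaschke (m : nat) (w : R[i]) : R[i] :=
  \prod_(k < m) ((w^* - (v k)^*) / (1 - v k * w^*)).

Lemma miter_linear m : linear (miter m).
Proof.
elim: m => [//|m IH] c a b /=; rewrite IH.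
exact: (lext_linear _).
Qed.

Lemma sqn_blaschke (r : R) m w : r < 1 -> sqn w <= r ->
  sqn (blaschke m w) <= (1 - 3 * (1 - r) / 16) ^+ m.
Proof.
move=> r1 wr; have w1 : sqn w < 1 by exact: le_lt_trans wr r1.
have w0 := sqn_ge0 w.
elim: m => [|m IH]; first by rewrite /blaschke big_ord0 expr0 /sqn /= expr1n expr0n addr0.
rewrite /blaschke big_ord_recr /= sqnM exprSr; apply: ler_pM; rewrite ?sqn_ge0//.
have D0 : 0 < sqn (1 - v m * w^*) by rewrite sqn_gt0 disc_neq0.
rewrite sqnM sqnV ler_pdivrMr//.
have D4 : sqn (1 - v m * w^*) <= 4.
  apply: le_trans (sqnD_le _ _) _; rewrite sqnN sqnM sqn_conj /sqn /= expr1n expr0n addr0.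
  have := v4 m; have := sqn_ge0 (v m); rewrite -/(sqn w) -/(sqn (v m)); nra.
have := blaschke_identity (v m) w; have := v4 m; nra.
Qed.

Definition tail_free (m : nat) : set I := [set i | forall k, (m <= k)%N -> pw i != v k].

Lemma miter_contr m a : supported (tail_free 0) a ->
  supported (tail_free m) (miter m a) /\ quad h (miter m a) <= quad h a.
Proof.
move=> a0; elim: m => [//|m [sm qm]] /=; split.
  apply: supported_mobius sm => i im; split=> k mk; first exact/im/ltnW.
  by rewrite sgw (inj_eq v_inj) neq_ltn mk.
apply: le_trans qm; apply: mobius_contr => //.
by move=> i /sm/(_ m (leqnn m)).
Qed.

(** Up to kernel functions at the points [v k], the iterates divide a kernel
    function by a product of Blaschke factors. *)
Lemma miter_point m i : tail_free 0 i -> exists2 b, supported base b &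
  blaschke m (pw i) *: miter m (fpoint R i) = fpoint R i - b.
Proof.
move=> iv; elim: m => [|m [b bb IH]].
  exists 0; first exact: supported0.
  by rewrite /blaschke big_ord0 scale1r subr0.
have mL : linear (mobius pw (v m) (sg m)) := lext_linear _.
set bl := ((pw i)^* - (v m)^*) / (1 - v m * (pw i)^*).
have n1 : 1 - v m * (pw i)^* != 0 by exact: disc_neq0.
have n2 : (pw i)^* - (v m)^* != 0.
  by rewrite -rmorphB fmorph_eq0 subr_eq0; exact: iv.
exists ((bl * ((1 - v m * (v m)^*) / ((pw i)^* - (v m)^*))) *: fpoint R (sg m i)
        + bl *: mobius pw (v m) (sg m) b).
  apply: supported_comb; first by apply: supported_point; exact: sgb.
  apply: supportedZ; apply: supported_mobius bb => j bj; split=> //; exact: sgb.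
rewrite /= /blaschke big_ord_recr /= -/bl -/(blaschke m (pw i)) mulrC.
rewrite -(scalerA bl (blaschke m (pw i))) -(linear_Z _ _ mL) IH.
rewrite (linear_D _ _ mL) -scaleN1r (linear_Z _ _ mL) scaleN1r.
rewrite [mobius _ _ _ (fpoint R i)]lext_delta.
rewrite scalerBr scalerBr !scalerA opprD addrA; congr (_ - _ - _).
by rewrite /bl mulrA divfK// divff// scale1r.
Qed.

(** Modulo the closure of the span of kernel functions at [base], at most
    [kappa] kernel functions are independent: a combination that is orthogonal
    to the frame after [m] steps has a square bounded by a multiple of the
    product of the Blaschke factors, which tends to zero. *)
Lemma dependent_mod_spanlim (x : 'I_kappa.+1 -> I) :
  (forall i, tail_free 0 (x i)) -> exists c,
    (exists i, c i != 0) /\ spanlim (lincomb (fun i => fpoint R (x i)) c).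
Proof.
move=> xv; pose d i := fpoint R (x i).
have [r [r0 r1 xr]] := family_lt1 (fun i => pw1 (x i)).
pose rho := 1 - 3 * (1 - r) / 16.
have rho0 : 0 <= rho by rewrite /rho; lra.
have rho1 : rho < 1 by rewrite /rho; lra.
pose S := \sum_i N (d i).
have step m : exists c b, [/\ \sum_i sqn (c i) = 1, supported base b &
    N (lincomb d c - b) <= 2 ^+ kappa.+1 * (rho ^+ m * S)].
  have /choice[b bP] i : exists b, supported base b /\
      blaschke m (pw (x i)) *: miter m (d i) = d i - b.
    by have [b b1 b2] := miter_point m (xv i); exists b.
  pose g i := d i - b i.
  have [c0 [c0n c0o]] := exists_kernel_comb (fun i j => h (g i) (n j)) (ltnSn kappa).
  have s0 := sum_sqn_gt0 c0n; set s := \sum_i sqn (c0 i) in s0.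
  pose q := (Num.sqrt s)^-1.
  have q2 : sqn (q%:C%C : R[i]) = s^-1 by rewrite sqn_real exprVn sqr_sqrtr// ltW.
  pose c i := q%:C%C * c0 i.
  have cs : \sum_i sqn (c i) = 1.
    under eq_bigr do rewrite sqnM q2.
    by rewrite -mulr_sumr mulVf// gt_eqF.
  exists c, (lincomb b c); split=> //.
    by apply: supported_lincomb => i; case: (bP i).
  have gE : lincomb d c - lincomb b c = lincomb g c.
    by rewrite /lincomb -sumrB; apply: eq_bigr => i _; rewrite scalerBr.
  have gT : lincomb g c = miter m (lincomb d (fun i => c i * blaschke m (pw (x i)))).
    rewrite (lincomb_lin _ _ (miter_linear m)) /lincomb; apply: eq_bigr => i _.
    by rewrite -[RHS]scalerA (bP i).2.
  have dn : supported (tail_free 0) (lincomb d (fun i => c i * blaschke m (pw (x i)))).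
    by apply: supported_lincomb => i; exact: supported_point.
  rewrite gE (quad_maj hH) big1 ?mulr0 ?addr0; last first.
    move=> j _; apply/eqP; rewrite sqn_eq0; apply/eqP.
    rewrite /lincomb (herm_suml hH) (eq_bigr (fun i => q%:C%C * (c0 i * h (g i) (n j)))).
      by rewrite -mulr_sumr c0o mulr0.
    by move=> i _; rewrite (hermZl hH) mulrA.
  rewrite gT; apply: le_trans (miter_contr m dn).2 _.
  apply: le_trans (quad_le_sn n hH _) _; apply: le_trans (sn_lincomb hH nf _ _) _.
  rewrite ler_pM2l ?exprn_gt0// /S mulr_sumr; apply: ler_sum => i _.
  rewrite ler_wpM2r ?sn_ge0// sqnM -[leRHS]mul1r; apply: ler_pM; rewrite ?sqn_ge0//.
    by rewrite -cs (bigD1 i)//= lerDl sumr_ge0// => j _; exact: sqn_ge0.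
  exact: sqn_blaschke.
have /choice[c /choice[b cbP]] := step.
have [W [WU oW]] := ultraFilterLemma (F := \oo) _.
have c1 m i : sqn (c m i) <= 1.
  have [<- _ _] := cbP m.
  by rewrite (bigD1 i)//= lerDl sumr_ge0// => j _; exact: sqn_ge0.
have bd (g : R[i] -> R) i : (forall w, g w ^+ 2 <= sqn w) ->
    exists l : R, g (c m i) @[m --> W] --> l.
  move=> gs; apply: (@ultra_bounded_cvg _ _ _ 1) => m.
  rewrite -(ler_pXn2r (n := 2))// ?nnegrE// expr1n real_normK ?num_real//.
  exact: le_trans (gs _) (c1 m i).
have /choice[p pP] := fun i => bd (@complex.Re R) i (fun w => re_sqr_le w).
have ims (w : R[i]) : complex.Im w ^+ 2 <= sqn w by rewrite /sqn lerDr sqr_ge0.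
have /choice[q qP] := fun i => bd (@complex.Im R) i ims.
pose l i := Complex (p i) (q i).
have cl i : sqn (l i - c m i) @[m --> W] --> (0 : R).
  have E : (fun m => sqn (l i - c m i)) =
      (fun m => (p i - re (c m i)) * (p i - re (c m i))
              + (q i - complex.Im (c m i)) * (q i - complex.Im (c m i))).
    by apply/funext => m; rewrite /sqn /l; case: (c m i) => ? ?; rewrite !expr2.
  have -> : (0 : R) = (p i - p i) * (p i - p i) + (q i - q i) * (q i - q i).
    by rewrite !subrr !mul0r addr0.
  rewrite E.
  have cp : p i - re (c m i) @[m --> W] --> p i - p i.
    by apply: cvgB => //; exact: cvg_cst.
  have cq : q i - complex.Im (c m i) @[m --> W] --> q i - q i.
    by apply: cvgB => //; exact: cvg_cst.
  by apply: cvgD; exact: cvgM.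
have cn m : \sum_i sqn (c m i) = 1 by case: (cbP m).
exists l; split.
  apply: contrapT => l0; have l00 i : l i = 0.
    by apply/eqP/negPn/negP => li; apply: l0; exists i.
  have lim : \sum_i sqn (l i - c m i) @[m --> W] --> \sum_(i < kappa.+1) (0 : R).
    exact: (cvg_sumU cl).
  have : (1 : R) <= \sum_(i < kappa.+1) 0.
    apply: (cvgU_le _ (cvg_cst _) lim) => m.
    by under eq_bigr do rewrite l00 sub0r sqnN; rewrite cn.
  by rewrite big1// ler10.
move=> e e0; pose K : R := 2 ^+ kappa.+1.
pose t m := 2 * (K * \sum_i sqn (l i - c m i) * N (d i)) + 2 * (K * (rho ^+ m * S)).
have tl : t m @[m --> W] --> (0 : R).
  have s0 : \sum_(i < kappa.+1) 0 * N (d i) = 0 by rewrite big1// => i _; rewrite mul0r.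
  have -> : (0 : R) = 2 * (K * \sum_(i < kappa.+1) 0 * N (d i)) + 2 * (K * (0 * S)).
    by rewrite s0 mul0r !mulr0 addr0.
  rewrite /t; apply: cvgD; apply: cvgMr; apply: cvgMr.
    by apply: cvg_sumU => i; apply: cvgM => //; exact: cvg_cst.
  apply: cvgM; last exact: cvg_cst.
  move=> A A0; apply: oW; move: A A0.
  by apply: cvg_expr; rewrite ger0_norm.
have [m] := filter_ex ((cvgrPdist_lt _ _).1 tl _ e0).
rewrite sub0r normrN => /(le_lt_trans (ler_norm _)) te.
have [_ bb nb] := cbP m; exists (b m) => //.
have -> : lincomb d l - b m = lincomb d (fun i => l i - c m i) + (lincomb d (c m) - b m).
  rewrite addrA lincombD; congr (lincomb _ _ - _); apply/funext => i; by rewrite subrK.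
apply: le_lt_trans (snD_le hH nf _ _) _; apply: le_lt_trans te.
by rewrite /t lerD// ler_pM2l//; exact: sn_lincomb.
Qed.

End Iterate.

(** The closure is invariant under [mobius], for which the kernel functions
    outside the closure are eigenvectors modulo the closure; so distinct points
    can be separated. *)
Lemma spanlim_separate (w : R[i]) (sg : I -> I) k (x : 'I_k -> I) (c : 'I_k -> R[i]) :
  sqn w < 1 -> (forall i, pw (sg i) = w) -> (forall i, py (sg i) = py i) ->
  (forall j, off pw w (n j)) -> (forall i, base i -> pw i != w) ->
  (forall i, spanlim (fpoint R (sg i))) ->
  (forall i, pw (x i) != w) -> injective (fun i => pw (x i)) ->
  spanlim (lincomb (fun i => fpoint R (x i)) c) ->
  forall i, c i != 0 -> spanlim (fpoint R (x i)).
Proof.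
move=> w1 sgw sgy noff wbase asg xw xinj ac i ci.
pose d i := fpoint R (x i).
pose ev (j : I) := (1 - w * (pw j)^*) / ((pw j)^* - w^*).
have mL : linear (mobius pw w sg) := lext_linear _.
have [C C0 CP] := mobius_bounded pw1 w1 sgw sgy nf noff.
have abase a : supported base a -> spanlim (mobius pw w sg a).
  move=> ba; apply: (free_ind (P := fun a => spanlim (mobius pw w sg a))).
  - by rewrite (linear_0 mL); exact: spanlim0.
  - by move=> e u v au av; rewrite mL; exact: spanlim_comb.
  move=> j /ba bj; rewrite /mobius lext_delta addrC -scaleNr.
  apply: spanlim_comb; first exact: asg.
  apply: spanlimZ; apply: spanlim_supported.
  exact: supported_point.
have inv c' : spanlim (lincomb d c') -> spanlim (lincomb d (fun j => c' j * ev (x j))).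
  move=> ac'.
  have am : spanlim (mobius pw w sg (lincomb d c')).
    apply: spanlim_closed => e e0; have [b bb nb] := ac' _ (divr_gt0 e0 C0).
    exists (mobius pw w sg b); first exact: abase.
    have -> : mobius pw w sg (lincomb d c') - mobius pw w sg b
        = mobius pw w sg (lincomb d c' - b).
      by rewrite (linear_D _ _ mL) -[in RHS]scaleN1r (linear_Z _ _ mL) scaleN1r.
    apply: le_lt_trans (CP _ _) _; last by rewrite -ltr_pdivlMl// mulrC.
    have dw : supported [set j | pw j != w] (lincomb d c' - b).
      apply: supportedD.
        by apply: supported_lincomb => j; apply: supported_point => /=.
      rewrite -scaleN1r; apply: supportedZ; apply: supported_sub bb => j /=.
      exact: wbase.
    exact: dw.
  have -> : lincomb d (fun j => c' j * ev (x j)) = mobius pw w sg (lincomb d c')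
     + lincomb (fun j => fpoint R (sg (x j)))
         (fun j => c' j * ((1 - w * w^*) / ((pw (x j))^* - w^*))).
    rewrite (lincomb_lin _ _ mL) /lincomb -big_split; apply: eq_bigr => j _ /=.
    by rewrite /mobius lext_delta scalerBr -!scalerA subrK.
  by apply: spanlimD; [exact: am|apply: spanlim_lincomb => j; exact: asg].
have pol (p : {poly R[i]}) : forall c', spanlim (lincomb d c') ->
    spanlim (lincomb d (fun j => c' j * p.[ev (x j)])).
  elim/poly_ind: p => [|p a IH] c' ac'.
    rewrite (_ : (fun j => _) = (fun=> 0)) ?lincomb0; first exact: spanlim0.
    by apply/funext => j; rewrite horner0 mulr0.
  have -> : (fun j => c' j * (p * 'X + a%:P).[ev (x j)]) =
      (fun j => c' j * ev (x j) * p.[ev (x j)] + a * c' j).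
    by apply/funext => j; rewrite hornerMXaddC; ring.
  rewrite -lincombD -lincombZ; apply: spanlimD; last exact: spanlimZ.
  by apply: IH; exact: inv.
pose p := \prod_(j | j != i) ('X - (ev (x j))%:P).
have evI : injective (fun j => ev (x j)).
  move=> j l; rewrite /ev => /eqP.
  have nz (o : 'I_k) : (pw (x o))^* - w^* != 0.
    by rewrite -rmorphB fmorph_eq0 subr_eq0.
  rewrite eqr_div// => /eqP H; apply: xinj; apply: (can_inj (@conjCK _)).
  have : (1 - w * w^*) * ((pw (x j))^* - (pw (x l))^*) = 0.
    move: H; move: ((pw (x j))^*) ((pw (x l))^*) => a b H.
    apply/eqP; rewrite -oppr_eq0; apply/eqP.
    by rewrite -[RHS](subrr ((1 - w * a) * (b - w^*))) {2}H; ring.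
  by move/eqP; rewrite mulf_eq0 (negPf (disc_neq0 w1 w1)) subr_eq0 => /eqP.
have := pol p c ac.
have -> : lincomb d (fun j => c j * p.[ev (x j)]) = (c i * p.[ev (x i)]) *: d i.
  rewrite /lincomb (bigD1 i)//= big1 ?addr0// => j ji.
  rewrite /p horner_prod (bigD1 j)//= hornerXsubC subrr mul0r mulr0 scale0r//.
have pi : c i * p.[ev (x i)] != 0.
  rewrite mulf_neq0// /p horner_prod; apply/prodf_neq0 => j ji.
  by rewrite hornerXsubC subr_eq0; apply: contra ji => /eqP /evI ->.
by move=> /(spanlimZ (c i * p.[ev (x i)])^-1); rewrite scalerA (mulVf pi) scale1r.
Qed.

End Approximation.

(** * Continuity of the kernel and localization of its negative squares *)

Lemma product_small (R : realType) (e a b t X Y : R) :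
  0 <= a -> 0 <= b -> 0 <= X -> 0 <= Y -> t <= 2 * Y + 2 ->
  a * (4 * (2 * Y + 2)) < e -> b * (8 * (X + 1)) < e ->
  2 * (a * t) + 2 * (X * b) < e.
Proof.
move=> a0 b0 X0 Y0 tY H1 H2.
have H3 : a * t <= a * (2 * Y + 2) by rewrite ler_wpM2l.
have H4 : X * b <= (X + 1) * b by rewrite ler_wpM2r// lerDl.
have H5 : 0 <= b * (X + 1) by rewrite mulr_ge0// addr_ge0.
nra.
Qed.

Section ComplexLimits.
Variable R : realType.
Implicit Types (z : nat -> R[i]) (l : R[i]).

Definition ccvg z l := forall e : R, 0 < e ->
  exists N, forall k, (N <= k)%N -> sqn (z k - l) < e.

Lemma ccvg_cst l : ccvg (fun=> l) l.
Proof. by move=> e e0; exists 0%N => k _; rewrite subrr sqn0. Qed.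

Lemma ccvgD z z' l l' : ccvg z l -> ccvg z' l' -> ccvg (fun k => z k + z' k) (l + l').
Proof.
move=> zl zl' e e0; have e4 : 0 < e / 4 by rewrite divr_gt0.
have [N1 P1] := zl _ e4; have [N2 P2] := zl' _ e4.
exists (maxn N1 N2) => k; rewrite geq_max => /andP[/P1 k1 /P2 k2].
by rewrite opprD addrACA; apply: le_lt_trans (sqnD_le _ _) _; lra.
Qed.

Lemma ccvgN z l : ccvg z l -> ccvg (fun k => - z k) (- l).
Proof. by move=> zl e /zl[N NP]; exists N => k /NP; rewrite -opprD sqnN. Qed.

Lemma ccvgB z z' l l' : ccvg z l -> ccvg z' l' -> ccvg (fun k => z k - z' k) (l - l').
Proof. by move=> zl zl'; apply: ccvgD => //; exact: ccvgN. Qed.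

Lemma ccvgM z z' l l' : ccvg z l -> ccvg z' l' -> ccvg (fun k => z k * z' k) (l * l').
Proof.
move=> zl zl' e e0.
have l1 : 0 < 8 * (sqn l + 1) by rewrite mulr_gt0// ltr_wpDl// sqn_ge0.
have l1' : 0 < 4 * (2 * sqn l' + 2) by rewrite mulr_gt0// ltr_wpDl// mulr_ge0// sqn_ge0.
have [N1 P1] := zl _ (divr_gt0 e0 l1').
have [N2 P2] := zl' _ (divr_gt0 e0 l1).
have [N3 P3] := zl' 1 ltr01.
exists (maxn N1 (maxn N2 N3)) => k; rewrite !geq_max => /and3P[/P1 k1 /P2 k2 /P3 k3].
have -> : z k * z' k - l * l' = (z k - l) * z' k + l * (z' k - l') by ring.
apply: le_lt_trans (sqnD_le _ _) _; rewrite !sqnM.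
move: k1 k2; rewrite !ltr_pdivlMr// => k1 k2.
apply: (product_small (Y := sqn l')) => //; rewrite ?sqn_ge0//.
rewrite -(subrK l' (z' k)) addrC; apply: le_trans (sqnD_le _ _) _; lra.
Qed.

Lemma ccvgV z l : l != 0 -> ccvg z l -> ccvg (fun k => (z k)^-1) l^-1.
Proof.
move=> l0 zl e e0; have s0 : 0 < sqn l by rewrite sqn_gt0.
have [N1 P1] := zl _ (divr_gt0 s0 (ltr0n _ 4)).
have e1 : 0 < e * sqn l ^+ 2 / 4 by rewrite divr_gt0// mulr_gt0// exprn_gt0.
have [N2 P2] := zl _ e1.
exists (maxn N1 N2) => k; rewrite geq_max => /andP[/P1 k1 /P2 k2].
have zk : sqn l / 4 <= sqn (z k).
  have := sqnD_le (z k) (l - z k); rewrite addrC subrK -(sqnN (l - _)) opprB; lra.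
have zk0 : z k != 0 by rewrite -sqn_gt0; apply: lt_le_trans zk; rewrite divr_gt0.
have -> : (z k)^-1 - l^-1 = - (z k - l) / (z k * l) by field; rewrite zk0 l0.
rewrite sqnM sqnN sqnV sqnM ltr_pdivrMr; last by rewrite mulr_gt0// sqn_gt0.
apply: lt_le_trans k2 _; rewrite expr2 -mulrA ler_pM2l// -mulrA mulrC.
by rewrite -mulrA [4^-1 * _]mulrC mulrC [leRHS]mulrC; rewrite mulrC ler_pM2l.
Qed.

Lemma ccvg_conj z l : ccvg z l -> ccvg (fun k => (z k)^*) l^*.
Proof. by move=> zl e /zl[N NP]; exists N => k /NP; rewrite -rmorphB sqn_conj. Qed.

End ComplexLimits.

Lemma ccvg_sum (R : realType) k (F : 'I_k -> nat -> R[i]) (a : 'I_k -> R[i]) :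
  (forall i, ccvg (F i) (a i)) -> ccvg (fun m => \sum_i F i m) (\sum_i a i).
Proof.
elim: k F a => [|k IH] F a Fa.
  by rewrite big_ord0; under [fun _ => _]eq_fun do rewrite big_ord0; exact: ccvg_cst.
rewrite big_ord_recl; under [fun _ => _]eq_fun do rewrite big_ord_recl.
by apply: ccvgD => //; exact: IH.
Qed.

Lemma ccvg_dot (R : realType) (U : hilbertSpace R) (s t : nat -> U) (x y : U) :
  qcvg (@nq R U) s x -> qcvg (@nq R U) t y ->
  ccvg (fun k => hs_dot U (s k) (t k)) (hs_dot U x y).
Proof.
move=> sx ty e e0.
have uH := hs_hermitian U.
have x1 : 0 < 8 * (nq x + 1) by rewrite mulr_gt0// ltr_wpDl// nq_ge0.
have y1 : 0 < 4 * (2 * nq y + 2) by rewrite mulr_gt0// ltr_wpDl// mulr_ge0// nq_ge0.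
have [N1 P1] := sx _ (divr_gt0 e0 y1).
have e2 : 0 < Num.min (e / (8 * (nq x + 1))) 1.
  by rewrite lt_min divr_gt0/=.
have [N2 P2] := ty _ e2.
exists (maxn N1 N2) => k; rewrite geq_max => /andP[/P1 k1 /P2 k2].
have -> : hs_dot U (s k) (t k) - hs_dot U x y
   = hs_dot U (s k - x) (t k) + hs_dot U x (t k - y).
  by rewrite (hermBl uH) (hermBr uH); ring.
apply: le_lt_trans (sqnD_le _ _) _.
have c1 := hs_cauchy_schwarz (s k - x) (t k).
have c2 := hs_cauchy_schwarz x (t k - y).
have t1 : nq (t k) <= 2 * nq y + 2.
  rewrite -(subrK y (t k)) addrC; apply: le_trans (nqD_le _ _) _.
  have : nq (t k - y) < 1 by apply: lt_le_trans k2 _; rewrite ge_min lexx orbT.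
  lra.
have k2' : nq (t k - y) < e / (8 * (nq x + 1)).
  by apply: lt_le_trans k2 _; rewrite ge_min lexx.
move: k1 k2'; rewrite !ltr_pdivlMr//.
move=> k1 k2'.
apply: le_lt_trans (_ : 2 * (nq (s k - x) * nq (t k)) + 2 * (nq x * nq (t k - y)) < _).
  by apply: lerD; rewrite ler_pM2l.
by apply: (product_small (Y := nq y)) => //; exact: nq_ge0.
Qed.

(** The bound makes the norm square of the perturbation of [lincomb n c] at most
    a sixteenth of [\sum_i sqn (c i)], while [lincomb n c] itself has the square
    [- \sum_i sqn (c i)]. *)
Lemma perturb_negdef (R : realType) (E : lmodType R[i]) (h : E -> E -> R[i])
    kappa (n b : 'I_kappa -> E) : hermitian_form h -> frame h n ->
  (forall i, quad (maj h n) (n i - b i) < (16 * 2 ^+ kappa)^-1) -> negdef h b.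
Proof.
move=> hH nf nb c c0; pose s := \sum_i sqn (c i); have s0 : 0 < s by exact: sum_sqn_gt0.
pose a := lincomb n c; pose r := - lincomb (fun i => n i - b i) c.
have -> : lincomb b c = a + r.
  rewrite /a /r -scaleN1r lincombZ /lincomb -big_split; apply: eq_bigr => i _ /=.
  by rewrite mulN1r scaleNr scalerBr opprB addrCA subrr addr0.
have Nr : quad (maj h n) r <= 16^-1 * s.
  rewrite /r (snN n hH); apply: le_trans (sn_lincomb hH nf _ _) _.
  apply: le_trans (_ : 2 ^+ kappa * \sum_i sqn (c i) * (16 * 2 ^+ kappa)^-1 <= _).
    rewrite ler_wpM2l ?exprn_ge0//; apply: ler_sum => i _.
    by rewrite ler_wpM2l ?sqn_ge0// ltW.
  rewrite -mulr_suml -/s; have K0 : 2 ^+ kappa != 0 :> R by rewrite expf_neq0.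
  rewrite (_ : 2 ^+ kappa * _ = 16^-1 * s)//.
  by move: K0; move: (2 ^+ kappa) => K K0; field.
have qa : quad h a = - s by rewrite (negon_quad hH _ nf.1).
have Na : quad (maj h n) a = s.
  rewrite (quad_maj hH) qa.
  under eq_bigr => i _ do rewrite (negon_coord hH _ _ nf.1) sqnN.
  by rewrite -/s; ring.
rewrite (quadD hH) qa.
have := quad_le_sn n hH r.
have : re (h a r) ^+ 2 <= s * quad (maj h n) r.
  apply: le_trans (re_sqr_le _) _; rewrite -[X in X * _]Na; exact: herm_le_maj.
move: Nr; set x := quad (maj h n) r; set y := re _ => Nr xy qr.
have : y <= s / 4.
  rewrite leNgt; apply/negP => sy.
  have : (s / 4) ^+ 2 < y ^+ 2 by rewrite ltr_pXn2r// nnegrE; lra.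
  rewrite (_ : (s / 4) ^+ 2 = s ^+ 2 * 16^-1); last by field.
  nra.
lra.
Qed.

Section Localize.
Variables (R : realType) (Y U : hilbertSpace R) (Om : set R[i]).
Variable (s : R[i] -> Y -> U).
Hypothesis Om1 : forall z, Om z -> sqn z < 1.
Hypothesis Om_open : forall z, Om z ->
  exists2 r : R, 0 < r & forall z', sqn (z' - z) < r ^+ 2 -> Om z'.
Hypothesis Om0 : Om 0.
Hypothesis s_cont : forall z y (e : R), Om z -> 0 < e ->
  exists2 r : R, 0 < r & forall z', sqn (z' - z) < r ^+ 2 -> nq (s z' y - s z y) < e.

Definition kpoint : choiceType := ({w : R[i] | w \in Om} * Y)%type.
Definition kpw (i : kpoint) : R[i] := val i.1.
Definition kpy (i : kpoint) : Y := i.2.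
Definition kps (i : kpoint) : U := s (kpw i) (kpy i).

Lemma kpw_Om i : Om (kpw i). Proof. by rewrite -inE; exact: (valP i.1). Qed.
Lemma kpw1 i : sqn (kpw i) < 1. Proof. exact/Om1/kpw_Om. Qed.

Definition kmk w (Hw : Om w) (y : Y) : kpoint := (exist _ w (mem_set Hw), y).

Local Notation h := (kform (schurker kpw kpy kps)).
Local Notation E := (fspace R kpoint).
Let hH : hermitian_form h := schurform_herm kpw kpy kps.

Variables (kappa : nat) (n : 'I_kappa -> E).
Hypothesis nf : frame h n.

Local Notation N := (quad (maj h n)).

Lemma point_continuous (i : kpoint) (e : R) : 0 < e ->
  exists2 d : R, 0 < d & forall j : kpoint, kpy j = kpy i ->
    sqn (kpw j - kpw i) < d ^+ 2 -> N (fpoint R i - fpoint R j) < e.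
Proof.
move=> e0; apply: contrapT => no.
have bad (k : nat) : exists j, [/\ kpy j = kpy i,
    sqn (kpw j - kpw i) < k.+1%:R^-1 ^+ 2 & e <= N (fpoint R i - fpoint R j)].
  apply: contrapT => nj; apply: no; exists k.+1%:R^-1 => [|j jy jw].
    by rewrite invr_gt0.
  by rewrite ltNge; apply/negP => je; apply: nj; exists j.
have /choice[j jP] := bad.
have small (d : R) : 0 < d -> exists M, forall k, (M <= k)%N ->
    sqn (kpw (j k) - kpw i) < d ^+ 2.
  move=> d0; have [M MP] := inv_small d0; exists M => k /MP kd.
  have [_ jw _] := jP k; apply: lt_trans jw _.
  by rewrite ltr_pXn2r// nnegrE ?invr_ge0// ltW.
have wl : ccvg (fun k => kpw (j k)) (kpw i).
  move=> d d0; have d1 : 0 < Num.sqrt d by rewrite sqrtr_gt0.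
  have [M MP] := small _ d1.
  by exists M => k /MP; rewrite sqr_sqrtr// ltW.
have sl : qcvg (@nq R U) (fun k => kps (j k)) (kps i).
  move=> d d0; have [r r0 rP] := s_cont (kpy i) (kpw_Om i) d0.
  have [M MP] := small r r0; exists M => k /MP; rewrite /kps.
  by have [-> _ _] := jP k; exact: rP.
have scst x : qcvg (@nq R U) (fun=> x) x.
  by move=> d d0; exists 0%N => k _; rewrite subrr nq0.
have kE a b : h (fpoint R a) (fpoint R b) = schurker kpw kpy kps a b.
  exact: (kform_delta (schurker_herm kpw kpy kps)).
have den a b : 1 - kpw a * (kpw b)^* != 0 by apply: disc_neq0; exact: kpw1.
have lim1 (b : E) : ccvg (fun k => h (fpoint R (j k)) b) (h (fpoint R i) b).
  apply: (free_ind (P := fun b =>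
    ccvg (fun k => h (fpoint R (j k)) b) (h (fpoint R i) b))).
  - rewrite (herm0r hH); have -> : (fun k => h (fpoint R (j k)) 0) = fun=> 0.
      by apply/funext => k; rewrite (herm0r hH).
    exact: ccvg_cst.
  - move=> c x y xl yl; rewrite (hermDr hH) (hermZr hH).
    have -> : (fun k => h (fpoint R (j k)) (c *: x + y)) =
        (fun k => c^* * h (fpoint R (j k)) x + h (fpoint R (j k)) y).
      by apply/funext => k; rewrite (hermDr hH) (hermZr hH).
    by apply: ccvgD => //; apply: ccvgM => //; exact: ccvg_cst.
  move=> a _; rewrite kE.
  have -> : (fun k => h (fpoint R (j k)) (fpoint R a)) =
      (fun k => (hs_dot Y (kpy i) (kpy a) - hs_dot U (kps (j k)) (kps a))
                * (1 - kpw a * (kpw (j k))^*)^-1).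
    by apply/funext => k; rewrite kE /schurker; have [-> _ _] := jP k.
  apply: ccvgM; first by apply: ccvgB; [exact: ccvg_cst|exact: ccvg_dot].
  apply: ccvgV => //; apply: ccvgB; first exact: ccvg_cst.
  by apply: ccvgM; [exact: ccvg_cst|exact: ccvg_conj].
have lim2 : ccvg (fun k => h (fpoint R (j k)) (fpoint R (j k)))
    (h (fpoint R i) (fpoint R i)).
  rewrite kE; have -> : (fun k => h (fpoint R (j k)) (fpoint R (j k))) =
      (fun k => (hs_dot Y (kpy i) (kpy i) - hs_dot U (kps (j k)) (kps (j k)))
                * (1 - kpw (j k) * (kpw (j k))^*)^-1).
    by apply/funext => k; rewrite kE /schurker; have [-> _ _] := jP k.
  apply: ccvgM; first by apply: ccvgB; [exact: ccvg_cst|exact: ccvg_dot].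
  apply: ccvgV => //; apply: ccvgB; first exact: ccvg_cst.
  by apply: ccvgM => //; exact: ccvg_conj.
pose a k := fpoint R i - fpoint R (j k).
have al b : ccvg (fun k => h (a k) b) 0.
  rewrite -(subrr (h (fpoint R i) b)).
  have -> : (fun k => h (a k) b) = (fun k => h (fpoint R i) b - h (fpoint R (j k)) b).
    by apply/funext => k; rewrite (hermBl hH).
  by apply: ccvgB => //; exact: ccvg_cst.
have aa : ccvg (fun k => h (a k) (a k)) 0.
  set x := h (fpoint R i) (fpoint R i) in lim2.
  have -> : 0 = x - x - (x^* - x) :> R[i].
    by rewrite /x -(herm_sym hH); ring.
  have -> : (fun k => h (a k) (a k)) = (fun k => x - h (fpoint R (j k)) (fpoint R i)
      - ((h (fpoint R (j k)) (fpoint R i))^* - h (fpoint R (j k)) (fpoint R (j k)))).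
    by apply/funext => k; rewrite (hermBl hH) !(hermBr hH) -(herm_sym hH) /x; ring.
  have l1 : ccvg (fun k => h (fpoint R (j k)) (fpoint R i)) x := lim1 (fpoint R i).
  exact: (ccvgB (ccvgB (@ccvg_cst _ x) l1) (ccvgB (ccvg_conj l1) lim2)).
have Nl : ccvg (fun k => maj h n (a k) (a k)) 0.
  have -> : 0 = 0 + 2 * \sum_(l < kappa) 0 * 0 :> R[i].
    by rewrite big1 ?mulr0 ?addr0// => l _; rewrite mul0r.
  apply: ccvgD => //; apply: ccvgM; first exact: ccvg_cst.
  apply: ccvg_sum => l; apply: ccvgM => //.
  have -> : (fun k => h (n l) (a k)) = (fun k => (h (a k) (n l))^*).
    by apply/funext => k; rewrite -(herm_sym hH).
  by have := ccvg_conj (al (n l)); rewrite rmorph0.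
have [M MP] := Nl _ (exprn_gt0 2 e0).
have := MP M (leqnn M); rewrite subr0 (herm_quad (maj_herm hH n)) sqn_real.
rewrite ltNge => /negP; apply; have [_ _ eN] := jP M.
by rewrite ler_pXn2r// nnegrE ?(ltW e0)// (le_trans (ltW e0)).
Qed.

Lemma notin_seq_injective (T : eqType) (g : nat -> T) (l : seq T) :
  injective g -> exists m, g m \notin l.
Proof.
move=> gi; apply: contrapT => no.
have sub : {subset map g (iota 0 (size l).+1) <= l}.
  move=> _ /mapP[m _ ->]; apply: contrapT => /negP gm; apply: no; by exists m.
have := uniq_leq_size _ sub; rewrite map_inj_uniq// iota_uniq size_map size_iota.
by rewrite ltnn => /(_ isT).
Qed.

Lemma avoid_supports (g : nat -> R[i]) : injective g ->
  exists m, forall j, off kpw (g m) (n j).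
Proof.
move=> gi; have /choice[A AP] := fun j => free_supp (n j).
have [m mP] := notin_seq_injective
  (flatten [seq [seq kpw i | i <- A j] | j <- enum 'I_kappa]) gi.
exists m => j i nji; apply: contra mP => /eqP <-; apply/flattenP.
exists [seq kpw i | i <- A j]; first by apply/mapP; exists j; rewrite ?mem_enum.
apply/mapP; exists i => //; apply: contraNT nji => /AP ->; by rewrite eqxx.
Qed.

(** The negative squares of the kernel are already visible near the origin: all
    kernel functions are limits of combinations of kernel functions at points
    close to [0], because by continuity a single exceptional point would be
    accompanied by infinitely many. *)
Lemma localize (r : R) : 0 < r -> exists b : 'I_kappa -> E,
  negdef h b /\ forall i, supported [set j | sqn (kpw j) < r ^+ 2] (b i).
Proof.
have [r0 r00 r0P] := Om_open Om0.
wlog [rr0 r2] : r / r <= r0 /\ r <= 2^-1.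
  move=> W rp; have [||b [bn bs]] := W (Num.min r (Num.min r0 2^-1)).
  - by split; rewrite !ge_min lexx /= !orbT.
  - by rewrite !lt_min rp r00 invr_gt0 ltr0n.
  exists b; split=> // i; apply: supported_sub (bs i) => j /= jr.
  have m0 : 0 < Num.min r (Num.min r0 2^-1).
    by rewrite !lt_min rp r00 invr_gt0 ltr0n.
  apply: lt_le_trans jr _; rewrite ler_pXn2r ?nnegrE ?(ltW rp) ?(ltW m0)//.
  by rewrite ge_min lexx.
move=> rp.
have rOm z : sqn z < r ^+ 2 -> Om z.
  move=> zr; apply: r0P; rewrite subr0; apply: lt_le_trans zr _.
  by rewrite ler_pXn2r// nnegrE ltW.
have q2 (m : nat) : (r / m.+2%:R) ^+ 2 <= r ^+ 2 / 4.
  rewrite expr_div_n ler_pM2l ?exprn_gt0// lef_pV2 ?posrE ?exprn_gt0//.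
  by rewrite -natrX ler_nat -[4%N]/(2 ^ 2)%N leq_exp2r.
have r24 : r ^+ 2 / 4 < r ^+ 2.
  by rewrite ltr_pdivrMr// ltr_pMr ?exprn_gt0// ltr1n.
have divI : injective (fun m : nat => r / m.+2%:R).
  move=> m m' /(mulfI (lt0r_neq0 rp)) /invr_inj /eqP.
  by rewrite eqr_nat => /eqP[].
(* The iteration uses real points, the separation a purely imaginary one that
   avoids the supports of the vectors of the frame. *)
pose v (m : nat) : R[i] := (r / m.+2%:R)%:C%C.
have v2 m : sqn (v m) <= r ^+ 2 / 4 by rewrite sqn_real.
have vr m : sqn (v m) < r ^+ 2 by exact: le_lt_trans (v2 m) r24.
have v_inj : injective v by move=> m m' [] /divI.
have v4 m : sqn (v m) <= 4^-1.
  apply: le_trans (v2 m) _; rewrite ler_pdivrMr// mulVf//.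
  by rewrite expr_le1// ?(ltW rp)// (le_trans r2)// invf_le1// ler1n.
have g_inj : injective (fun m : nat => Complex 0 (r / m.+2%:R)).
  by move=> m m' [] /divI.
have [m0 woff] := avoid_supports g_inj.
set w := Complex 0 _ in woff.
have w2 : sqn w <= r ^+ 2 / 4 by rewrite /sqn /w /= expr0n add0r.
have wr : sqn w < r ^+ 2 by exact: le_lt_trans w2 r24.
have vw m : v m != w.
  rewrite eq_complex /= negb_and; apply/orP; left.
  by rewrite mulf_neq0 ?invr_neq0// gt_eqF.
pose sg m (i : kpoint) := kmk (rOm _ (vr m)) i.2.
pose sgs (i : kpoint) := kmk (rOm _ wr) i.2.
pose base : set kpoint := [set i | sqn (kpw i) < r ^+ 2 /\ kpw i != w].
have sgb m i : base (sg m i) by split; [exact: vr|exact: vw].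
have asg i : spanlim kpw kpy kps n base (fpoint R (sgs i)).
  apply: (spanlim_closed nf) => e e0.
  have [d d0 dP] := point_continuous (sgs i) e0.
  pose t := Num.min (d / 2) (r / 2).
  have t0 : 0 < t by rewrite lt_min !divr_gt0.
  pose z := w + t%:C%C.
  have zr : sqn z < r ^+ 2.
    have -> : sqn z = t ^+ 2 + sqn w by rewrite /sqn /z /w /=; ring.
    have : t ^+ 2 <= r ^+ 2 / 4.
      have -> : r ^+ 2 / 4 = (r / 2) ^+ 2 by field.
      by rewrite ler_pXn2r ?nnegrE ?(ltW t0) ?divr_ge0 ?(ltW rp)// ge_min lexx orbT.
    have := exprn_gt0 2 rp; move: w2; lra.
  exists (fpoint R (kmk (rOm _ zr) i.2)).
    apply: spanlim_supported; apply: supported_point; split=> //.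
    by rewrite /kpw /= /z -subr_eq0 addrC addKr eq_complex /= gt_eqF.
  apply: dP => //; rewrite /kpw /= /z addrAC subrr add0r sqn_real.
  rewrite ltr_pXn2r ?nnegrE ?(ltW t0) ?(ltW d0)//.
  by apply: le_lt_trans (_ : d / 2 < d); rewrite ?ge_min ?lexx// ltr_pdivrMr//; lra.
(* Around an exceptional point lie [kappa.+1] others; these are linearly
   dependent modulo the closure, and the separation puts one of them into it. *)
have all_approx i : spanlim kpw kpy kps n base (fpoint R i).
  apply: contrapT => nai.
  have [e e0 eP] : exists2 e : R, 0 < e & forall b, spanlim kpw kpy kps n base b ->
      e <= N (fpoint R i - b).
    apply: contrapT => no; apply: nai; apply: (spanlim_closed nf) => e e0.
    apply: contrapT => nb; apply: no; exists e => // b ab.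
    by rewrite leNgt; apply/negP => be; apply: nb; exists b.
  have [d d0 dP] := point_continuous i e0.
  have [d' d'0 d'P] := Om_open (kpw_Om i).
  pose t (j : 'I_kappa.+1) : R := Num.min (d / 2) (d' / 2) / j.+1%:R.
  have m0' : 0 < Num.min (d / 2) (d' / 2) by rewrite lt_min !divr_gt0.
  have t0 j : 0 < t j by rewrite divr_gt0.
  have tle (x : R) j : 0 < x -> Num.min (d / 2) (d' / 2) <= x / 2 -> t j < x.
    move=> x0 mx; apply: le_lt_trans (_ : x / 2 < x); last by rewrite ltr_pdivrMr//; lra.
    apply: le_trans mx; rewrite ler_pdivrMr// ler_peMr ?(ltW m0')//.
    by rewrite ler1n.
  have td j : sqn (kpw i + (t j)%:C%C - kpw i) < d ^+ 2.
    rewrite addrAC subrr add0r sqn_real ltr_pXn2r ?nnegrE ?(ltW (t0 j)) ?(ltW d0)//.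
    by apply: tle => //; rewrite ge_min lexx.
  have td' j : sqn (kpw i + (t j)%:C%C - kpw i) < d' ^+ 2.
    rewrite addrAC subrr add0r sqn_real ltr_pXn2r ?nnegrE ?(ltW (t0 j)) ?(ltW d'0)//.
    by apply: tle => //; rewrite ge_min lexx orbT.
  pose x j := kmk (d'P _ (td' j)) i.2.
  have xbad j : ~ spanlim kpw kpy kps n base (fpoint R (x j)).
    move=> ax; have := dP (x j) erefl (td j).
    by rewrite ltNge => /negP; apply; exact: eP.
  have xw j : kpw (x j) != w.
    apply/eqP => xjw; apply: (xbad j); have -> : x j = sgs (x j); last exact: asg.
    rewrite /x /sgs /kmk /=; congr (_, _); apply: val_inj => /=; exact: xjw.
  have xv : forall j, tail_free kpw v 0 (x j).
    move=> j m _; apply/eqP => xjv; apply: (xbad j); apply: spanlim_supported.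
    by apply: supported_point; split=> //; rewrite xjv.
  have x_inj : injective (fun j => kpw (x j)).
    move=> j l /= /addrI [] /(mulfI (lt0r_neq0 m0')) /invr_inj /eqP.
    by rewrite eqr_nat => /eqP[] /val_inj.
  have [c [[j cj] ac]] := dependent_mod_spanlim kpw1 nf v4 v_inj
     (sg := sg) (fun _ _ => erefl) (fun _ _ => erefl) sgb xv.
  apply: (xbad j); apply: (spanlim_separate kpw1 nf (Om1 (rOm _ wr))
     (sg := sgs) (fun _ => erefl) (fun _ => erefl) woff _ asg xw x_inj ac cj).
  by move=> l [].
have eps0 : 0 < (16 * 2 ^+ kappa)^-1 :> R by rewrite invr_gt0 mulr_gt0// exprn_gt0.
have /choice[b bP] j : exists b, supported base b /\ N (n j - b) < (16 * 2 ^+ kappa)^-1.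
  have : spanlim kpw kpy kps n base (n j).
    apply: (free_ind (P := spanlim kpw kpy kps n base)) => [|c x y|l _]; first exact: spanlim0.
      exact: spanlim_comb.
    exact: all_approx.
  by move=> /(_ _ eps0)[b bb nb]; exists b.
exists b; split; first by apply: (perturb_negdef hH nf) => j; case: (bP j).
by move=> j; apply: supported_sub (bP j).1 => l [].
Qed.

End Localize.

(** * Negative eigenvalues of Hermitian matrices *)

Section NegativeEigenvalues.
Variable R : realType.
Local Open Scope sesquilinear_scope.

Lemma char_poly_conj (F : fieldType) k (P A : 'M[F]_k) : P \in unitmx ->
  char_poly (invmx P *m A *m P) = char_poly A.
Proof.
move=> Pu; rewrite /char_poly /char_poly_mx.
pose Q := map_mx polyC P; pose Q' := map_mx polyC (invmx P).
have QQ : Q' *m Q = 1%:M by rewrite -map_mxM mulVmx// map_mx1.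
have -> : 'X%:M - map_mx polyC (invmx P *m A *m P) = Q' *m ('X%:M - map_mx polyC A) *m Q.
  rewrite mulmxBr mulmxBl !map_mxM; congr (_ - _).
  by rewrite scalar_mxC -mulmxA QQ mulmx1.
by rewrite !det_mulmx mulrAC -det_mulmx QQ det1 mul1r.
Qed.

Lemma hermitian_diagonal k (M : 'M[R[i]]_k) : (forall i j, M i j = (M j i)^*) ->
  exists (P Q : 'M[R[i]]_k) (D : 'I_k -> R), [/\ P *m Q = 1%:M,
    forall c : 'I_k -> R[i], \sum_i \sum_j (c i)^* * M i j * c j
      = (\sum_l D l * sqn (\sum_j P l j * c j))%:C%C
    & nb_negative_eigenvalues M = #|[pred l | D l < 0]| ].
Proof.
move=> Mh.
have hM : M \is hermsymmx.
  apply/is_hermitianmxP; rewrite expr0 scale1r; apply/matrixP => i j.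
  by rewrite !mxE -Mh.
have ME := orthomx_spectralP (hermitian_normalmx hM).
have Pu := spectral_unitarymx M.
have Dr := hermitian_spectral_diag_real hM.
move: ME Pu Dr; set P := spectralmx M; set d := spectral_diag M => ME Pu Dr.
have dR l : d 0 l = (re (d 0 l))%:C%C.
  by apply/esym/RRe_real; have /mxOverP := Dr; exact.
exists P, (P ^t*), (fun l => re (d 0 l)); split.
- exact/unitarymxP.
- move=> c; pose v := \col_j c j.
  have -> : \sum_i \sum_j (c i)^* * M i j * c j = (v ^t* *m M *m v) 0 0.
    rewrite mxE exchange_big; apply: eq_bigr => j _ /=.
    rewrite mxE mulr_suml; apply: eq_bigr => i _.
    by rewrite !mxE.
  rewrite ME (invmx_unitary Pu) !mulmxA.
  have -> : v ^t* *m P ^t* = (P *m v) ^t* by rewrite trmx_mul map_mxM.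
  rewrite -mulmxA -mulmxA mxE rmorph_sum; apply: eq_bigr => l _ /=.
  rewrite rmorphM /= -dR -mulcJ.
  have -> : \sum_j P l j * c j = (P *m v) l 0.
    by rewrite mxE; apply: eq_bigr => j _; rewrite mxE.
  rewrite mul_diag_mx !mxE; ring.
rewrite /nb_negative_eigenvalues.
case: (closed_field_poly_normal (char_poly M)) => r /= rE.
have /seq.permP -> : perm_eq r [seq d 0 l | l <- enum 'I_k].
  apply: prod_XsubC_eq.
  move: rE; rewrite (monicP (char_poly_monic M)) scale1r => <-; rewrite big_map big_enum /=.
  have -> : char_poly M = \prod_(l < k) ('X - (d 0 l)%:P).
    rewrite {1}ME char_poly_conj//; last exact: unitarymx_unit.
    rewrite char_poly_trig ?diag_mx_is_trig//; apply: eq_bigr => l _.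
    by rewrite mxE eqxx mulr1n.
  by [].
rewrite -sum1_count big_map big_enum_cond -sum1_card; apply: eq_bigl => l /=.
by rewrite inE dR ltcR.
Qed.

End NegativeEigenvalues.

Section GramMatrix.
Variables (R : realType) (E : lmodType R[i]) (h : E -> E -> R[i]).
Hypothesis hH : hermitian_form h.

Definition gram k (x : 'I_k -> E) : 'M[R[i]]_k := \matrix_(i, j) h (x j) (x i).

Lemma gram_diagonal k (x : 'I_k -> E) :
  exists (P Q : 'M[R[i]]_k) (D : 'I_k -> R), [/\ P *m Q = 1%:M,
    forall c, quad h (lincomb x c) = \sum_l D l * sqn (\sum_j P l j * c j)
    & nb_negative_eigenvalues (gram x) = #|[pred l | D l < 0]| ].
Proof.
have [|P [Q [D [PQ DE nE]]]] := @hermitian_diagonal R k (gram x).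
  by move=> i j; rewrite !mxE (herm_sym hH).
exists P, Q, D; split=> // c; rewrite /quad.
have -> : h (lincomb x c) (lincomb x c) = \sum_i \sum_j (c i)^* * gram x i j * c j.
  rewrite {1}/lincomb (herm_suml hH) exchange_big; apply: eq_bigr => j _ /=.
  rewrite /lincomb (herm_sumr hH); apply: eq_bigr => i _.
  by rewrite (hermZl hH) (hermZr hH) mxE; ring.
by rewrite DE.
Qed.

(** A negative definite family has at most as many members as the Gram matrix
    has negative eigenvalues: otherwise some combination has no component along
    the eigenvectors of negative eigenvalues. *)
Lemma negdef_le_gram k m (x : 'I_k -> E) (v : 'I_m -> E) (a : 'I_m -> 'I_k -> R[i]) :
  negdef h v -> (forall i, v i = lincomb x (a i)) ->
  (m <= nb_negative_eigenvalues (gram x))%N.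
Proof.
move=> vn va; have [P [_ [D [_ DE ->]]]] := gram_diagonal x.
rewrite leqNgt; apply/negP => lt_m.
have [c [c0 ck]] := exists_kernel_comb
  (fun i (l : 'I_#|[pred l | D l < 0]|) => \sum_j P (enum_val l) j * a i j) lt_m.
have := vn c c0; rewrite ltNge => /negP; apply.
have -> : lincomb v c = lincomb x (fun j => \sum_i c i * a i j).
  rewrite /lincomb; under eq_bigr => i _ do rewrite va /lincomb scaler_sumr.
  rewrite exchange_big; apply: eq_bigr => j _ /=.
  by rewrite scaler_suml; apply: eq_bigr => i _; rewrite scalerA.
rewrite DE; apply: sumr_ge0 => l _; have [Dl|Dl] := leP 0 (D l).
  by rewrite mulr_ge0 ?sqn_ge0.
rewrite (_ : \sum_j _ = 0) ?sqn0 ?mulr0//.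
have lD : l \in [pred l | D l < 0] by [].
have := ck (enum_rank_in lD l); rewrite enum_rankK_in//; apply: etrans.
under eq_bigr => j _ do rewrite mulr_sumr.
rewrite exchange_big; apply: eq_bigr => i _ /=.
by rewrite mulr_sumr; apply: eq_bigr => j _; ring.
Qed.

(** The eigenvectors of negative eigenvalues are the coefficients of a negative
    definite family. *)
Lemma gram_negdef k (x : 'I_k -> E) :
  exists v : 'I_(nb_negative_eigenvalues (gram x)) -> E, negdef h v.
Proof.
have [P [Q [D [PQ DE ->]]]] := gram_diagonal x.
exists (fun l => lincomb x (fun j => Q j (enum_val l))) => c c0.
have -> : lincomb (fun l => lincomb x (fun j => Q j (enum_val l))) c =
    lincomb x (fun j => \sum_l c l * Q j (enum_val l)).
  rewrite /lincomb; under eq_bigr => i _ do rewrite scaler_sumr.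
  rewrite exchange_big; apply: eq_bigr => j _ /=.
  by rewrite scaler_suml; apply: eq_bigr => i _; rewrite scalerA.
have PE i : \sum_j P i j * (\sum_l c l * Q j (enum_val l)) =
    \sum_l c l * (i == enum_val l)%:R.
  under eq_bigr => j _ do rewrite mulr_sumr.
  rewrite exchange_big; apply: eq_bigr => l _ /=.
  have := congr1 (fun M : 'M[R[i]]_k => M i (enum_val l)) PQ; rewrite !mxE => <-.
  by rewrite mulr_sumr; apply: eq_bigr => j _; ring.
rewrite DE (bigID [pred l | D l < 0]) /= [X in _ + X]big1 ?addr0; last first.
  move=> i; rewrite -leNgt => Di; rewrite PE big1 ?sqn0 ?mulr0// => l _.
  have [iE|_] := eqVneq i (enum_val l); last by rewrite mulr0.
  by have := enum_valP l; rewrite -iE inE ltNge Di.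
have PEl l : sqn (\sum_j P (enum_val l) j * (\sum_l c l * Q j (enum_val l))) = sqn (c l).
  rewrite PE (bigD1 l)//= eqxx mulr1 big1 ?addr0// => l' l'l.
  by rewrite (inj_eq enum_val_inj) eq_sym (negPf l'l) mulr0.
rewrite (eq_bigl [in [pred l | D l < 0]])// big_enum_val /=.
under eq_bigr => l _ do rewrite PEl.
have Dn (l : 'I_#|[pred l | D l < 0]|) : D (enum_val l) < 0 by exact: (enum_valP l).
case: c0 => l cl; rewrite (bigD1 l)//= ltr_wnDr//.
  by apply: sumr_le0 => j _; rewrite nmulr_rle0 ?sqn_ge0.
by rewrite nmulr_rlt0// sqn_gt0.
Qed.

(** After orthonormalization, a negative vector orthogonal to the family could be
    added to it. *)
Lemma frame_of_negdef kappa (v : 'I_kappa -> E) : negdef h v ->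
  (forall m (w : 'I_m -> E), negdef h w -> (m <= kappa)%N) ->
  exists n : 'I_kappa -> E, frame h n.
Proof.
move=> /(gram_schmidt hH)[n [nn _]] ub; exists n; split=> // x xn.
rewrite leNgt; apply/negP => xlt.
by have := ub _ _ (negon_fcons_negdef hH nn xn xlt); rewrite ltnn.
Qed.

End GramMatrix.

(** * Adjoints of bounded operators *)

Section Adjoints.
Variable R : realType.

Lemma continuous_of_bounded (V W : normedModType R[i]) (T : V -> W) (c : R) :
  linear T -> 0 <= c -> (forall x, nq (T x) <= c * nq x) -> continuous_linear T.
Proof.
move=> TL c0 Tc; split=> //.
pose Tl : {linear V -> W} := HB.pack T (GRing.isLinear.Build _ _ _ _ _ TL).
suff : continuous Tl by [].
apply/linear_bounded_continuous/linear_boundedP.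
exists (Num.sqrt c)%:C%C; split=> [|r].
  by rewrite complex_real.
case: r => a b; rewrite ltcE /= => /andP[/eqP -> ca] x.
have a0 : 0 <= a by rewrite (le_trans _ (ltW ca))// sqrtr_ge0.
rewrite (norm_re x) (norm_re (T x)) -[Complex a 0]/(a%:C)%C -rmorphM lecR.
have n1 : re `|T x| \in Num.nneg by rewrite nnegrE re_norm_ge0.
have n2 : a * re `|x| \in Num.nneg by rewrite nnegrE mulr_ge0// re_norm_ge0.
rewrite -(ler_pXn2r (isT : (0 < 2)%N) n1 n2) exprMn -!/(nq _).
apply: le_trans (Tc x) _; apply: ler_wpM2r; first exact: nq_ge0.
by rewrite -(sqr_sqrtr c0) ler_pXn2r ?nnegrE ?sqrtr_ge0// ltW.
Qed.

Variables (U Y : hilbertSpace R).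

Lemma hs_nondeg (x y : U) : (forall u, hs_dot U u x = hs_dot U u y) -> x = y.
Proof.
move=> xy; apply/eqP; rewrite -subr_eq0 -nq_eq0 -hs_quad /quad.
by rewrite (hermBr (hs_hermitian U)) xy subrr.
Qed.

Lemma hs_dot_le (x : U) (B : R) : 0 <= B ->
  (forall u, sqn (hs_dot U u x) <= B * nq u) -> nq x <= B.
Proof.
move=> B0 /(_ x); rewrite (herm_quad (hs_hermitian U)) sqn_real hs_quad expr2.
have [->//|x0] := eqVneq (nq x) 0.
by rewrite ler_pM2r// lt_neqAle eq_sym x0 nq_ge0.
Qed.

Lemma adjointP (T : U -> Y) : continuous_linear T ->
  continuous_linear (adjoint T) /\
  forall u y, hs_dot Y (T u) y = hs_dot U u (adjoint T y).
Proof.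
move=> Tc; have [c c0 cP] := bounded_of_continuous Tc.
have YH := hs_hermitian Y; have UH := hs_hermitian U.
have ex y : exists u', forall u, hs_dot Y (T u) y = hs_dot U u u'.
  apply: (hs_riesz (B := c * nq y)) => [a u v|u].
    by rewrite Tc.1 (hermPl YH).
  apply: le_trans (hs_cauchy_schwarz _ _) _; rewrite [leRHS]mulrAC.
  by apply: ler_wpM2r; [exact: nq_ge0|exact: cP].
have /choice[T' T'P] := ex.
suff T'c : continuous_linear T'.
  by rewrite /adjoint; case: xgetP => [S _ [? ?]//|/(_ T')[]].
apply: (continuous_of_bounded (c := c)); last 2 first.
- exact: ltW.
- move=> y; apply: hs_dot_le => [|u]; first by rewrite mulr_ge0 ?nq_ge0// ltW.
  rewrite -T'P; apply: le_trans (hs_cauchy_schwarz _ _) _.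
  by rewrite [leRHS]mulrAC; apply: ler_wpM2r; [exact: nq_ge0|exact: cP].
move=> a x y; apply: hs_nondeg => u.
by rewrite (hermDr UH) (hermZr UH) -!T'P (hermDr YH) (hermZr YH).
Qed.

End Adjoints.

(** * Negative squares of a function of the generalized Schur class *)

Section SchurClass.
Variables (R : realType) (U Y : hilbertSpace R) (S : R[i] -> U -> Y).
Variable kappa : nat.

Definition sadj (w : R[i]) (y : Y) : U := adjoint (S w) y.

Local Notation Om := (holomorphy_domain S).

Lemma domain_disc z : Om z -> sqn z < 1.
Proof.
case=> z1 _; rewrite -ltcR -normc_sqn rmorph1.
by rewrite -(expr1n _ 2) ltr_pXn2r// nnegrE ?normr_ge0// ler01.
Qed.

Lemma domain_open z : Om z ->
  exists2 r : R, 0 < r & forall z', sqn (z' - z) < r ^+ 2 -> Om z'.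
Proof.
move=> [z1 Hz].
have /near_complexP[r r0 rP] : \forall z' \near (z : R[i]^o), holomorphic_at S z'.
  exact: (nbhs_interior Hz).
have zE (x : R[i]) : `|x| = (re `|x|)%:C%C := norm_re (x : R[i]^o).
have t0 : 0 < 1 - re `|z|.
  by rewrite subr_gt0 -ltcR -zE.
exists (Num.min r (1 - re `|z|)) => [|z' z'z]; first by rewrite lt_min r0.
have m0 : 0 < Num.min r (1 - re `|z|) by rewrite lt_min r0.
split; last first.
  apply: rP; apply: lt_le_trans z'z _.
  by rewrite ler_pXn2r ?nnegrE ?(ltW m0) ?(ltW r0)// ge_min lexx.
have d : re `|z' - z| < 1 - re `|z|.
  rewrite ltNge; apply/negP => dd.
  move: z'z; rewrite -ltcR -normc_sqn zE -rmorphXn ltcR ltNge => /negP; apply.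
  rewrite ler_pXn2r ?nnegrE ?(ltW m0)//; last by rewrite (le_trans (ltW t0)).
  by apply: le_trans dd; rewrite ge_min lexx orbT.
rewrite -(subrK z z'); apply: le_lt_trans (ler_normD _ _) _.
rewrite (zE (z' - z)) (zE z) -rmorphD -[1]/(1%:C)%C ltcR.
by rewrite -ltrBrDr.
Qed.

Lemma domain_clin z : Om z -> continuous_linear (S z).
Proof.
by case=> _ /near_complexP[r r0 rP]; apply: (rP z _).1; rewrite subrr sqn0 exprn_gt0.
Qed.

Lemma sadjP z u y : Om z -> hs_dot Y (S z u) y = hs_dot U u (sadj z y).
Proof. by move=> /domain_clin/adjointP[]. Qed.

Lemma sadj_continuous z y (e : R) : Om z -> 0 < e ->
  exists2 r : R, 0 < r &
    forall z', sqn (z' - z) < r ^+ 2 -> nq (sadj z' y - sadj z y) < e.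
Proof.
move=> Oz e0; have [_ /near_complexP[r0 r00 r0P]] := Oz.
have [|_ [S' S'c S'P]] := r0P z; first by rewrite subrr sqn0 exprn_gt0.
have [c c0 cP] := bounded_of_continuous S'c.
have /near_complexP[r1 r10 r1P] := S'P 1 ltr01.
have [r2 r20 r2P] := domain_open Oz.
pose K := (2 + 2 * c) * nq y + 1.
have K0 : 0 < K.
  by rewrite ltr_wpDl// mulr_ge0 ?nq_ge0// addr_ge0// mulr_ge0// ltW.
have eK : 0 < Num.sqrt (e / K) by rewrite sqrtr_gt0 divr_gt0.
pose r := Num.min r1 (Num.min r2 (Num.sqrt (e / K))).
have rp : 0 < r by rewrite !lt_min r10 r20 eK.
exists r => // z' z'z.
have sub (x : R) : 0 < x -> r <= x -> sqn (z' - z) < x ^+ 2.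
  move=> x0 rx; apply: lt_le_trans z'z _; rewrite ler_pXn2r ?nnegrE ?(ltW rp) ?(ltW x0)//.
have zz1 : sqn (z' - z - 0) < r1 ^+ 2.
  by rewrite subr0 sub// /r ge_min lexx.
have Oz' : Om z' by apply: r2P; apply: sub => //; rewrite /r !ge_min lexx orbT.
have zz3 : sqn (z' - z) < e / K.
  rewrite -[ltRHS]sqr_sqrtr ?divr_ge0 ?ltW//.
  by apply: sub => //; rewrite /r !ge_min lexx !orbT.
have near_u u : nq (S z' u - S z u) <= sqn (z' - z) * (2 + 2 * c) * nq u.
  have := r1P _ zz1 u; rewrite [z + _]addrC subrK mul1r -normrZ => H.
  rewrite -[X in nq X](subrK ((z' - z) *: S' u)).
  apply: le_trans (nqD_le _ _) _.
  have h1 : nq (S z' u - S z u - (z' - z) *: S' u) <= sqn (z' - z) * nq u.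
    rewrite -nqZ -lecR !nq_norm ler_pXn2r// nnegrE ?normr_ge0//.
  have h2 : nq ((z' - z) *: S' u) <= sqn (z' - z) * (c * nq u).
    by rewrite nqZ ler_wpM2l ?sqn_ge0.
  by apply: le_trans (lerD (ler_wpM2l _ h1) (ler_wpM2l _ h2)) _ => //; lra.
apply: le_lt_trans (_ : sqn (z' - z) * (2 + 2 * c) * nq y < e).
  apply: hs_dot_le => [|u].
    by rewrite mulr_ge0 ?nq_ge0// mulr_ge0 ?sqn_ge0// addr_ge0// mulr_ge0// ltW.
  rewrite (hermBr (hs_hermitian U)) -!sadjP// -(hermBl (hs_hermitian Y)).
  apply: le_trans (hs_cauchy_schwarz _ _) _; rewrite [leRHS]mulrAC.
  by apply: ler_wpM2r; [exact: nq_ge0|exact: near_u].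
rewrite -mulrA; apply: le_lt_trans (_ : sqn (z' - z) * K < e).
  by rewrite ler_wpM2l ?sqn_ge0// /K lerDl.
by rewrite -ltr_pdivlMr.
Qed.

Local Notation pw := (@kpw R Y Om).
Local Notation py := (@kpy R Y Om).
Local Notation ps := (kps sadj).
Local Notation h := (kform (schurker pw py ps)).

Lemma kernel_matrix_gram k (x : 'I_k -> kpoint Y Om) :
  kernel_matrix S (fun i => pw (x i)) (fun i => py (x i)) =
  gram h (fun i => fpoint R (x i)).
Proof.
have YH := hs_hermitian Y.
apply/matrixP => i j; rewrite !mxE (kform_delta (schurker_herm pw py ps)).
rewrite /schur_kernel (hermZl YH) (hermBl YH) sadjP; last exact: kpw_Om.
by rewrite mulrC.
Qed.

(** The Hermitian matrices of the kernel are the Gram matrices of finite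
    families of kernel functions, so the negative squares are those of the form
    on the span of all kernel functions. *)
Lemma schur_frame : has_negative_squares S kappa ->
  exists n : 'I_kappa -> fspace R (kpoint Y Om), frame h n.
Proof.
case=> ub [m [w [f [Ow wE]]]]; have hH := schurform_herm pw py ps.
pose x i : kpoint Y Om := kmk (Ow i) (f i).
have gE : nb_negative_eigenvalues (gram h (fun i => fpoint R (x i))) = kappa.
  by rewrite -kernel_matrix_gram.
have := gram_negdef hH (fun i => fpoint R (x i)); rewrite gE => -[v vn].
apply: (frame_of_negdef hH vn) => l u un.
have [k [z [a aP]]] := free_family u.
apply: leq_trans (negdef_le_gram hH un aP) _.
by rewrite -kernel_matrix_gram; apply: ub => i; exact: kpw_Om.
Qed.

End SchurClass.

(** * Neumann inverses and the contraction property of the adjoint *)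

Section Neumann.
Variables (R : realType) (X : completeNormedModType R[i]) (A : X -> X).
Variables (a : R) (z : R[i]).
Hypothesis cA : continuous_linear A.
Hypothesis aP : forall x, nq (A x) <= a * nq x.
Hypothesis za : sqn z * a <= 4^-1.

Let zA_le x : nq (z *: A x) <= 4^-1 * nq x.
Proof.
rewrite nqZ; apply: le_trans (ler_wpM2l (sqn_ge0 z) (aP x)) _.
by rewrite mulrA; apply: ler_wpM2r; first exact: nq_ge0.
Qed.

Let zAB x y : z *: A x - z *: A y = z *: A (x - y).
Proof.
have -> : x - y = (-1) *: y + x by rewrite scaleN1r addrC.
by rewrite cA.1 scaleN1r -scalerBr addrC.
Qed.

Lemma neumann_bound x g : x - z *: A x = g -> nq x <= 4 * nq g.
Proof.
move=> xg; have := nqD_le g (z *: A x); rewrite -{1}xg subrK.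
by have := zA_le x; lra.
Qed.

Lemma neumann_solve g : exists x, x - z *: A x = g.
Proof.
pose s k := iter k (fun x => g + z *: A x) 0.
have sS k : s k.+1 = g + z *: A (s k) by [].
have dS k : nq (s k.+2 - s k.+1) <= 4^-1 * nq (s k.+1 - s k).
  rewrite (sS k.+1) {1}(sS k) opprD addrACA subrr add0r zAB; exact: zA_le.
have dk k : nq (s k.+1 - s k) <= 4^-1 ^+ k * nq (s 1%N - s 0%N).
  elim: k => [|k IH]; first by rewrite mul1r.
  by apply: le_trans (dS k) _; rewrite exprS -mulrA ler_pM2l// invr_gt0.
have tail j : forall k, nq (s (k + j)%N - s k) <= 4 * nq (s k.+1 - s k).
  elim: j => [|j IH] k; first by rewrite addn0 subrr nq0 mulr_ge0 ?nq_ge0.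
  rewrite addnS -addSn -(subrK (s k.+1) (s (k.+1 + j)%N)) -addrA.
  apply: le_trans (nqD_le _ _) _; have := IH k.+1; have := dS k.
  lra.
have cs : qcauchy (@nq R X) s.
  move=> e e0; pose M := nq (s 1%N - s 0%N) + 1.
  have M0 : 0 < M by rewrite ltr_wpDl// nq_ge0.
  have eM : 0 < e / (16 * M) by rewrite divr_gt0// mulr_gt0.
  have q0 : 0 <= 4^-1 :> R by rewrite invr_ge0.
  have q1 : 4^-1 < 1 :> R by rewrite invf_lt1// ltr1n.
  have [N NP] := geometric_small q0 q1 eM.
  have sm k : (N <= k)%N -> nq (s k - s N) < e / 4.
    move=> Nk; rewrite -(subnKC Nk); apply: le_lt_trans (tail _ _) _.
    have := NP N (leqnn N); rewrite ltr_pdivlMr ?mulr_gt0// => qM.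
    have dM : 4^-1 ^+ N * nq (s 1%N - s 0%N) <= 4^-1 ^+ N * M.
      by rewrite ler_wpM2l ?exprn_ge0// /M lerDl.
    by have := le_trans (dk N) dM; move: qM; rewrite mulrCA; lra.
  exists N => m k Nm Nk; have -> : s m - s k = (s m - s N) + (s N - s k).
    by rewrite addrA subrK.
  apply: le_lt_trans (nqD_le _ _) _; rewrite -(nqN (s N - s k)) opprB.
  by have := sm m Nm; have := sm k Nk; lra.
have [l sl] := complete_qcvg cs; exists l; apply/eqP; rewrite subr_eq; apply/eqP.
apply: (qcvg_unique (u := fun k => s k.+1)).
  by move=> e /sl[N NP]; exists N => k Nk; apply: NP; exact: leqW.
move=> e e0; have [N NP] := sl e e0; exists N => k /NP Nk.
rewrite sS opprD addrACA subrr add0r zAB; apply: le_lt_trans (zA_le _) _.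
by have := nq_ge0 (s k - l); lra.
Qed.

Lemma neumann_inverse : let G := operator_inverse (fun x => x - z *: A x) in
  [/\ continuous_linear G, cancel (fun x => x - z *: A x) G
    & cancel G (fun x => x - z *: A x)].
Proof.
rewrite /operator_inverse; case: xgetP => [G _ //|no].
have /choice[G GP] := neumann_solve.
have inj x y : x - z *: A x = y - z *: A y -> x = y.
  move=> xy; apply/eqP; rewrite -subr_eq0 -nq_eq0 eq_le nq_ge0 andbT.
  have := neumann_bound (x := x - y) (g := 0); rewrite nq0 mulr0; apply.
  by rewrite -zAB opprD opprK addrACA [- y + _]addrC -(opprB y) xy subrr.
exfalso; apply: (no G); split=> //; last by move=> x; apply: inj.
apply: (continuous_of_bounded (c := 4)) => // [b x y|x]; last exact: neumann_bound.
apply: inj; rewrite GP cA.1 -{1}(GP x) -{1}(GP y) !scalerBr scalerDr !scalerA.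
by rewrite [z * b]mulrC opprD addrACA.
Qed.

End Neumann.

(** The adjoint of a contraction between spaces of equal negative index is a
    contraction; [a] stands for the image of [b] under the adjoint. Adding to
    [a] a vector of the span of [n1] makes [b - T p] orthogonal to the negative
    subspace [T (lspan n1)], and the defect splits into three nonnegative terms. *)
Lemma adjoint_contraction (R : realType) (E1 E2 : lmodType R[i])
    (h1 : E1 -> E1 -> R[i]) (h2 : E2 -> E2 -> R[i]) kappa
    (n1 : 'I_kappa -> E1) (n2 : 'I_kappa -> E2) (T : E1 -> E2) (a : E1) (b : E2) :
  hermitian_form h1 -> hermitian_form h2 -> frame h1 n1 -> frame h2 n2 ->
  linear T -> (forall p, quad h2 (T p) <= quad h1 p) ->
  (forall p, h2 (T p) b = h1 p a) -> quad h1 a <= quad h2 b.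
Proof.
move=> H1 H2 f1 f2 TL Tc Tab.
have Tn : negdef h2 (fun i => T (n1 i)).
  move=> c c0; rewrite -(lincomb_lin _ _ TL); apply: le_lt_trans (Tc _) _.
  by rewrite (negon_quad H1 _ f1.1) oppr_lt0 sum_sqn_gt0.
have [m [mn mE]] := gram_schmidt H2 Tn.
pose w := b - T a.
have [d dE] : lspan (fun i => T (n1 i)) (- lincomb m (fun i => h2 w (m i))).
  rewrite -mE -scaleN1r lincombZ; by eexists.
pose v := lincomb n1 d; pose p := a + v.
have bTp : b - T p = ncomp h2 m w.
  rewrite /p (linear_D _ _ TL) opprD addrA /ncomp; congr (_ + _).
  by rewrite /v (lincomb_lin _ _ TL) -dE opprK.
have q1 : 0 <= quad h2 (b - T p).
  apply: (frame_max H2 f2 mn).2 => i; rewrite bTp; exact: (ncomp_orth H2).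
have q2 : quad h1 v <= 0.
  by rewrite (negon_quad H1 _ f1.1) oppr_le0 sumr_ge0// => i _; exact: sqn_ge0.
have := Tc p; move: q1; rewrite (quadD H2) (quadN H2) (hermNr H2) reN (re_herm_sym H2) Tab.
rewrite /p (hermDl H1) reD -[re (h1 a a)]/(quad h1 a) (quadD H1) (re_herm_sym H1 a v).
lra.
Qed.

(** * Observability from the negative index of the transfer function *)

Section StateSpace.
Variables (R : realType) (X : completeNormedModType R[i]) (f : X -> X -> R[i]).
Variables (kappa : nat) (n : 'I_kappa -> X).
Hypothesis fH : hermitian_form f.
Hypothesis nf : frame f n.
Hypothesis nqE : forall x : X, nq x = quad (maj f n) x.
Variables (U Y : hilbertSpace R) (T : X * U -> X * Y).
Hypothesis TL : linear T.
Hypothesis contr : forall p, quad f (T p).1 + nq (T p).2 <= quad f p.1 + nq p.2.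

Local Notation A := (fun x => (T (x, 0)).1).
Local Notation C := (fun x => (T (x, 0)).2).
Hypothesis cA : continuous_linear A.
Hypothesis cC : continuous_linear C.

Variable S : R[i] -> U -> Y.
Hypothesis S0 : holomorphic_at S 0.
Hypothesis Sneg : has_negative_squares S kappa.
Variables a r : R.
Hypothesis a0 : 0 < a.
Hypothesis aP : forall x, nq (A x) <= a * nq x.
Hypothesis r0 : 0 < r.
Hypothesis r_half : r ^+ 2 <= 2^-1.
Hypothesis r_a : r ^+ 2 * a <= 4^-1.
Hypothesis ST : forall z u, sqn z < r ^+ 2 -> S z u =
  (T (0, u)).2 + z *: C (operator_inverse (fun x => x - z *: A x) (T (0, u)).1).

Local Notation Om := (holomorphy_domain S).
Local Notation pw := (@kpw R Y Om).
Local Notation py := (@kpy R Y Om).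
Local Notation ps := (kps (Om := Om) (sadj S)).
Local Notation h := (kform (schurker pw py ps)).
Local Notation E := (fspace R (kpoint Y Om)).
Let hH : hermitian_form h := schurform_herm pw py ps.

Definition prodform (V W : lmodType R[i]) (k : V -> V -> R[i]) (l : W -> W -> R[i])
  (p q : V * W) : R[i] := k p.1 q.1 + l p.2 q.2.

Lemma prodform_herm (V : lmodType R[i]) (k : X -> X -> R[i]) (l : V -> V -> R[i]) :
  hermitian_form k -> hermitian_form l -> hermitian_form (prodform k l).
Proof.
move=> kH lH; split=> [c x y z|x y]; rewrite /prodform /=.
  by rewrite (hermPl kH) (hermPl lH); ring.
by rewrite rmorphD /= -(herm_sym kH) -(herm_sym lH).
Qed.

Lemma prodform_frame (V : hilbertSpace R) :
  frame (prodform f (hs_dot V)) (fun i => (n i, 0 : V)).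
Proof.
have VH := hs_hermitian V.
split=> [i j|x xn]; first by rewrite /prodform /= (herm0l VH) addr0 nf.1.
rewrite /quad /prodform reD; apply: addr_ge0.
  by apply: nf.2 => i; have := xn i; rewrite /prodform /= (herm0r VH) addr0.
by rewrite -/(quad _ _) hs_quad nq_ge0.
Qed.

Let T_split x u : T (x, u) = T (x, 0) + T (0, u).
Proof. by rewrite -(linear_D _ _ TL); congr (T (_, _)); rewrite /= ?addr0 ?add0r. Qed.

Local Notation near := [set j | sqn (pw j) < r ^+ 2].

Let near_a j : near j -> sqn (pw j) * a <= 4^-1.
Proof. by move=> /= jr; apply: le_trans r_a; rewrite ler_wpM2r ?ltW. Qed.

(** The state vector of a kernel function represents the functional
    [x |-> <C (1 - w A)^-1 x, y>]. *)
Lemma state_kernel_exists : exists g : kpoint Y Om -> X, forall j, near j ->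
  forall x, f x (g j) = hs_dot Y (C (operator_inverse (fun x => x - pw j *: A x) x)) (py j).
Proof.
have YH := hs_hermitian Y.
suff /choice[g gP] j : exists g, near j -> forall x, f x g =
    hs_dot Y (C (operator_inverse (fun x => x - pw j *: A x) x)) (py j).
  by exists g.
have [jn|] := pselect (near j); last by exists 0.
have [Gc _ _] := neumann_inverse cA aP (near_a jn).
move: (operator_inverse _) Gc => G Gc.
have [c c0 cP] := bounded_of_continuous Gc.
have [d d0 dP] := bounded_of_continuous cC.
have [||g gP] := pontryagin_riesz fH nqE
  (phi := fun x => hs_dot Y (C (G x)) (py j)) (B := d * c * nq (py j)).
- by move=> b x y; rewrite Gc.1 cC.1 (hermPl YH).
- move=> x; apply: le_trans (hs_cauchy_schwarz _ _) _; rewrite [leRHS]mulrAC.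
  apply: ler_wpM2r; first exact: nq_ge0.
  apply: le_trans (dP _) _; rewrite -mulrA ler_wpM2l ?(ltW d0)//.
by exists g => _ x; rewrite gP.
Qed.

Variable g : kpoint Y Om -> X.
Hypothesis gP : forall j, near j -> forall x,
  f x (g j) = hs_dot Y (C (operator_inverse (fun x => x - pw j *: A x) x)) (py j).

Local Notation lg := (lext g).
Local Notation ly := (lext py).
Local Notation ls := (lext ps).
(** The adjoint of the multiplication by [z], for which the kernel functions are
    eigenvectors. *)
Definition backshift : E -> E := lext (fun j => (pw j)^* *: fpoint R j).

Lemma supported_backshift b : supported near b -> supported near (backshift b).
Proof.
have ML : linear backshift := lext_linear _.
move=> bn; apply: (free_ind (P := fun b => supported near (backshift b))).
- by rewrite (linear_0 ML); exact: supported0.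
- by move=> c x y xn yn; rewrite ML; exact: supported_comb.
move=> j /bn jn; rewrite /backshift lext_delta; apply: supportedZ; exact: supported_point.
Qed.

Lemma backshift_form b c : h b c - h (backshift b) (backshift c) =
  hs_dot Y (ly b) (ly c) - hs_dot U (ls b) (ls c).
Proof.
have ML : linear backshift := lext_linear _.
have yL : linear ly := lext_linear _; have sL : linear ls := lext_linear _.
have UH := hs_hermitian U; have YH := hs_hermitian Y.
apply: (free_ind (P := fun b => h b c - h (backshift b) (backshift c) =
  hs_dot Y (ly b) (ly c) - hs_dot U (ls b) (ls c))).
- by rewrite (linear_0 ML) (linear_0 yL) (linear_0 sL) !(herm0l hH) (herm0l UH) (herm0l YH).
- move=> d x y; rewrite ML yL sL !(hermPl hH) (hermPl UH) (hermPl YH) => /eqP.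
  rewrite subr_eq => /eqP -> /eqP; rewrite subr_eq => /eqP ->; ring.
move=> i _; apply: (free_ind (P := fun c => h (fpoint R i) c - h (backshift (fpoint R i)) (backshift c) =
  hs_dot Y (ly (fpoint R i)) (ly c) - hs_dot U (ls (fpoint R i)) (ls c))).
- by rewrite (linear_0 ML) (linear_0 yL) (linear_0 sL) !(herm0r hH) (herm0r UH) (herm0r YH).
- move=> d x y; rewrite ML yL sL !(hermDr hH, hermZr hH) !(hermDr UH, hermZr UH).
  rewrite !(hermDr YH, hermZr YH) => /eqP.
  rewrite subr_eq => /eqP -> /eqP; rewrite subr_eq => /eqP ->; ring.
move=> j _; rewrite /backshift !lext_delta (hermZl hH) (hermZr hH).
rewrite !(kform_delta (schurker_herm pw py ps)) /schurker conjCK.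
have := disc_neq0 (kpw1 (@domain_disc _ _ _ S) j) (kpw1 (@domain_disc _ _ _ S) i).
move: (hs_dot Y _ _) (hs_dot U _ _) (pw j) ((pw i)^*) => p q z w zw.
by field.
Qed.

(** The relation between [T] and the kernel functions says that the adjoint of
    [T] maps [(M g, y)] to [(g, s)], [M] being the backward shift: this is [1 + w (1 - w A)^-1 A = (1 - w A)^-1]. *)
Lemma kernel_relation b p : supported near b ->
  prodform f (hs_dot Y) (T p) (lg (backshift b), ly b) =
  prodform f (hs_dot U) p (lg b, ls b).
Proof.
have ML : linear backshift := lext_linear _; have gL : linear lg := lext_linear _.
have yL : linear ly := lext_linear _; have sL : linear ls := lext_linear _.
have UH := hs_hermitian U; have YH := hs_hermitian Y.
move=> bn; apply: (free_ind (P := fun b => prodform f (hs_dot Y) (T p) (lg (backshift b), ly b) =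
  prodform f (hs_dot U) p (lg b, ls b))).
- rewrite (linear_0 ML) (linear_0 gL) (linear_0 yL) (linear_0 sL) /prodform /=.
  by rewrite !(herm0r fH) (herm0r YH) (herm0r UH).
- move=> d x y; rewrite ML !gL yL sL /prodform /= !(hermDr fH, hermZr fH).
  rewrite !(hermDr YH, hermZr YH) !(hermDr UH, hermZr UH) => xE yE.
  by rewrite addrACA [RHS]addrACA -!mulrDr xE yE.
move=> j /bn jn; rewrite /backshift !lext_delta (linear_Z _ _ gL) lext_delta.
have [Gc AG GA] := neumann_inverse cA aP (near_a jn).
case: p => x u; rewrite /prodform /= (hermZr fH) conjCK !(gP jn) -(hermZl YH) -(hermDl YH).
rewrite -sadjP; last exact: kpw_Om.
rewrite (ST _ jn) -(hermDl YH); congr (hs_dot Y _ _).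
rewrite T_split /=.
move: (operator_inverse _) Gc AG GA => G Gc AG GA.
have GL : linear G := Gc.1; have CL : linear C := cC.1.
have -> : G ((T (x, 0)).1 + (T (0, u)).1) = G (T (x, 0)).1 + G (T (0, u)).1.
  exact: (linear_D _ _ GL).
have CD y z : C (y + z) = C y + C z by exact: (linear_D _ _ CL).
have CZ c y : C (c *: y) = c *: C y by exact: (linear_Z _ _ CL).
rewrite /= in CD CZ; rewrite CD scalerDr addrACA; congr (_ + _); last by rewrite addrC.
rewrite -CZ -CD -(linear_Z _ _ GL).
have /= := AG x; rewrite -scaleN1r addrC GL scaleN1r => /eqP.
by rewrite addrC subr_eq => /eqP ->; rewrite addrC.
Qed.

Definition defect_form (b c : E) : R[i] := h b c - f (lg b) (lg c).

Lemma defect_herm : hermitian_form defect_form.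
Proof.
have gL : linear lg := lext_linear _.
split=> [c x y z|x y]; rewrite /defect_form.
  by rewrite gL (hermPl hH) (hermPl fH); ring.
by rewrite rmorphB /= -(herm_sym hH) -(herm_sym fH).
Qed.

Lemma defect_backshift b : supported near b ->
  quad defect_form (backshift b) <= quad defect_form b.
Proof.
move=> bn; have UH := hs_hermitian U; have YH := hs_hermitian Y.
have := adjoint_contraction (prodform_herm fH UH) (prodform_herm fH YH)
  (prodform_frame U) (prodform_frame Y) TL _ (fun p => kernel_relation p bn).
have contr' p : quad (prodform f (hs_dot Y)) (T p) <= quad (prodform f (hs_dot U)) p.
  by rewrite /quad /prodform !reD -!/(quad _ _) !hs_quad.
move=> /(_ contr'); rewrite /quad /prodform /defect_form /= !reD !reN.
have /(congr1 (@complex.Re R)) := backshift_form b b; rewrite !reD !reN; lra.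
Qed.

Lemma defect_cvg b c : supported near b -> supported near c ->
  ccvg (fun k => defect_form (iter k backshift b) (iter k backshift c)) 0.
Proof.
have qH := defect_herm; have ML : linear backshift := lext_linear _.
have IL k : linear (iter k backshift).
  by elim: k => [//|k IH] d x y; rewrite !iterS IH ML.
have IP k j : iter k backshift (fpoint R j) = (pw j)^* ^+ k *: fpoint R j.
  elim: k => [|k IH]; first by rewrite scale1r.
  by rewrite iterS IH (linear_Z _ _ ML) /backshift lext_delta scalerA -exprSr.
pose D b c k := defect_form (iter k backshift b) (iter k backshift c).
have D0l c' : D 0 c' = fun=> 0.
  by apply/funext => k; rewrite /D (linear_0 (IL k)) (herm0l qH).
have D0r b' : D b' 0 = fun=> 0.
  by apply/funext => k; rewrite /D (linear_0 (IL k)) (herm0r qH).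
have DPl d x y c' : D (d *: x + y) c' = fun k => d * D x c' k + D y c' k.
  by apply/funext => k; rewrite /D (IL k) (hermPl qH).
have DPr d x y b' : D b' (d *: x + y) = fun k => d^* * D b' x k + D b' y k.
  by apply/funext => k; rewrite /D (IL k) (hermDr qH) (hermZr qH).
have comb0 d (s t : nat -> R[i]) : ccvg s 0 -> ccvg t 0 ->
    ccvg (fun k => d * s k + t k) 0.
  move=> s0 t0; rewrite -[0](addr0 0) -{1}[0](mulr0 d).
  by apply: ccvgD => //; apply: ccvgM => //; exact: ccvg_cst.
move=> bn cn; apply: (free_ind (P := fun b => ccvg (D b c) 0)).
- by rewrite D0l; exact: ccvg_cst.
- by move=> d x y xl yl; rewrite DPl; exact: comb0.
move=> i /bn iw; apply: (free_ind (P := fun c => ccvg (D (fpoint R i) c) 0)).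
- by rewrite D0r; exact: ccvg_cst.
- by move=> d x y xl yl; rewrite DPr; exact: comb0.
move=> j /cn jw; pose z := (pw i)^* * pw j.
have -> : D (fpoint R i) (fpoint R j) =
    (fun k => z ^+ k * defect_form (fpoint R i) (fpoint R j)).
  apply/funext => k; rewrite /D !IP (hermZl qH) (hermZr qH) rmorphXn /= conjCK.
  by rewrite mulrA -exprMn.
rewrite -(mul0r (defect_form (fpoint R i) (fpoint R j))).
apply: ccvgM; last exact: ccvg_cst.
have z1 : sqn z < 1.
  rewrite /z sqnM sqn_conj; have := sqn_ge0 (pw i); have := sqn_ge0 (pw j).
  by move: iw jw r_half; rewrite /=; nra.
move=> e e0; have [N NP] := geometric_small (sqn_ge0 z) z1 e0.
exists N => k /NP; rewrite subr0; congr (_ < e).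
by rewrite sqnX.
Qed.

(** The map sending kernel functions near the origin to state vectors decreases
    squares, since the defect decreases along the backward shift, whose powers
    tend to zero there. *)
Lemma defect_ge0 b : supported near b -> quad f (lg b) <= quad h b.
Proof.
move=> bn; suff : 0 <= quad defect_form b by rewrite /quad /defect_form reB subr_ge0.
have step k : supported near (iter k backshift b) /\
    quad defect_form (iter k backshift b) <= quad defect_form b.
  elim: k => [//|k [IH1 IH2]]; split; first exact: supported_backshift.
  exact: le_trans (defect_backshift IH1) IH2.
rewrite leNgt; apply/negP => q0.
have q2 : 0 < quad defect_form b ^+ 2 by rewrite exprn_even_gt0//= lt_eqF.
have [N /(_ N (leqnn N))] := defect_cvg bn bn q2.
rewrite subr0 (herm_quad defect_herm) sqn_real; have := (step N).2; move: q0.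
by move: (quad _ _) (quad _ _) => x y; nra.
Qed.

(** With [x = (1 - w A)^-1 v], the vanishing of all [C A^k v] gives
    [C x = w^k C A^k x], which tends to zero. *)
Lemma unobservable_orth v b : (forall j, C (iter j A v) = 0) ->
  supported near b -> f v (lg b) = 0.
Proof.
move=> Cv bn; have gL : linear lg := lext_linear _.
apply: (free_ind (P := fun b => f v (lg b) = 0)).
- by rewrite (linear_0 gL) (herm0r fH).
- by move=> c x y xE yE; rewrite gL (hermDr fH) (hermZr fH) xE yE mulr0 addr0.
move=> j /bn jn; rewrite lext_delta gP//.
have [_ _ GA] := neumann_inverse cA aP (near_a jn).
move: (GA v); move: (operator_inverse _ v) => x /= xv.
have CL : linear C := cC.1; have AL : linear A := cA.1.
have IL k : linear (iter k A) by elim: k => [//|k IH] d y z; rewrite !iterS IH AL.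
have xE k : C (iter k A x) = pw j *: C (iter k.+1 A x).
  have : C (iter k A (x - pw j *: A x)) = 0 by rewrite xv.
  rewrite -scaleNr addrC (IL k) CL -iterSr scaleNr addrC => /eqP.
  by rewrite subr_eq0 => /eqP.
have xk k : C x = pw j ^+ k *: C (iter k A x).
  elim: k => [|k IH]; first by rewrite scale1r.
  by rewrite IH xE scalerA -exprSr.
have [d d0 dP] := bounded_of_continuous cC.
have Ak k : nq (iter k A x) <= a ^+ k * nq x.
  elim: k => [|k IH]; first by rewrite mul1r.
  rewrite iterS; apply: le_trans (aP _) _.
  by rewrite exprS -mulrA ler_pM2l.
have Cx k : nq (C x) <= 4^-1 ^+ k * (d * nq x).
  rewrite (xk k) nqZ sqnX.
  apply: le_trans (_ : sqn (pw j) ^+ k * (d * (a ^+ k * nq x)) <= _).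
    rewrite ler_wpM2l ?exprn_ge0 ?sqn_ge0//; apply: le_trans (dP _) _.
    by rewrite ler_pM2l.
  rewrite (_ : _ * _ = (sqn (pw j) * a) ^+ k * (d * nq x)); last by rewrite exprMn; ring.
  apply: ler_wpM2r; first by rewrite mulr_ge0 ?nq_ge0 ?(ltW d0).
  apply: lerXn2r; rewrite ?nnegrE ?mulr_ge0 ?sqn_ge0 ?(ltW a0)//.
  exact: (near_a jn).
suff Cx0 : C x = 0 by rewrite /= in Cx0; rewrite Cx0 (herm0l (hs_hermitian Y)).
apply/eqP; rewrite -nq_eq0 eq_le nq_ge0 andbT leNgt; apply/negP => C0.
have K0 : 0 < d * nq x + 1 by rewrite ltr_wpDl// mulr_ge0 ?nq_ge0 ?(ltW d0).
have q0 : 0 <= 4^-1 :> R by rewrite invr_ge0.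
have q1 : 4^-1 < 1 :> R by rewrite invf_lt1// ltr1n.
have [N /(_ N (leqnn N))] := geometric_small q0 q1 (divr_gt0 C0 K0).
rewrite ltr_pdivlMr//; apply/negP; rewrite -leNgt; apply: le_trans (Cx N) _.
by rewrite ler_wpM2l ?exprn_ge0// lerDl.
Qed.

(** Every negative square of the kernel is realized near the origin, hence by
    state vectors orthogonal to the unobservable ones, which are therefore confined
    to a positive subspace. *)
Lemma unobservable_positive v : (forall j, C (iter j A v) = 0) ->
  quad f v <= 0 -> v = 0.
Proof.
move=> Cv qv; have gL : linear lg := lext_linear _.
have [m mf] := schur_frame Sneg.
have O0 : Om 0 by split=> //; rewrite normr0.
have [b [bn bs]] := localize (@domain_disc _ _ _ S) (@domain_open _ _ _ S) O0
  (fun z y e => @sadj_continuous _ _ _ S z y e) mf r0.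
have gn : negdef f (fun i => lg (b i)).
  move=> c c0; rewrite -(lincomb_lin _ _ gL); apply: le_lt_trans (bn c c0).
  by apply: defect_ge0; exact: supported_lincomb.
have [k [kn kE]] := gram_schmidt fH gn.
apply/eqP; apply: contraT => v0; have vk i : f v (k i) = 0.
  have [c ->] : lspan (fun i => lg (b i)) (k i).
    by rewrite -kE; exists (fun j => (j == i)%:R); rewrite lincomb_delta.
  rewrite -(lincomb_lin _ _ gL); apply: unobservable_orth => //.
  exact: supported_lincomb.
have := pos_of_orth fH nf nqE kn vk v0.
by rewrite ltNge qv.
Qed.

End StateSpace.

(** * Passive systems *)

Section Passive.
Variables (R : realType) (kappa : nat).
Variables (X : pontryaginSpace R kappa) (U Y : hilbertSpace R).
Variable Sigma : system X U Y.

Let inject_continuous : continuous (fun x : X => (x, 0 : U)).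
Proof. by move=> x; apply: cvg_pair; [exact: cvg_id|exact: cvg_cst]. Qed.

Let inject_linear c (x y : X) : (c *: x + y, 0 : U) = c *: (x, 0 : U) + (y, 0).
Proof. by congr (_, _); rewrite /= ?scaler0 ?addr0. Qed.

Let open_loop_continuous : continuous (fun x : X => Sigma (x, 0)).
Proof.
suff : continuous (Sigma \o (fun x : X => (x, 0 : U))) by [].
move=> x; apply: continuous_comp; first exact: inject_continuous.
exact: sys_continuous.
Qed.

Lemma main_operator_clin : continuous_linear (main_operator Sigma).
Proof.
split=> [c x y|x]; first by rewrite /main_operator inject_linear linearP.
suff : {for x, continuous (fst \o (fun x : X => Sigma (x, 0)))} by [].
apply: continuous_comp; first exact: open_loop_continuous.
exact: cvg_fst.
Qed.

Lemma output_operator_clin : continuous_linear (output_operator Sigma).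
Proof.
split=> [c x y|x]; first by rewrite /output_operator inject_linear linearP.
suff : {for x, continuous (snd \o (fun x : X => Sigma (x, 0)))} by [].
apply: continuous_comp; first exact: open_loop_continuous.
exact: cvg_snd.
Qed.

Lemma passive_contr : passive Sigma -> forall p : X * U,
  quad (ps_form X) (Sigma p).1 + nq (Sigma p).2 <= quad (ps_form X) p.1 + nq p.2.
Proof.
move=> pS [x u]; have := pS x u; rewrite lecE => /andP[_].
by rewrite !reD -!hs_quad.
Qed.

(** Near the origin the Neumann series converges, and the function of the Schur
    class is the transfer function. *)
Lemma passive_unobservable v : passive Sigma ->
  germ_in_generalized_schur kappa (transfer_function Sigma) ->
  (forall j, output_operator Sigma (iter j (main_operator Sigma) v) = 0) ->
  quad (ps_form X) v <= 0 -> v = 0.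
Proof.
move=> pS [S [_ S0 Sneg] /near_complexP[r1 r10 r1P]] Cv qv.
have [n [nf nqE]] := pontryagin_frame X.
have fH : hermitian_form (ps_form X) := hermitian_dot _.
have cA := main_operator_clin; have cC := output_operator_clin.
have [a a0 aP] := bounded_of_continuous cA.
pose t := (2 * (a + 1))^-1.
have ta : t * (2 * (a + 1)) = 1 by rewrite mulVf// gt_eqF// mulr_gt0// addr_gt0.
have t0 : 0 < t by rewrite invr_gt0 mulr_gt0// addr_gt0.
pose r := Num.min r1 t.
have r0 : 0 < r by rewrite lt_min r10 t0.
have rt : r ^+ 2 <= t ^+ 2 by rewrite ler_pXn2r ?nnegrE ?(ltW r0) ?(ltW t0)// ge_min lexx orbT.
have t2 : t ^+ 2 <= 2^-1 by nra.
have t2a : t ^+ 2 * a <= 4^-1 by nra.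
have ST z u : sqn z < r ^+ 2 -> S z u = transfer_function Sigma z u.
  move=> zr; apply: r1P; rewrite subr0; apply: lt_le_trans zr _.
  by rewrite ler_pXn2r ?nnegrE ?(ltW r0) ?(ltW r10)// ge_min lexx.
have r_half := le_trans rt t2.
have r_a : r ^+ 2 * a <= 4^-1 by apply: le_trans t2a; rewrite ler_wpM2r ?(ltW a0).
have SL : linear Sigma by move=> c x y; rewrite linearP.
have [g gP] := state_kernel_exists fH nqE cA cC S a0 aP r_a.
exact: (unobservable_positive fH nf nqE SL (passive_contr pS) cA cC S0 Sneg a0 aP
  r0 r_half r_a ST gP Cv qv).
Qed.

End Passive.

Theorem proposition3p10 (R : realType) (kappa : nat)
    (X : pontryaginSpace R kappa) (U Y : hilbertSpace R)
    (Sigma : system X U Y) :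
  passive Sigma ->
  germ_in_generalized_schur kappa (transfer_function Sigma) ->
  (exists! D : set X * set X,
     fundamental_decomposition (ps_form X) D.1 D.2 /\
     main_operator Sigma @` D.1 `<=` D.1) /\
  (exists! D : set X * set X,
     fundamental_decomposition (ps_form X) D.1 D.2 /\
     main_operator Sigma @` D.2 `<=` D.2).
Proof.
move=> pS gS; have [n [nf nqE]] := pontryagin_frame X.
have fH : hermitian_form (ps_form X) := hermitian_dot _.
have cA := main_operator_clin Sigma; have cC := output_operator_clin Sigma.
have dissip x : quad (ps_form X) (main_operator Sigma x) + nq (output_operator Sigma x)
    <= quad (ps_form X) x.
  by have := passive_contr pS (x, 0); rewrite /= nq0 addr0.
have obs v : (forall j, output_operator Sigma (iter j (main_operator Sigma) v) = 0) ->
    quad (ps_form X) v <= 0 -> v = 0 by exact: passive_unobservable.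
split.
  exact: (posinv_decomposition fH nf nqE cA cC dissip obs).
exact: (neginv_decomposition fH nf nqE cA cC dissip obs).
Qed.
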